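(* Let $\Omega\subset\mathbb{H}^N$ be a bounded smooth domain, $0<s<1<p<Q$ with $Q=2N+2$, and $\alpha>0$. Let $\delta:\overline{\Omega}\to(0,\infty)$ be a continuous function for which there exist constants $\delta_*\ge1$ and $\epsilon>0$ such that $\delta(x)\le\delta_*$ for all $x\in\Omega_\epsilon:=\{y\in\Omega:\operatorname{dist}(y,\partial\Omega)<\epsilon\}$. Let $f\in L^m(\Omega)\setminus\{0\}$ be nonnegative, and let $u=\lim_{n\to\infty}u_n$ be the weak solution of $$-\Delta_{H,p}u+\alpha(-\Delta_{H,p})^s u=f(x)u^{-\delta(x)}\ \text{in }\Omega,\qquad u>0\ \text{in }\Omega,\qquad u=0\ \text{in }\mathbb{H}^N\setminus\Omega$$ obtained as the pointwise limit of the approximate solutions $u_n$ described in the context. Then: (i) if $m\in\left[\frac{Q(\delta_*+p-1)}{Q(p-1)+\delta_*p},\frac{Q}{p}\right)$, then $u\in L^t(\Omega)$, where $t=m'\gamma$ and $\gamma=\frac{Q(p-1)(m-1)}{Q-mp}$; (ii) if $m>\frac{Q}{p}$, then $u\in L^\infty(\Omega)$.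
   Context: Heisenberg group. $N\ge1$ is an integer; $\mathbb{H}^N$ is $\mathbb{R}^{2N+1}$ with group law $\xi\circ\eta=(x_1+y_1,\dots,x_{2N}+y_{2N},\tau+\tau'+\frac12\sum_{i=1}^N(x_iy_{N+i}-x_{N+i}y_i))$ for $\xi=(x_1,\dots,x_{2N},\tau)$, $\eta=(y_1,\dots,y_{2N},\tau')$. Horizontal vector fields: $X_i=\partial_{x_i}-\frac{x_{N+i}}2\partial_\tau$, $X_{N+i}=\partial_{x_{N+i}}+\frac{x_i}2\partial_\tau$, $1\le i\le N$; $\nabla_Hu=(X_1u,\dots,X_{2N}u)$ (weak sense). $|\xi|=((\sum_{i=1}^{2N}x_i^2)^2+\tau^2)^{1/4}$. Measure is Lebesgue measure on $\mathbb{R}^{2N+1}$; $\operatorname{dist}$ is taken with respect to the Carnot–Carathéodory distance. For $l>1$, $l'=\frac{l}{l-1}$. Function spaces. $HW^{1,p}(\Omega)=\{u\in L^p(\Omega):\nabla_Hu\in L^p(\Omega)\}$; $HW^{1,p}_{\mathrm{loc}}(\Omega)$ is the set of $u$ with $u\in HW^{1,p}(\Omega')$ for every open $\Omega'\Subset\Omega$; $HW^{1,p}_0(\Omega)=\{u\in HW^{1,p}(\mathbb{H}^N):u=0\text{ in }\mathbb{H}^N\setminus\Omega\}$. $J_p(t)=|t|^{p-2}t$ and $d\mu=\frac{dx\,dy}{|y^{-1}\circ x|^{Q+sp}}$. Operators. $\Delta_{H,p}u=\operatorname{div}(|\nabla_Hu|^{p-2}\nabla_Hu)$ (horizontal divergence),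 $(-\Delta_{H,p})^su(x)=\mathrm{P.V.}\int_{\mathbb{H}^N}\frac{J_p(u(x)-u(y))}{|y^{-1}\circ x|^{Q+sp}}\,dy$; both are understood through weak formulations. Approximate solutions. For $n\in\mathbb{N}$ let $f_n=\min\{f,n\}$, and let $u_n\in HW^{1,p}_0(\Omega)\cap L^\infty(\Omega)$ be the unique positive function satisfying, for all $\varphi\in HW^{1,p}_0(\Omega)$, $$\int_\Omega|\nabla_Hu_n|^{p-2}\nabla_Hu_n\cdot\nabla_H\varphi\,dx+\alpha\int_{\mathbb{H}^N}\int_{\mathbb{H}^N}J_p(u_n(x)-u_n(y))(\varphi(x)-\varphi(y))\,d\mu=\int_\Omega f_n(x)\Big(u_n^++\frac1n\Big)^{-\delta(x)}\varphi\,dx.$$ The sequence $\{u_n\}$ exists and is nondecreasing in $n$, and $u$ denotes its pointwise limit. Weak solution. $u\in HW^{1,p}_{\mathrm{loc}}(\Omega)\cap L^{p-1}(\Omega)$ is a weak solution of the singular problem if $u=0$ in $\mathbb{H}^N\setminus\Omega$; $u\ge0$ and $(u-\theta)^+\in HW^{1,p}_0(\Omega)$ for every $\theta>0$; for every $\omega\Subset\Omega$ there is $C(\omega)>0$ with $u\ge C(\omega)$ a.e. in $\omega$; and for every $\varphi\in C^1_c(\Omega)$ the displayed identity holds with $u_n$ replaced by $u$ and right-hand side $\int_\Omega f u^{-\delta(x)}\varphi\,dx$. *)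

(* Defs.v *)
From HB Require Import structures.
From mathcomp Require Import all_boot all_order all_algebra.
From mathcomp Require Import all_classical all_reals all_analysis.
Set Implicit Arguments. Unset Strict Implicit. Unset Printing Implicit Defensive.
Import Order.TTheory GRing.Theory Num.Theory.
Import numFieldNormedType.Exports.
Local Open Scope classical_set_scope.
Local Open Scope ring_scope.

(* Row vectors carry no measurable structure in the library: as for tuples, we
   take the sigma-algebra generated by the coordinates (for 'rV[R]_n these are
   the Borel sets). *)
Section measurable_rV.
Context {R : realType} {n : nat}.
Let coord (i : 'I_n) (v : 'rV[R]_n) : R := v ord0 i.
Let sig := g_sigma_preimage coord.
Let sig0 : sig set0. Proof. exact: sigma_algebra0. Qed.
Let sigC A : sig A -> sig (~` A). Proof. exact: sigma_algebraC. Qed.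
Let sigU (F : (set 'rV[R]_n)^nat) : (forall i, sig (F i)) -> sig (\bigcup_i F i).
Proof. exact: sigma_algebra_bigcup. Qed.
HB.instance Definition _ := @isMeasurable.Build default_measure_display
  'rV[R]_n sig sig0 sigC sigU.

Lemma measurable_coord (i : 'I_n) :
  measurable_fun [set: 'rV[R]_n] (fun v : 'rV[R]_n => v ord0 i).
Proof.
move=> _ Y mY; rewrite setTI; apply: sub_sigma_algebra => /=.
rewrite -bigcup_seq/=; exists i => /=; first by rewrite mem_index_enum.
by exists Y => //; rewrite setTI.
Qed.

Lemma measurable_fun_coord d (T : measurableType d) (f : T -> 'rV[R]_n) :
  (forall i, measurable_fun [set: T] (fun x => f x ord0 i)) ->
  measurable_fun [set: T] f.
Proof.
move=> mf.
suff fS : g_sigma_preimage (fun i => coord i \o f) `<=` measurable.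
  by move=> _ A mA; apply: fS; rewrite g_sigma_preimage_comp; exists A.
apply: smallest_sub; first exact: sigma_algebra_measurable.
rewrite -bigcup_seq/=; apply: bigcup_sub => i _.
by move=> A [B mB <-]; exact: mf.
Qed.
End measurable_rV.

Section lebesgue_rV_step.
Context {R : realType} {n : nat} (m : {sigma_finite_measure set 'rV[R]_n -> \bar R}).

Definition rV_cons (p : R * 'rV[R]_n) : 'rV[R]_n.+1 := 
  \row_i if unlift ord0 i is Some j then p.2 ord0 j else p.1.

Lemma measurable_rV_cons : measurable_fun [set: R * 'rV[R]_n] rV_cons.
Proof.
apply: measurable_fun_coord => i; rewrite /rV_cons.
under eq_fun do rewrite mxE.
case: unliftP => [j _|_]; last exact: measurable_fst.
exact: measurableT_comp (measurable_coord j) measurable_snd.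
Qed.

Definition rV_uncons (v : 'rV[R]_n.+1) : R * 'rV[R]_n :=
  (v ord0 ord0, \row_(j < n) v ord0 (lift ord0 j)).

Lemma measurable_rV_uncons : measurable_fun [set: 'rV[R]_n.+1] rV_uncons.
Proof.
apply: measurable_fun_pair; first exact: measurable_coord.
apply: measurable_fun_coord => i; under eq_fun do rewrite mxE.
exact: measurable_coord.
Qed.

Lemma rV_consK : cancel rV_cons rV_uncons.
Proof.
move=> [x v]; rewrite /rV_uncons /rV_cons; congr pair.
  by rewrite mxE unlift_none.
by apply/rowP => j; rewrite !mxE liftK.
Qed.

Definition lebesgue_rV_step : set 'rV[R]_n.+1 -> \bar R :=
  pushforward (lebesgue_measure \x m)%E rV_cons.

Let step0 : lebesgue_rV_step set0 = 0%E.
Proof. by rewrite /lebesgue_rV_step /pushforward preimage_set0 measure0. Qed.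

Let step_ge0 A : (0 <= lebesgue_rV_step A)%E.
Proof.
exact: (@measure_ge0 _ _ _
  (measure_function_pushforward__canonical__measure_function_Measure
    (lebesgue_measure \x m)%E measurable_rV_cons)).
Qed.

Let step_sigma_additive : semi_sigma_additive lebesgue_rV_step.
Proof.
exact: (@measure_semi_sigma_additive _ _ _
  (measure_function_pushforward__canonical__measure_function_Measure
    (lebesgue_measure \x m)%E measurable_rV_cons)).
Qed.

HB.instance Definition _ := isMeasure.Build _ _ _ lebesgue_rV_step
  step0 step_ge0 step_sigma_additive.

Let step_sigma_finite : sigma_finite setT lebesgue_rV_step.
Proof.
have /sigma_finiteP[F [FT ndF Foo]] :=
  sigma_finiteT (@lebesgue_measure R : {sigma_finite_measure set _ -> \bar R}).
have /sigma_finiteP[G [GT ndG Goo]] := sigma_finiteT m.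
exists (fun k => rV_uncons @^-1` (F k `*` G k)).
  apply/esym; rewrite -subTset => v _.
  have [i _ Fi] : (\bigcup_i F i) (v ord0 ord0) by rewrite -FT.
  have [j _ Gj] : (\bigcup_i G i) (rV_uncons v).2 by rewrite -GT.
  exists (maxn i j) => //; split => /=.
  - by move: Fi; exact/subsetPset/ndF/leq_maxl.
  - by move: Gj; exact/subsetPset/ndG/leq_maxr.
move=> k; have [mFk Fk] := Foo k; have [mGk Gk] := Goo k; split.
  rewrite -[X in measurable X]setTI; apply: measurable_rV_uncons => //.
  exact: measurableX.
rewrite /lebesgue_rV_step /pushforward -comp_preimage.
rewrite (_ : _ \o _ = id); last by rewrite funeqE => x; exact: rV_consK.
rewrite preimage_id product_measure1E//.
by rewrite lte_mul_pinfty// ge0_fin_numE.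
Qed.

HB.instance Definition _ := @Measure_isSigmaFinite.Build _ _ _ lebesgue_rV_step
  step_sigma_finite.
End lebesgue_rV_step.

(* n-dimensional Lebesgue measure: the n-fold product of the library's
   one-dimensional [lebesgue_measure], carried over to row vectors. *)
Fixpoint lebesgue_rV {R : realType} (n : nat) :
    {sigma_finite_measure set 'rV[R]_n -> \bar R} :=
  match n with
  | 0 => \d_(0 : 'rV[R]_0)
  | n.+1 => lebesgue_rV_step (lebesgue_rV n)
  end.

Arguments lebesgue_rV : clear implicits.

Lemma measurable_box (R : realType) n (A : 'I_n -> set R) :
  (forall i, measurable (A i)) ->
  measurable [set v : 'rV[R]_n | forall i, A i (v ord0 i)].
Proof.
move=> mA; rewrite (_ : [set _ | _] =
    \bigcap_(i in [set: 'I_n]) ((fun v : 'rV[R]_n => v ord0 i) @^-1` A i)).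
  apply: fin_bigcap_measurable => // i _.
  by rewrite -[X in measurable X]setTI; apply: measurable_coord.
by apply/seteqP; split => v vA i; [move=> _; exact: vA|exact: (vA i)].
Qed.

Lemma lebesgue_rV_box (R : realType) n (A : 'I_n -> set R) :
  (forall i, measurable (A i)) ->
  lebesgue_rV R n [set v | forall i, A i (v ord0 i)] =
  (\prod_(i < n) lebesgue_measure (A i))%E.
Proof.
elim: n A => [|n ih] A mA.
  by rewrite big_ord0 /= diracE mem_set// => -[].
rewrite big_ord_recl -(ih (fun i => A (lift ord0 i)))//=.
transitivity ((lebesgue_measure \x lebesgue_rV R n)%E (A ord0 `*`
    [set v : 'rV[R]_n | forall i : 'I_n, A (lift ord0 i) (v ord0 i)])).
  rewrite /lebesgue_rV_step /pushforward; congr (_ _).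
  apply/seteqP; split => -[x v] /=.
    move=> h; split => [|i]; first by have := h ord0; rewrite mxE unlift_none.
    by have := h (lift ord0 i); rewrite mxE liftK.
  by move=> [xA vA] i; rewrite mxE; case: unliftP => [j ->|->].
rewrite product_measure1E//; first exact: mA.
by apply: (@measurable_box R n (fun i => A (lift ord0 i))) => i; exact: mA.
Qed.

Section euclidean.
Context {R : realType} {n : nat}.
Local Notation V := 'rV[R]_n.
Implicit Types (A B D : set V) (f g : V -> R).

Local Notation mu := (lebesgue_rV R n).

Definition boundary A : set V := closure A `\` A°.

(* A ⋐ B *)
Definition compactly_in A B := compact (closure A) /\ closure A `<=` B.

Fixpoint is_Ck (k : nat) f : Prop :=
  if k is k'.+1 then
    continuous f /\ forall i : 'I_n,
      (forall x, derivable f x (delta_mx ord0 i)) /\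
      is_Ck k' (fun x => 'D_(delta_mx ord0 i) f x)
  else continuous f.

Definition is_smooth f := forall k, is_Ck k f.

Definition compact_supp_in D f :=
  compact (closure [set x | f x != 0]) /\ closure [set x | f x != 0] `<=` D.

Definition Ckc k D f := is_Ck k f /\ compact_supp_in D f.

Definition test_fun D f := is_smooth f /\ compact_supp_in D f.

(* Near each boundary point, D is the sublevel set of a smooth function whose
   gradient does not vanish at that point. *)
Definition smooth_boundary D := forall x, boundary D x ->
  exists (U : set V) (rho : V -> R),
    [/\ open U, U x, is_smooth rho,
        exists i : 'I_n, 'D_(delta_mx ord0 i) rho x != 0 &
        D `&` U = [set y | rho y < 0] `&` U].

Definition bounded_smooth_domain D :=
  [/\ open D, connected D, D !=set0, bounded_set D & smooth_boundary D].

Definition dotv (v w : V) : R := \sum_i v ord0 i * w ord0 i.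

(* The library norm on row vectors is the sup norm; this is the Euclidean one. *)
Definition enorm (v : V) : R := Num.sqrt (dotv v v).

(* f is in L^q(D), for 0 < q <= +oo; only the values of f on D matter. *)
Definition LpOn D (q : \bar R) f := f \_ D \in Lfun mu q.

Definition L1loc D f := measurable_fun D f /\
  forall K : set V, compact K -> K `<=` D -> mu.-integrable K (EFin \o f).

(* Absolute continuity on [a, b]; I lists disjoint subintervals. *)
Definition abs_continuous (a b : R) (g : R -> V) := forall e : R, 0 < e ->
  exists2 d : R, 0 < d &
  forall (k : nat) (I : 'I_k -> R * R),
    (forall i, a <= (I i).1 /\ (I i).1 <= (I i).2 /\ (I i).2 <= b) ->
    (forall i j, i != j -> (I i).2 <= (I j).1 \/ (I j).2 <= (I i).1) ->
    \sum_i ((I i).2 - (I i).1) < d ->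
    \sum_i enorm (g (I i).2 - g (I i).1) < e.

End euclidean.

(* The horizontal gradient takes values in 'rV_(N + N); its components are
   ordered X_1, ..., X_2N. Points of the Heisenberg group are row vectors
   (x_1, ..., x_2N, tau). *)
Section heisenberg.
Context {R : realType} {N : nat}.
Local Notation H := 'rV[R]_(N + N + 1).
Implicit Types (x y : H) (u v phi : H -> R) (Omega : set H).

Local Notation mu := (lebesgue_rV R (N + N + 1)).

Definition hX (x : H) (i : 'I_(N + N)) : R := x ord0 (lshift 1 i).
Definition hT (x : H) : R := x ord0 (rshift (N + N) ord0).

Definition hmul x y : H :=
  row_mx (\row_i (hX x i + hX y i))
    (const_mx (hT x + hT y + 2^-1 * \sum_(i < N)
       (hX x (lshift N i) * hX y (rshift N i) -
        hX x (rshift N i) * hX y (lshift N i)))).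

Definition hinv x : H := - x.

Lemma hmulVx x : hmul (hinv x) x = 0.
Proof.
apply/rowP => j; rewrite /hmul /hinv [in RHS]mxE.
case: (split_ordP j) => i ->.
  by rewrite row_mxEl mxE /hX mxE addNr.
rewrite row_mxEr mxE /hT mxE addNr add0r big1 ?mulr0// => k _.
by rewrite /hX !mxE !mulNr opprK addrC mulrC subrr.
Qed.

Definition hnorm x : R :=
  ((\sum_i hX x i ^+ 2) ^+ 2 + hT x ^+ 2) `^ 4^-1.

Definition hdim : R := (2 * N + 2)%:R.

(* The horizontal vector fields: hfield i x is the value of X_(i+1) at x. *)
Definition hfield (i : 'I_(N + N)) (x : H) : H :=
  delta_mx ord0 (lshift 1 i) +
  (match fintype.split i with
   | inl j => - (hX x (rshift N j) / 2)
   | inr j => hX x (lshift N j) / 2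
   end) *: delta_mx ord0 (rshift (N + N) ord0).

Local Notation unit_itv := (`[0%R, 1%R]%classic : set R).

(* Lengths of the absolutely continuous horizontal curves from x to y:
   g' = \sum_i c_i X_i(g) almost everywhere, of length \int |c|. *)
Definition hcurve_length x y : set (\bar R) :=
  [set L | exists (g : R -> H) (c : R -> 'rV[R]_(N + N)),
    [/\ abs_continuous 0 1 g, g 0 = x /\ g 1 = y,
        measurable_fun unit_itv c,
        {ae lebesgue_measure, forall t : R, unit_itv t ->
           is_derive t (1 : R) g (\sum_i c t ord0 i *: hfield i (g t))} &
        L = (\int[lebesgue_measure]_(t in unit_itv) (enorm (c t))%:E)%E]].

Definition cc_dist x y : \bar R := ereal_inf (hcurve_length x y).

Definition cc_dist_set x (A : set H) : \bar R := ereal_inf [set cc_dist x y | y in A].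

(* G is the weak horizontal gradient of u in Omega; the X_i are divergence
   free, so that the formal adjoint of X_i is - X_i. *)
Definition weak_hgrad Omega u (G : H -> 'rV[R]_(N + N)) :=
  L1loc Omega u /\
  forall i, L1loc Omega (fun x => G x ord0 i) /\
    forall phi, test_fun Omega phi ->
      \int[mu]_(x in Omega) (u x * 'D_(hfield i x) phi x) =
      - \int[mu]_(x in Omega) (G x ord0 i * phi x).

Definition HW Omega (p : R) u := LpOn Omega p%:E u /\
  exists2 G, weak_hgrad Omega u G & LpOn Omega p%:E (fun x => enorm (G x)).

Definition HWloc Omega (p : R) u := forall Omega' : set H,
  open Omega' -> compactly_in Omega' Omega -> HW Omega' p u.

Definition HW0 Omega (p : R) u :=
  HW setT p u /\ {ae mu, forall x, ~ Omega x -> u x = 0}.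

Definition Jp (p t : R) : R := `|t| `^ (p - 2) * t.

(* The weak form of - Delta_{H,p} u + alpha (- Delta_{H,p})^s u = rhs in Omega,
   tested against phi. That the integrals exist is part of the identity (the
   library integral is total). The weak gradients are only defined up to null
   sets, so the identity is stated for all representatives. *)
Definition weak_identity Omega (p s alpha : R) (rhs u phi : H -> R) :=
  forall Gu Gphi, weak_hgrad Omega u Gu -> weak_hgrad Omega phi Gphi ->
  let loc x := enorm (Gu x) `^ (p - 2) * dotv (Gu x) (Gphi x) in
  let nonloc (z : H * H) := Jp p (u z.1 - u z.2) * (phi z.1 - phi z.2) /
    hnorm (hmul (hinv z.2) z.1) `^ (hdim + s * p) in
  [/\ mu.-integrable Omega (EFin \o loc),
      (mu \x mu)%E.-integrable setT (EFin \o nonloc),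
      mu.-integrable Omega (EFin \o (rhs \* phi)) &
      \int[mu]_(x in Omega) loc x + alpha * \int[(mu \x mu)%E]_z nonloc z =
      \int[mu]_(x in Omega) (rhs x * phi x)].

Definition approx_solution Omega (p s alpha : R) (delta f : H -> R) (n : nat) v :=
  [/\ HW0 Omega p v, LpOn Omega +oo%E v,
      {ae mu, forall x, Omega x -> 0 < v x} &
      forall phi, HW0 Omega p phi ->
        weak_identity Omega p s alpha
          (fun x => Num.min (f x) n%:R *
                    (Num.max (v x) 0 + n%:R^-1) `^ (- delta x)) v phi].

Definition weak_solution Omega (p s alpha : R) (delta f u : H -> R) :=
  [/\ HWloc Omega p u /\ LpOn Omega (p - 1)%:E u,
      {ae mu, forall x, ~ Omega x -> u x = 0},
      {ae mu, forall x, 0 <= u x} /\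
      forall theta : R, 0 < theta -> HW0 Omega p (fun x => Num.max (u x - theta) 0),
      forall omega : set H, compactly_in omega Omega ->
        exists2 C : R, 0 < C & {ae mu, forall x, omega x -> C <= u x} &
      forall phi, Ckc 1 Omega phi ->
        weak_identity Omega p s alpha
          (fun x => f x * u x `^ (- delta x)) u phi].

End heisenberg.

Arguments hdim R N : clear implicits.

Definition conj_exp {R : realType} (l : R) : R := l / (l - 1).

(* Main.v *)
(* Write T^i_t x = x (exp t X_i) for the flow of X_i. A weak horizontal gradient G of u
   is the same as u o T^i_t - u = int_0^t G_i o T^i_r dr a.e. for all t > 0. Chain rules
   along flows thus reduce to one dimension, and truncations Psi(u_n), with Psi' the tent
   function on [k, k + h] and k >= 1, are admissible test functions. The nonlocal term is
   nonnegative and (u_n + 1/n)^(- delta) <= 1 where u_n >= 1, so testing gives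
   int Psi'(u_n) |grad u_n|^p <= E := (h/2) int_{u_n > k} f.
   Every group element y in a box of radius r is a product of boundedly many horizontal
   exponentials of time O(r) (the centre is reached by commutators), so
   int |w(x y) - w(x)|^p dx <= C r^p E for w = Psi(u_n). Averaging over a box of measure
   at least twice a(k) := |{u_n > k}|, half of the translates x y of a point of
   {u_n > k + h} leave {u_n > k}, whence
     h^(p-1) a(k + h) <= C a(k)^(p/Q) int_{u_n > k} f,
   uniformly in n. By Hoelder this is Stampacchia's iteration when m > Q/p. When m < Q/p,
   sum it over the dyadic levels k = h = 2^j with weights 2^(j t): the sum S satisfies
   S <= |Omega| + C S^(p/Q + 1 - 1/m) with exponent < 1, so S is bounded; conclude by
   Fatou. *)

Require Import Defs.
From HB Require Import structures.
From mathcomp Require Import all_boot all_order all_algebra.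
From mathcomp Require Import all_classical all_reals all_analysis.
From mathcomp Require Import measurable_realfun.
From mathcomp Require Import ring lra.
Import Order.TTheory GRing.Theory Num.Theory.
Import numFieldNormedType.Exports.
Local Open Scope classical_set_scope.
Local Open Scope ring_scope.

Set Implicit Arguments.
Unset Strict Implicit.
Unset Printing Implicit Defensive.

(** Sobolev's inequality and mollification are both bypassed. Flows of X_i preserve the measure and
    map test functions to test functions, so a weak derivative can be integrated along them exactly;
    the homogeneous dimension enters only through the volume r^Q of a box with sides of order r and
    r^2. The tent function is preferred to a plain truncation because its primitive is C^{1,1}: the
    chain rule then follows from a quadratic Taylor bound and bisection, although u is merely
    absolutely continuous along almost every flow line. As only levels k >= 1 occur, the exponent
    delta leaves the estimates; delta_* survives in the lower bound on m, which yields m > 1 and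
    gamma >= 1. The exponents come from two requirements: the dyadic weights must balance in the
    decay estimate, t (1 - p/Q) = gamma + p - 1, and Hoelder turns weights 2^(j gamma) into 2^(j m'
    gamma), so t = m' gamma. Solving gives the gamma of the theorem. Absorbing a power of S requires
    S finite beforehand, so the levels stop at 2^J and all bounds are uniform in J and n; at the end
    J and n tend to infinity together. *)

(** * Lebesgue measure on boxes *)

Section boxes.
Context {R : realType} {n : nat}.
Local Notation V := 'rV[R]_n.

Lemma norm_coord_le (v : V) i : `|v ord0 i| <= `|v|.
Proof.
have -> : `|v| = mx_norm v by [].
by rewrite mx_normrE (le_bigmax _ (fun j : 'I_1 * 'I_n => `|v j.1 j.2|) (ord0, i)).
Qed.

Definition obox (a b : 'I_n -> R) : set V :=
  [set v | forall i, a i < v ord0 i < b i].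

Lemma oboxE a b : obox a b =
  [set v | forall i, (fun i => `]a i, b i[%classic) i (v ord0 i)].
Proof. by apply/seteqP; split => v vab i; have := vab i; rewrite /= in_itv. Qed.

Lemma measurable_obox a b : measurable (obox a b).
Proof. rewrite oboxE.
by apply: (@measurable_box R n (fun i => `]a i, b i[%classic)) => i; exact: measurable_itv. Qed.

Lemma obox_setI a b c d : obox a b `&` obox c d =
  obox (fun i => Num.max (a i) (c i)) (fun i => Num.min (b i) (d i)).
Proof.
apply/seteqP; split => [v [vab vcd] i|v vh].
  have /andP[? ?] := vab i; have /andP[? ?] := vcd i.
  by rewrite gt_max lt_min; apply/andP; split; apply/andP.
by split => i; have /andP[] := vh i; rewrite gt_max lt_min => /andP[? ?] /andP[? ?];
  apply/andP.
Qed.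

Lemma obox_cover : \bigcup_k obox (fun=> - k%:R) (fun=> k%:R) = [set: V].
Proof.
apply/seteqP; split => // v _.
have [k vk] : exists k : nat, `|v| < k%:R.
  by exists (Num.Def.truncn `|v|).+1; rewrite truncnS_gt.
exists k => // i; rewrite -ltr_norml; apply: le_lt_trans vk.
exact: norm_coord_le.
Qed.

(** The preimage of an open interval under one coordinate is the countable union of the boxes whose
    other sides are ]-k, k[. *)
Lemma measurable_rV_obox :
  (measurable : set (set V)) = <<s [set A | exists a b, A = obox a b] >>.
Proof.
apply/seteqP; split; last first.
  apply: smallest_sub; first exact: sigma_algebra_measurable.
  by move=> _ [a [b ->]]; exact: measurable_obox.
apply: smallest_sub; first exact: smallest_sigma_algebra.
rewrite -bigcup_seq/=; apply: bigcup_sub => i _.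
have Emeas : (measurable : set (set (measurableTypeR R))) = <<s @RGenOpens.G R >>.
  exact: RGenOpens.measurableE.
rewrite [X in preimage_set_system _ _ X](_ : _ = <<s @RGenOpens.G R >>)//.
rewrite -[X in X `<=` _]g_sigma_preimageE.
apply: smallest_sub; first exact: smallest_sigma_algebra.
move=> _ [_ [x [y ->]] <-]; rewrite setTI.
rewrite (_ : _ @^-1` _ = \bigcup_k (obox (fun j => if j == i then x else - k%:R)
   (fun j => if j == i then y else k%:R))).
  have GS := @sigma_algebra_bigcup _ setT [set A | exists a b, A = obox a b].
  apply: (GS) => k.
  by apply: sub_sigma_algebra; do 2 eexists.
apply/seteqP; split => [v /=|v [k _ /(_ i)]]; last by rewrite eqxx /= in_itv.
rewrite in_itv/= => vi.
have [k _ kv] : (\bigcup_k obox (fun=> - k%:R) (fun=> k%:R)) v by rewrite obox_cover.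
by exists k => // j; case: ifPn => [/eqP ->//|_]; exact: kv.
Qed.

(** Open boxes are stable under intersection, generate the sigma-algebra, and countably many boxes
    of finite measure cover the space. *)
Lemma obox_measure_unique (m1 m2 : {measure set V -> \bar R}) :
  (forall a b, m1 (obox a b) = m2 (obox a b)) ->
  (forall a b, m1 (obox a b) < +oo)%E ->
  forall A, measurable A -> m1 A = m2 A.
Proof.
move=> m12 m1f A mA.
apply: (measure_unique [set A | exists a b, A = obox a b]
  (fun k : nat => obox (fun=> - k%:R) (fun=> k%:R))) => //.
- exact: measurable_rV_obox.
- move=> _ _ [a [b ->]] [c [d ->]]; rewrite obox_setI.
  by do 2 eexists.
- by move=> k; do 2 eexists.
- exact: obox_cover.
- by move=> _ [a [b ->]].
Qed.

Lemma lebesgue_obox a b :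
  lebesgue_rV R n (obox a b) = (\prod_(i < n) lebesgue_measure `]a i, b i[%classic)%E.
Proof. rewrite oboxE (@lebesgue_rV_box R n (fun i => `]a i, b i[%classic))//. Qed.

Lemma lebesgue_obox_fin a b : (lebesgue_rV R n (obox a b) < +oo)%E.
Proof.
rewrite lebesgue_obox.
suff -> : (\prod_(i < n) lebesgue_measure `]a i, b i[%classic =
   (\prod_(i < n) Num.max 0 (b i - a i))%:E)%E by rewrite ltry.
elim/big_ind2 : _ => // [x1 x2 y1 y2 -> ->|i _]; first by rewrite EFinM.
rewrite lebesgue_measure_itv/= lte_fin; case: ifPn => [ab|].
  by rewrite max_r// subr_ge0 ltW.
by rewrite -leNgt => ba; rewrite max_l// subr_le0.
Qed.

End boxes.

(** * Measure-preserving maps: translations and shears *)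

Section measure_preserving.
Context d (X : measurableType d) (R : realType) (mu : {measure set X -> \bar R}).

Definition measure_preserving (phi : X -> X) :=
  measurable_fun setT phi /\ forall A, measurable A -> mu (phi @^-1` A) = mu A.

Section integrals.
Variables (phi : X -> X) (phiP : measure_preserving phi).

Lemma ge0_integral_preserved (f : X -> \bar R) : measurable_fun setT f ->
  (forall x, 0 <= f x)%E -> (\int[mu]_x f (phi x) = \int[mu]_x f x)%E.
Proof.
move=> mf f0; have [mphi phimu] := phiP.
rewrite -[LHS](ge0_integral_pushforward mphi mu measurableT mf) => [|x _]; last exact: f0.
by apply: eq_measure_integral => //= A mA _; exact: phimu.
Qed.

Lemma integrable_preserved (f : X -> \bar R) :
  mu.-integrable setT f -> mu.-integrable setT (f \o phi).
Proof.
move=> /integrableP[mf foo]; apply/integrableP; split.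
  exact: measurableT_comp mf phiP.1.
by rewrite (ge0_integral_preserved (f := fun x => `|f x|%E))//; exact: measurableT_comp.
Qed.

Lemma Rintegral_preserved (f : X -> R) : mu.-integrable setT (EFin \o f) ->
  \int[mu]_x f (phi x) = \int[mu]_x f x.
Proof.
move=> fi; rewrite /Rintegral; congr fine; have [mphi phimu] := phiP.
have mf := measurable_int _ fi.
rewrite -(integral_pushforward mphi mf (integrable_preserved fi) measurableT).
by apply: eq_measure_integral => //= A mA _; exact: phimu.
Qed.

End integrals.
End measure_preserving.

Section shear.
Context {R : realType}.

Lemma lebesgue_measureD (c : R) (A : set (measurableTypeR R)) : measurable A ->
  lebesgue_measure ((fun t => t + c) @^-1` A) = lebesgue_measure A.
Proof.
move=> mA; apply/esym.
have mc : measurable_fun [set: measurableTypeR R] (fun t : measurableTypeR R => (t + c : measurableTypeR R)).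
  exact: measurable_funD.
have H := lebesgue_measure_unique (mu := measure_function_pushforward__canonical__measure_function_Measure lebesgue_measure mc).
apply: H => //.
move=> _ [[a b]] _ <-.
rewrite /= /pushforward (_ : _ @^-1` _ = `]a - c, b - c]%classic).
  by rewrite !lebesgue_measure_itv/= !lte_fin ltrD2r; case: ifP => // _; congr EFin; lra.
by apply/seteqP; split => t; rewrite /= !in_itv/= ltrBlDr lerBrDr.
Qed.

Lemma lebesgue_rVD n (c : 'rV[R]_n) :
  measure_preserving (lebesgue_rV R n) (fun v => v + c).
Proof.
have mc : measurable_fun [set: 'rV[R]_n] (fun v => v + c).
  apply: measurable_fun_coord => i; under eq_fun do rewrite mxE.
  by apply: measurable_funD => //; exact: measurable_coord.
split => // A mA; apply/esym.
apply: (obox_measure_unique (m2 := (measure_function_pushforward__canonical__measure_function_Measure (lebesgue_rV R n) mc))) => //; last exact: lebesgue_obox_fin.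
move=> a b; rewrite /= /pushforward.
rewrite (_ : _ @^-1` _ = obox (fun i => a i - c ord0 i) (fun i => b i - c ord0 i)).
  rewrite !lebesgue_obox; apply: eq_bigr => i _.
  by rewrite !lebesgue_measure_itv/= !lte_fin ltrD2r; case: ifP => // _; congr EFin; lra.
apply/seteqP; split => v /= vh i; have := vh i; rewrite ?mxE => /andP[h1 h2]; apply/andP; split; lra.
Qed.

Definition rV_snoc n (p : 'rV[R]_n * measurableTypeR R) : 'rV[R]_(n + 1) :=
  row_mx p.1 (const_mx p.2).

Lemma measurable_rV_snoc n : measurable_fun setT (@rV_snoc n).
Proof.
apply: measurable_fun_coord => i; rewrite /rV_snoc.
case: (split_ordP i) => j ->.
  under eq_fun do rewrite row_mxEl.
  exact: measurableT_comp (measurable_coord j) measurable_fst.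
under eq_fun do rewrite row_mxEr mxE.
exact: measurable_snd.
Qed.

(** [lebesgue_rV] is built by adding coordinates in front, whereas the centre of the group is the
    last coordinate; this gives the splitting adapted to the group law. *)
Lemma lebesgue_rV_snoc n (A : set 'rV[R]_(n + 1)) : measurable A ->
  lebesgue_rV R (n + 1) A = (lebesgue_rV R n \x lebesgue_measure)%E (@rV_snoc n @^-1` A).
Proof.
apply: (obox_measure_unique (m2 := (measure_function_pushforward__canonical__measure_function_Measure (lebesgue_rV R n \x lebesgue_measure)%E (@measurable_rV_snoc n)))) => //; last exact: lebesgue_obox_fin.
move=> a b; rewrite /= /pushforward.
rewrite (_ : _ @^-1` _ = obox (fun i => a (lshift 1 i)) (fun i => b (lshift 1 i)) `*` `]a (rshift n ord0), b (rshift n ord0)[%classic).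
  rewrite product_measure1E//; last exact: measurable_obox.
  transitivity ((\prod_(i < n) lebesgue_measure `]a (lshift 1 i), b (lshift 1 i)[%classic) *
    lebesgue_measure `]a (rshift n ord0), b (rshift n ord0)[%classic)%E.
    by rewrite lebesgue_obox big_split_ord big_ord1.
  by congr (_ * _)%E; exact/esym/lebesgue_obox.
apply/seteqP; split => [[v t] /= h|[v t] /= [h1 h2] i].
  split => [i|]; first by have := h (lshift 1 i); rewrite row_mxEl.
  by have := h (rshift n ord0); rewrite row_mxEr mxE /= in_itv.
case: (split_ordP i) => j ->; first by rewrite row_mxEl.
by rewrite (ord1 j) row_mxEr mxE; move: h2; rewrite in_itv.
Qed.

(** For a fixed horizontal part the last coordinate undergoes a translation, so sections keep their
    measure; a translation of the horizontal part remains. Left and right translations of the group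
    both have this form. *)
Lemma shear_preserving n (a : 'rV[R]_n) (l : 'rV[R]_n -> R) : measurable_fun setT l ->
  measure_preserving (lebesgue_rV R (n + 1)) (fun x : 'rV[R]_(n + 1) =>
   row_mx (lsubmx x + a) (const_mx (x ord0 (rshift n ord0) + l (lsubmx x)))).
Proof.
move=> ml.
have mls : measurable_fun setT (fun x : 'rV[R]_(n + 1) => lsubmx x).
  apply: measurable_fun_coord => i; under eq_fun do rewrite mxE.
  exact: measurable_coord.
set S := fun _ => _.
have mS : measurable_fun setT S.
  apply: measurable_fun_coord => i; rewrite /S.
  case: (split_ordP i) => j ->.
    under eq_fun do rewrite row_mxEl !mxE.
    by apply: measurable_funD => //; exact: measurable_coord.
  under eq_fun do rewrite row_mxEr !mxE.
  apply: measurable_funD; first exact: measurable_coord.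
  exact: measurableT_comp ml mls.
split => // A mA.
have mSA : measurable (S @^-1` A) by rewrite -[X in measurable X]setTI; exact: mS.
transitivity ((lebesgue_rV R n \x lebesgue_measure)%E (@rV_snoc n @^-1` (S @^-1` A))).
  exact: lebesgue_rV_snoc.
transitivity ((lebesgue_rV R n \x lebesgue_measure)%E (@rV_snoc n @^-1` A)); last first.
  exact/esym/lebesgue_rV_snoc.
have mpre B : measurable B -> measurable (@rV_snoc n @^-1` B).
  by move=> mB; rewrite -[X in measurable X]setTI; exact: measurable_rV_snoc.
have [mT TP] := lebesgue_rVD a.
rewrite /= /product_measure1.
transitivity (\int[lebesgue_rV R n]_v
  (lebesgue_measure \o xsection (@rV_snoc n @^-1` A)) (v + a)%R)%E; last first.
  by rewrite (ge0_integral_preserved (lebesgue_rVD a))//; apply: measurable_fun_xsection; exact: mpre.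
apply: eq_integral => v _ /=.
rewrite -[RHS](lebesgue_measureD (l v)); last by apply: measurable_xsection; exact: mpre.
congr (_ _); apply/seteqP; split => t; rewrite /xsection/= !inE/= /S /rV_snoc/= !row_mxKl row_mxEr mxE//.
Qed.

End shear.

(** * Borel sets and compact boxes of row vectors *)

Section rV_borel.
Context {R : realType} {n : nat}.
Local Notation V := 'rV[R]_n.

Lemma rV_ballE (x y : V) e : ball x e y <-> 0 < e /\ forall i, `|x ord0 i - y ord0 i| < e.
Proof.
split=> [|[e0 h]]; last by split => // i j; rewrite (ord1 i); exact: h.
by move=> [e0 h]; split => // i; exact: h.
Qed.

Lemma open_measurable_rV (U : set V) : open U -> measurable U.
Proof.
move=> oU.
pose B (p : {ffun 'I_n -> rat} * nat) : set V :=
  obox (fun i => ratr (p.1 i) - p.2.+1%:R^-1) (fun i => ratr (p.1 i) + p.2.+1%:R^-1).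
pose F p := if `[< B p `<=` U >] then B p else set0.
have -> : U = \bigcup_p F p.
  apply/seteqP; split => [x Ux|x [p _]]; last first.
    by rewrite /F; case: asboolP => // pU; exact: pU.
  have /nbhs_ballP[e /= e0 xeU] : nbhs x U by exact: open_nbhs_nbhs.
  have [k ke] : exists k : nat, k.+1%:R^-1 < e / 2.
    exists (Num.Def.truncn (2 / e)).
    (* A rational box of radius below e / 2 that contains x stays inside the ball of radius e around
       x. *)
    by rewrite invf_plt ?posrE ?divr_gt0// invf_div truncnS_gt.
  have /choice[q qP] i : exists q : rat, ratr q \in `]x ord0 i - k.+1%:R^-1, x ord0 i + k.+1%:R^-1[.
    apply: rat_in_itvoo.
    by rewrite ltrD2l (@lt_trans _ _ 0)// ?oppr_lt0 invr_gt0.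
  have xq i : `|x ord0 i - ratr (q i)| < k.+1%:R^-1.
    by have := qP i; rewrite in_itv/= => /andP[];
    rewrite ltr_norml; set d := _^-1 => h1 h2; apply/andP; split; lra.
  exists ([ffun i => q i], k) => //; rewrite /F; case: asboolP => [_|]; last first.
    case; move=> y yB; apply: xeU; apply/rV_ballE; split => // i.
    have /andP[] := yB i; rewrite /= ffunE; have := xq i; move: ke.
    rewrite !ltr_norml; set d := _^-1 => ke /andP[h3 h4] h1 h2; apply/andP; split; lra.
  move=> i /=; rewrite ffunE; have := xq i.
  by rewrite ltr_norml; set d := _^-1 => /andP[h3 h4]; apply/andP; split; lra.
apply: countable_bigcupT_measurable; first exact: countableP.
move=> p; rewrite /F; case: ifP => _ //; exact: measurable_obox.
Qed.

Lemma closed_measurable_rV (C : set V) : closed C -> measurable C.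
Proof.
move=> cC; rewrite -[C]setCK; apply: measurableC; apply: open_measurable_rV.
exact: closed_openC.
Qed.

Lemma compact_measurable_rV (K : set V) : compact K -> measurable K.
Proof. move=> cK; apply: closed_measurable_rV; by apply: compact_closed => //. Qed.

Lemma continuous_measurable_rV (f : V -> R) : continuous f -> measurable_fun setT f.
Proof.
move=> /continuousP cf; apply: (measurability _ (RGenOpens.measurableE R)).
move=> _ [_ [a [b ->] <-]]; rewrite setTI; apply: open_measurable_rV.
by apply: cf; exact: itv_open.
Qed.

Lemma bounded_sub_obox (A : set V) : bounded_set A ->
  exists k : nat, A `<=` obox (fun=> - k%:R) (fun=> k%:R).
Proof.
move=> [M [_ MA]].
exists (Num.Def.truncn (`|M| + 1)).+1 => v Av i; rewrite -ltr_norml.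
apply: le_lt_trans (truncnS_gt _).
apply: le_trans (norm_coord_le v i) _.
by apply: MA => //; rewrite (le_lt_trans (ler_norm _))// ltrDl.
Qed.

Lemma obox_bounded (a b : 'I_n -> R) : bounded_set (obox a b).
Proof.
exists (\big[Num.max/0]_i (Num.max `|a i| `|b i|)); split; first exact: num_real.
move=> x xM v vab /=; have -> : `|v| = mx_norm v by [].
have x0 : 0 <= x by apply: le_trans (ltW xM); exact: bigmax_ge_id.
rewrite mx_normrE; apply/bigmax_leP; split => // -[i j] _ /=; rewrite (ord1 i).
apply: le_trans (ltW xM); apply: le_trans (le_bigmax _ _ j).
have /andP[h1 h2] := vab j.
rewrite ler_norml le_max lerNl le_max; apply/andP; split.
  have := ler_norm (- a j); rewrite normrN => h3.
  by apply/orP; left; rewrite (le_trans _ h3)// lerN2 ltW.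
by rewrite orbC (le_trans (ltW h2))// ler_norm.
Qed.

Lemma bounded_finite_measure (A : set V) : measurable A -> bounded_set A ->
  (lebesgue_rV R n A < +oo)%E.
Proof.
move=> mA /bounded_sub_obox[k Ak].
apply: le_lt_trans (lebesgue_obox_fin (fun=> - k%:R) (fun=> k%:R)).
by apply: le_measure => //; rewrite inE//; exact: measurable_obox.
Qed.

Definition cbox (a b : 'I_n -> R) : set V := [set v | forall i, a i <= v ord0 i <= b i].

Lemma cbox_closed (a b : 'I_n -> R) : closed (cbox a b).
Proof.
have -> : cbox a b = \bigcap_i ((fun v : V => v ord0 i) @^-1` `[a i, b i]%classic).
  by apply/seteqP; split => v h i; [move=> _|]; have := h i; rewrite /= in_itv//=; exact.
apply: closed_bigI => i _.
apply: (@closed_comp _ _ (fun v : V => v ord0 i)) => [v _|]; first exact: coord_continuous.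
exact: interval_closed.
Qed.

Lemma cbox_bounded (a b : 'I_n -> R) : bounded_set (cbox a b).
Proof.
have [M [Mr MP]] := obox_bounded (fun i => a i - 1) (fun i => b i + 1).
exists M; split => // x xM v vab; apply: MP => // i.
by have /andP[] := vab i; move=> ? ?; apply/andP; split; lra.
Qed.

Lemma cbox_compact (a b : 'I_n -> R) : compact (cbox a b).
Proof. by apply: bounded_closed_compact; [exact: cbox_bounded|exact: cbox_closed]. Qed.

Lemma measurable_cbox (a b : 'I_n -> R) : measurable (cbox a b).
Proof. by apply: closed_measurable_rV; exact: cbox_closed. Qed.

Lemma compact_sub_cbox (K : set V) : compact K ->
  exists k : nat, K `<=` cbox (fun=> - k%:R) (fun=> k%:R).
Proof.
move=> /compact_bounded/bounded_sub_obox[k Kk]; exists k => v /Kk h i.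
by have /andP[? ?] := h i; apply/andP; split; lra.
Qed.

End rV_borel.

(** * Smooth functions *)

Section line_derivative.
Context {R : realType} {V : normedModType R}.
Implicit Types (f : V -> R) (u v x : V).

Lemma is_derive_line f x v t d :
  is_derive (x + t *: v) v f d <-> is_derive t (1 : R) (fun s => f (x + s *: v)) d.
Proof.
have E : (fun h : R => h^-1 *: ((f \o shift (x + t *: v)) (h *: v) - f (x + t *: v))) =
         (fun h : R => h^-1 *: (((fun s => f (x + s *: v)) \o shift t) (h *: (1 : R)) - f (x + t *: v))).
  apply/funext => h /=; congr (_ *: (f _ - _)).
  by rewrite [h *: 1]mulr1 scalerDl addrCA.
split=> -[dfx dE]; split.
- by rewrite /derivable -E.
- by rewrite /derive -E.
- by rewrite /derivable E.
- by rewrite /derive E.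
Qed.

Lemma is_derive_scale f x v (c d : R) :
  is_derive x v f d -> is_derive x (c *: v) f (c * d).
Proof.
rewrite -[x in is_derive x v](addr0 x) -[x in is_derive x (c *: v)](addr0 x).
rewrite -{1}(scale0r v) -(scale0r (c *: v)) => /is_derive_line fd.
apply/is_derive_line.
have -> : (fun s => f (x + s *: (c *: v))) = (fun s => f (x + s *: v)) \o (fun s => c * s).
  by apply/funext => s /=; rewrite scalerA mulrC.
rewrite mulrC; apply: is_derive1_comp; first by rewrite mulr0.
have := @is_deriveZ R R R id c 0 1 1 (is_derive_id _ _).
by rewrite [_ *: 1]mulr1.
Qed.

(** [is_Ck] only speaks of the coordinate directions, while X_i combines two of them. The increment
    along v + u is split at x + h v; the part along u is treated by the mean value theorem at a
    moving base point, which is why Du must be continuous at x. *)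
Lemma is_deriveDdir f x u v (d : R) (Du : V -> R) :
  (forall y, is_derive y u f (Du y)) -> {for x, continuous Du} ->
  is_derive x v f d -> is_derive x (v + u) f (d + Du x).
Proof.
move=> fu cDu fv.
suff H : (fun h : R => h^-1 *: ((f \o shift x) (h *: (v + u)) - f x)) @ 0^' --> d + Du x.
  by split; [apply/cvg_ex; exists (d + Du x)|exact: cvg_lim].
have Hv : (fun h : R => h^-1 *: ((f \o shift x) (h *: v) - f x)) @ 0^' --> d.
  by case: fv => dfv <-.
have -> : (fun h : R => h^-1 *: ((f \o shift x) (h *: (v + u)) - f x)) =
  (fun h : R => h^-1 *: ((f \o shift x) (h *: v) - f x)) \+
  (fun h : R => h^-1 *: (f ((x + h *: v) + h *: u) - f (x + h *: v))).
  apply/funext => h /=; rewrite -scalerDr; congr (_ *: _).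
  by rewrite scalerDr [h *: v + x]addrC [_ + x]addrC addrA; lra.
apply: cvgD => //.
apply/cvgrPdist_le => e e0.
move/cvgrPdist_le : cDu => /(_ e e0) /nbhs_ballP[r /= r0 xr].
(* The intermediate point x + h v + c u with |c| <= |h| is within |h| K of x; the summand 1 keeps K
   positive. *)
pose K := `|u| + `|v| + 1.
have K0 : 0 < K by rewrite ltr_wpDl// addr_ge0.
exists (r / K); first by rewrite /= divr_gt0.
move=> h /=; rewrite sub0r normrN => hr h0.
have [c [ch cE]] : exists c : R, `|c| <= `|h| /\
   f ((x + h *: v) + h *: u) - f (x + h *: v) = h * Du ((x + h *: v) + c *: u).
  pose g s := f ((x + h *: v) + s *: u).
  pose dg s := Du ((x + h *: v) + s *: u).
  have gd s : is_derive s (1 : R) g (dg s) by apply/is_derive_line; exact: fu.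
  have gc s : {for s, continuous g}.
    apply: differentiable_continuous; apply/derivable1_diffP.
    by have [] := gd s.
  have [hp|hn] := ltP 0 h.
    have [c] := @MVT_segment R g dg 0 h (ltW hp) (fun s _ => gd s) (continuous_subspaceT gc).
    rewrite in_itv/= => /andP[c0 ch] E; exists c; split.
      by rewrite !ger0_norm// ltW.
    by rewrite -[X in f X - _ = _]/((x + h *: v) + h *: u) -/(g h) -[X in _ - f X](addr0 (x + h *: v)) -(scale0r u) -/(g 0) E subr0 mulrC.
  have [c] := @MVT_segment R g dg h 0 hn (fun s _ => gd s) (continuous_subspaceT gc).
  rewrite in_itv/= => /andP[c0 ch] E; exists c; split.
    by rewrite !ler0_norm// lerN2.
  rewrite -[X in _ - f X](addr0 (x + h *: v)) -(scale0r u) -/(g 0) -/(g h) -opprB E sub0r.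
  by rewrite mulrN opprK mulrC.
rewrite cE [_ *: _]mulrA mulVf// mul1r; apply: xr.
rewrite -ball_normE /= -addrA opprD addrA subrr sub0r normrN.
apply: (@le_lt_trans _ _ (`|h| * K)); last by rewrite -ltr_pdivlMr.
rewrite (le_trans (ler_normD _ _))// !normrZ /K !mulrDr mulr1.
have := ler_wpM2r (normr_ge0 u) ch; have := normr_ge0 h; lra.
Qed.

End line_derivative.

Section Ck.
Context {R : realType} {n : nat}.
Local Notation V := 'rV[R]_n.
Implicit Types (f g : V -> R).
Local Notation e i := (delta_mx ord0 i : V).

Lemma is_CkS k f : is_Ck k.+1 f -> is_Ck k f.
Proof.
elim: k f => [|k ih] f; first by case.
move=> [cf df]; split => // i; have [dfi Ckf] := df i; split => //; exact: ih.
Qed.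

Lemma is_Ck_continuous k f : is_Ck k f -> continuous f.
Proof. by case: k => [|k] // []. Qed.

Lemma is_CkP k f (df : 'I_n -> V -> R) : continuous f ->
  (forall i x, is_derive x (e i) f (df i x)) -> (forall i, is_Ck k (df i)) ->
  is_Ck k.+1 f.
Proof.
move=> cf fd Ck; split=> // i; split => [x|]; first by have [] := fd i x.
rewrite (_ : (fun x => _) = df i) //.
by apply/funext => x; have [_ ->] := fd i x.
Qed.

Lemma is_Ck_cst k (c : R) : is_Ck k (fun _ : V => c).
Proof.
elim: k c => [|k ih] c; first exact: cst_continuous.
by apply: (@is_CkP _ _ (fun _ _ => 0)) => // *; exact: cst_continuous.
Qed.

Lemma is_derive_coord (x v : V) j : is_derive x v (fun y : V => y ord0 j) (v ord0 j).
Proof.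
have E : is_derive x v (id : V -> V) v by exact: is_derive_id.
have [/derivable_mxP H Dv] := E.
split; first exact: (H ord0 j).
have := derive_mx (@ex_derive _ _ _ _ _ _ _ E); rewrite Dv => /(congr1 (fun w : V => w ord0 j)).
by rewrite mxE => ->.
Qed.

Lemma is_Ck_coord k j : is_Ck k (fun x : V => x ord0 j).
Proof.
case: k => [|k]; first by move=> x; exact: coord_continuous.
apply: (@is_CkP _ _ (fun i _ => (e i) ord0 j)) => [x|i x|i].
- exact: coord_continuous.
- exact: is_derive_coord.
- exact: is_Ck_cst.
Qed.

Lemma is_Ck_derive k f i x : is_Ck k.+1 f -> is_derive x (e i) f ('D_(e i) f x).
Proof. by move=> [_ /(_ i)[df _]]; exact: derivableP. Qed.

Lemma is_CkD k f g : is_Ck k f -> is_Ck k g -> is_Ck k (fun x => f x + g x).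
Proof.
elim: k f g => [|k ih] f g Cf Cg.
  have [cf cg] := (is_Ck_continuous Cf, is_Ck_continuous Cg).
  by move=> x; exact: (continuousD (cf x) (cg x)).
apply: (@is_CkP _ _ (fun i x => 'D_(e i) f x + 'D_(e i) g x)).
- have [cf cg] := (is_Ck_continuous Cf, is_Ck_continuous Cg).
  by move=> x; exact: (continuousD (cf x) (cg x)).
- by move=> i x; exact: (is_deriveD (is_Ck_derive i x Cf) (is_Ck_derive i x Cg)).
- by move=> i; apply: ih; [case: Cf => _ /(_ i)[]|case: Cg => _ /(_ i)[]].
Qed.

Lemma is_CkM k f g : is_Ck k f -> is_Ck k g -> is_Ck k (fun x => f x * g x).
Proof.
elim: k f g => [|k ih] f g Cf Cg.
  have [cf cg] := (is_Ck_continuous Cf, is_Ck_continuous Cg).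
  by move=> x; exact: (continuousM (cf x) (cg x)).
apply: (@is_CkP _ _ (fun i x => f x * 'D_(e i) g x + g x * 'D_(e i) f x)).
- have [cf cg] := (is_Ck_continuous Cf, is_Ck_continuous Cg).
  by move=> x; exact: (continuousM (cf x) (cg x)).
- by move=> i x; exact: (is_deriveM (is_Ck_derive i x Cf) (is_Ck_derive i x Cg)).
- by move=> i; apply: is_CkD; apply: ih;
   [exact: is_CkS|case: Cg => _ /(_ i)[]|exact: is_CkS|case: Cf => _ /(_ i)[]].
Qed.

Lemma is_Ck_prod k m (F : 'I_m -> V -> R) : (forall j, is_Ck k (F j)) ->
  is_Ck k (fun x => \prod_(j < m) F j x).
Proof.
elim: m F => [|m ih] F CF.
  by under eq_fun do rewrite big_ord0; exact: is_Ck_cst.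
under eq_fun do rewrite big_ord_recl.
by apply: is_CkM => //; exact: ih.
Qed.

(** Differentiating G_j o f produces G_(j+1) o f, so the induction on k needs the whole sequence of
    derivatives, with j left general. *)
Lemma is_Ck_comp (G : nat -> R -> R) k j f :
  (forall j x, is_derive x (1 : R) (G j) (G j.+1 x)) -> is_Ck k f ->
  is_Ck k (fun x => G j (f x)).
Proof.
move=> GP.
have Gc i x : {for x, continuous (G i)}.
  by apply: differentiable_continuous; apply/derivable1_diffP; have [] := GP i x.
elim: k j f => [|k ih] j f Cf.
  by move=> x; apply: continuous_comp; [exact: Cf|exact: Gc].
apply: (@is_CkP _ _ (fun i x => G j.+1 (f x) * 'D_(e i) f x)).
- by move=> x; apply: continuous_comp; [exact: (is_Ck_continuous Cf)|exact: Gc].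
- move=> i x.
  rewrite -[x in is_derive x](addr0 x) -{1}(scale0r (e i)); apply/is_derive_line.
  apply: (@is_derive1_comp R (G j) (fun s => f (x + s *: e i))).
    by rewrite scale0r addr0; exact: GP.
  apply: (iffLR (is_derive_line f x (e i) 0 _)).
  have Dx := is_Ck_derive i x Cf.
  rewrite scale0r addr0.
  exact: Dx.
- by move=> i; apply: is_CkM; [apply: ih; exact: is_CkS|case: Cf => _ /(_ i)[]].
Qed.

End Ck.

(** * A flat function, the source of smooth bumps *)

Section flat_function.
Context {R : realType}.
Implicit Types q : {poly R}.

(** The functions q(1/x) e^(-1/x), extended by 0, form a family closed under differentiation: the
    derivative replaces q by X^2 (q - q'). Smoothness of e^(-1/x) thus needs no formula for the k-th
    derivative. *)
Definition flatp q (x : R) : R := if 0 < x then q.[x^-1] * expR (- x^-1) else 0.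

Lemma poly_growth q : exists C d, 0 <= C /\ forall y : R, 1 <= y -> `|q.[y]| <= C * y ^+ d.
Proof.
elim/poly_ind : q => [|q c [C [d [C0 H]]]].
  by exists 0, 0%N; split => // y _; rewrite horner0 normr0 mul0r.
exists (C + `|c|), d.+1; split; first by rewrite addr_ge0.
move=> y y1; rewrite hornerMXaddC (le_trans (ler_normD _ _))// mulrDl lerD//.
  rewrite normrM exprSr mulrA ler_pM// ?H// ger0_norm//; lra.
by rewrite ler_peMr// exprn_ege1.
Qed.

(** The exponential of y = 1/h exceeds y^(d+2) / (d+2)!, which beats a polynomial of degree d with
    h^2 to spare. The square makes the difference quotient at 0 vanish. *)
Lemma flatp_le q : exists C : R, forall h, 0 < h -> h <= 1 -> `|flatp q h| <= C * h ^+ 2.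
Proof.
have [C [d [C0 H]]] := poly_growth q.
exists (C * (d.+2)`!%:R) => h h0 h1; rewrite /flatp h0 normrM.
have y1 : 1 <= h^-1 by rewrite invf_ge1.
have y0 : 0 < h^-1 by lra.
rewrite [X in _ * X]ger0_norm ?expR_ge0//.
apply: (@le_trans _ _ (C * h^-1 ^+ d * ((d.+2)`!%:R / h^-1 ^+ d.+2))); last first.
  have -> : h^-1 ^+ d.+2 = h^-1 ^+ d * h^-1 ^+ 2 by rewrite -exprD addn2.
  rewrite le_eqVlt; apply/orP; left; apply/eqP.
  have ? : h^-1 ^+ d != 0 by rewrite expf_neq0// gt_eqF.
  have ? : h != 0 by rewrite gt_eqF.
  set z := h^-1 ^+ d in H *.
  by field; apply/andP.
apply: ler_pM; [exact: normr_ge0|exact: expR_ge0|exact: H|].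
rewrite expRN -[X in _ <= X]invf_div lef_pV2 ?posrE ?expR_gt0//; last first.
  by rewrite divr_gt0 ?exprn_gt0// ltr0n fact_gt0.
by have := @expR_ge1Dxn R h^-1 d.+1 (ltW y0); lra.
Qed.

Lemma is_derive_flatp q x :
  is_derive x (1 : R) (flatp q) (flatp ('X ^+ 2 * (q - q^`())) x).
Proof.
have [x0|x0|->] := ltgtP x 0.
- rewrite {2}/flatp ltNge (ltW x0)/=.
  apply: (@near_eq_is_derive R R R (cst 0) _ _ _ _ _ (is_derive_cst _ _ _)).
  by near=> y; rewrite /flatp ltNge ltW//=; near: y; exact: lt_nbhsl.
- apply: (@near_eq_is_derive R R R (fun y => q.[y^-1] * expR (- y^-1))).
    by near=> y; rewrite /flatp ifT//; near: y; exact: lt_nbhsr.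
  have xV : is_derive x (1 : R) (fun y : R => y^-1) (- x ^- 2).
    have := @is_deriveV R id x 1 1 _ _; rewrite [_ *: 1]mulr1; apply => //.
    by rewrite gt_eqF.
  have d1 : is_derive x (1 : R) (fun y => q.[y^-1]) (q^`().[x^-1] * (- x ^- 2)).
    exact: (@is_derive1_comp R (horner q) (fun y => y^-1)).
  have d2 : is_derive x (1 : R) (fun y => expR (- y^-1)) (expR (- x^-1) * (- - x ^- 2)).
    apply: (@is_derive1_comp R expR (fun y => - y^-1)).
  have := is_deriveM d1 d2; set D := _ + _; suff -> : flatp ('X ^+ 2 * (q - q^`())) x = D by [].
  rewrite /D /flatp x0 !hornerE /= /GRing.scale/=.
  by rewrite exprVn; ring.
rewrite {2}/flatp ltxx.
suff H : (fun h : R => h^-1 *: ((flatp q \o shift 0) (h *: (1 : R)) - flatp q 0)) @ 0^' --> (0 : R).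
  by split; [apply/cvg_ex; exists 0|exact: cvg_lim].
have [C HC] := flatp_le q.
apply/cvgrPdist_le => e e0.
exists (Num.min 1 (e / (`|C| + 1))).
  by rewrite /= lt_min ltr01 divr_gt0// ltr_wpDl.
move=> h /=; rewrite sub0r normrN lt_min => /andP[h1 hC] h0.
rewrite sub0r normrN addr0 [h *: 1]mulr1 {2}/flatp ltxx subr0.
have [hp|hn] := ltP 0 h; last by rewrite /flatp ltNge hn/= scaler0 normr0 ltW.
rewrite gtr0_norm// in h1 hC.
rewrite [_ *: _]mulrC normrM normfV [X in _ / X]gtr0_norm// ler_pdivrMr// [X in _ <= X]mulrC.
apply: le_trans (HC _ hp (ltW h1)) _.
rewrite expr2 mulrCA ler_pM2l//.
have hC' : h * (`|C| + 1) < e by rewrite -ltr_pdivlMr// ltr_wpDl.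
have := ler_norm C; nra.
Unshelve. all: by end_near.
Qed.

Lemma flatp_ge0 x : 0 <= flatp 1 x.
Proof. by rewrite /flatp; case: ifP => // _; rewrite hornerE mul1r expR_ge0. Qed.

Lemma flatp_le1 x : flatp 1 x <= 1.
Proof.
rewrite /flatp; case: ifP => // x0; rewrite hornerE mul1r -expR0 ler_expR oppr_le0.
by rewrite invr_ge0 ltW.
Qed.

Lemma is_smooth_flatp n (f : 'rV[R]_n -> R) : is_smooth f -> is_smooth (fun x => flatp 1 (f x)).
Proof.
move=> fs k.
pose G j := flatp (iter j (fun q => 'X ^+ 2 * (q - q^`())) 1).
apply: (@is_Ck_comp _ _ G k 0) => // j x; exact: is_derive_flatp.
Qed.

End flat_function.

(** * The Heisenberg group and its horizontal flows *)

Section heisenberg_group.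
Context {R : realType} {N : nat}.
Local Notation H := 'rV[R]_(N + N + 1).
Local Notation mu := (lebesgue_rV R (N + N + 1)).
Implicit Types (x y z : H) (i : 'I_(N + N)).

Definition symp x y : R := \sum_(k < N)
  (hX x (lshift N k) * hX y (rshift N k) - hX x (rshift N k) * hX y (lshift N k)).

Lemma hP x y : (forall i, hX x i = hX y i) -> hT x = hT y -> x = y.
Proof.
move=> hx ht; apply/rowP => j; case: (split_ordP j) => k ->; first exact: hx.
by rewrite (ord1 k); exact: ht.
Qed.

Lemma hX_mul x y i : hX (hmul x y) i = hX x i + hX y i.
Proof. by rewrite /hX /hmul row_mxEl mxE. Qed.

Lemma hT_mul x y : hT (hmul x y) = hT x + hT y + 2^-1 * symp x y.
Proof. by rewrite {1}/hT /hmul row_mxEr mxE. Qed.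

Lemma hX_row (a : 'rV[R]_(N + N)) (b : 'rV[R]_1) i : hX (row_mx a b) i = a ord0 i.
Proof. by rewrite /hX row_mxEl. Qed.

Lemma hT_row (a : 'rV[R]_(N + N)) (b : R) : hT (row_mx a (const_mx b)) = b.
Proof. by rewrite /hT row_mxEr mxE. Qed.

Lemma hXD x y i : hX (x + y) i = hX x i + hX y i. Proof. by rewrite /hX mxE. Qed.
Lemma hTD x y : hT (x + y) = hT x + hT y. Proof. by rewrite /hT mxE. Qed.
Lemma hXZ (a : R) x i : hX (a *: x) i = a * hX x i. Proof. by rewrite /hX mxE. Qed.
Lemma hTZ (a : R) x : hT (a *: x) = a * hT x. Proof. by rewrite /hT mxE. Qed.
Lemma hX0 i : hX (0 : H) i = 0. Proof. by rewrite /hX mxE. Qed.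
Lemma hT0 : hT (0 : H) = 0. Proof. by rewrite /hT mxE. Qed.

Lemma hmulA x y z : hmul x (hmul y z) = hmul (hmul x y) z.
Proof.
apply: hP => [i|]; first by rewrite !hX_mul addrA.
rewrite !hT_mul.
suff -> : symp x (hmul y z) = symp x y + symp x z.
  suff -> : symp (hmul x y) z = symp x z + symp y z by lra.
  by rewrite -big_split; apply: eq_bigr => k _; rewrite !hX_mul /=; ring.
by rewrite -big_split; apply: eq_bigr => k _; rewrite !hX_mul /=; ring.
Qed.

Lemma hmul0 x : hmul x 0 = x.
Proof.
apply: hP => [i|]; first by rewrite hX_mul hX0 addr0.
rewrite hT_mul hT0 addr0 [symp _ _]big1 ?mulr0 ?addr0// => k _.
by rewrite !hX0; ring.
Qed.

Definition hexp i (s : R) : H := row_mx (s *: delta_mx ord0 i) 0.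

Definition hcoef i x : R := match fintype.split i with
  | inl j => - (hX x (rshift N j) / 2)
  | inr j => hX x (lshift N j) / 2
  end.

Lemma hX_exp i s j : hX (hexp i s) j = s *+ (j == i).
Proof. by rewrite /hX /hexp row_mxEl !mxE eqxx /= mulr_natr. Qed.

Lemma hT_exp i s : hT (hexp i s) = 0.
Proof. by rewrite /hT /hexp row_mxEr mxE. Qed.

Lemma symp_exp x i s : symp x (hexp i s) = 2 * (s * hcoef i x).
Proof.
rewrite /symp /hcoef; case: (split_ordP i) => j ->.
  rewrite (bigD1 j)//= big1 ?addr0 => [|k kj].
    by rewrite !hX_exp eqxx eq_rlshift mulr0n mulr1n; lra.
  by rewrite !hX_exp eq_rlshift (inj_eq (@lshift_inj N N)) (negPf kj) !mulr0n !mulr0 subrr.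
rewrite (bigD1 j)//= big1 ?addr0 => [|k kj].
  by rewrite !hX_exp eqxx eq_lrshift mulr0n mulr1n; lra.
by rewrite !hX_exp eq_lrshift (inj_eq (@rshift_inj N N)) (negPf kj) !mulr0n !mulr0 subrr.
Qed.

Lemma hX_field i x j : hX (hfield i x) j = (j == i)%:R.
Proof.
rewrite /hX /hfield !mxE eqxx /= (inj_eq (@lshift_inj _ 1)).
by rewrite eq_lrshift mulr0 addr0.
Qed.

Lemma hT_field i x : hT (hfield i x) = hcoef i x.
Proof. by rewrite /hT /hfield !mxE eqxx /= eq_rlshift eqxx add0r mulr1. Qed.

Definition hflow i (s : R) x := x + s *: hfield i x.

(** Left invariance of X_i: its flow is right multiplication by a one-parameter subgroup. This links
    weak derivatives to group increments. *)
Lemma hmul_exp x i s : hmul x (hexp i s) = hflow i s x.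
Proof.
apply: hP => [j|].
  by rewrite hX_mul hX_exp /hflow hXD hXZ hX_field mulr_natr.
rewrite hT_mul hT_exp symp_exp /hflow hTD hTZ hT_field; lra.
Qed.

(** The coefficient of X_i involves only the coordinate conjugate to the i-th one, which the flow
    does not move. Hence the field is constant along its flow lines, which are straight. *)
Lemma hcoef_flow i s x : hcoef i (hflow i s x) = hcoef i x.
Proof.
rewrite /hcoef /hflow; case: (split_ordP i) => j ->.
  by rewrite hXD hXZ hX_field eq_rlshift mulr0 addr0.
by rewrite hXD hXZ hX_field eq_lrshift mulr0 addr0.
Qed.

Lemma hfield_flow i s x : hfield i (hflow i s x) = hfield i x.
Proof. by apply: hP => [j|]; rewrite ?hX_field// !hT_field hcoef_flow. Qed.

Lemma hflowD i s t x : hflow i (s + t) x = hflow i s (hflow i t x).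
Proof. by rewrite {2}/hflow hfield_flow /hflow scalerDl -addrA [t *: _ + _]addrC. Qed.

Lemma hflow0 i x : hflow i 0 x = x.
Proof. by rewrite /hflow scale0r addr0. Qed.

Lemma hmul_right_preserving y : measure_preserving mu (fun x => hmul x y).
Proof.
pose l (v : 'rV[R]_(N + N)) : R := hT y + 2^-1 * \sum_(k < N)
  (v ord0 (lshift N k) * hX y (rshift N k) - v ord0 (rshift N k) * hX y (lshift N k)).
have -> : (fun x => hmul x y) = (fun x => row_mx (lsubmx x + lsubmx y)
   (const_mx (x ord0 (rshift (N + N) ord0) + l (lsubmx x)))).
  apply/funext => x; apply: hP => [i|].
    by rewrite hX_mul hX_row !mxE.
  rewrite hT_mul hT_row addrA; congr (_ + _ + _ * _).
  by apply: eq_bigr => k _; rewrite !mxE.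
apply: (@shear_preserving R (N + N) (lsubmx y) l); apply: measurable_funD => //; apply: measurable_funM => //.
apply: measurable_sum => k; apply: measurable_funB; apply: measurable_funM => //;
exact: measurable_coord.
Qed.

Lemma hmul_left_preserving y : measure_preserving mu (hmul y).
Proof.
pose l (v : 'rV[R]_(N + N)) : R := hT y + 2^-1 * \sum_(k < N)
  (hX y (lshift N k) * v ord0 (rshift N k) - hX y (rshift N k) * v ord0 (lshift N k)).
have -> : hmul y = (fun x => row_mx (lsubmx x + lsubmx y)
   (const_mx (x ord0 (rshift (N + N) ord0) + l (lsubmx x)))).
  apply/funext => x; apply: hP => [i|].
    by rewrite hX_mul hX_row !mxE addrC.
  rewrite hT_mul hT_row addrA [hT y + _]addrC; congr (_ + _ + _ * _).
  by apply: eq_bigr => k _; rewrite !mxE.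
apply: (@shear_preserving R (N + N) (lsubmx y) l); apply: measurable_funD => //; apply: measurable_funM => //.
apply: measurable_sum => k; apply: measurable_funB; apply: measurable_funM => //;
exact: measurable_coord.
Qed.

Lemma hflow_preserving i s : measure_preserving mu (hflow i s).
Proof.
have -> : hflow i s = fun x => hmul x (hexp i s) by apply/funext => x; rewrite hmul_exp.
exact: hmul_right_preserving.
Qed.

Lemma measurable_hX i : measurable_fun setT (fun x : H => hX x i).
Proof. exact: measurable_coord. Qed.

Lemma measurable_hT : measurable_fun setT (fun x : H => hT x).
Proof. exact: measurable_coord. Qed.

Lemma measurable_hcoef i : measurable_fun setT (hcoef i).
Proof.
rewrite /hcoef; case: (fintype.split i) => j.
  by apply: measurableT_comp => //; apply: measurable_funM => //; exact: measurable_hX.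
by apply: measurable_funM => //; exact: measurable_hX.
Qed.

Lemma measurable_to_H d (T : measurableType d) (F : T -> H) :
  (forall i, measurable_fun setT (fun t => hX (F t) i)) ->
  measurable_fun setT (fun t => hT (F t)) -> measurable_fun setT F.
Proof.
move=> mX mT; apply: measurable_fun_coord => j.
case: (split_ordP j) => k ->; first exact: mX.
by rewrite (ord1 k); exact: mT.
Qed.

Lemma measurable_hflow i :
  measurable_fun setT (fun p : measurableTypeR R * H => hflow i p.1 p.2).
Proof.
apply: measurable_to_H => [j|]; rewrite /hflow.
  under eq_fun do rewrite hXD hXZ hX_field.
  apply: measurable_funD; first exact: measurableT_comp (measurable_hX j) measurable_snd.
  by apply: measurable_funM => //; exact: measurable_fst.
under eq_fun do rewrite hTD hTZ hT_field.
apply: measurable_funD; first exact: measurableT_comp measurable_hT measurable_snd.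
apply: measurable_funM; first exact: measurable_fst.
exact: measurableT_comp (measurable_hcoef i) measurable_snd.
Qed.

Lemma measurable_hmul : measurable_fun setT (fun p : H * H => hmul p.1 p.2).
Proof.
have m1 i : measurable_fun setT (fun p : H * H => hX p.1 i).
  exact: measurableT_comp (measurable_hX i) measurable_fst.
have m2 i : measurable_fun setT (fun p : H * H => hX p.2 i).
  exact: measurableT_comp (measurable_hX i) measurable_snd.
apply: measurable_to_H => [j|].
  under eq_fun do rewrite hX_mul.
  by apply: measurable_funD.
under eq_fun do rewrite hT_mul.
apply: measurable_funD; [apply: measurable_funD|].
- exact: measurableT_comp measurable_hT measurable_fst.
- exact: measurableT_comp measurable_hT measurable_snd.
apply: measurable_funM => //; apply: measurable_sum => k.
by apply: measurable_funB; apply: measurable_funM.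
Qed.

Lemma is_Ck_hX k i : is_Ck k (fun x : H => hX x i).
Proof. exact: is_Ck_coord. Qed.

Lemma is_Ck_hT k : is_Ck k (fun x : H => hT x).
Proof. exact: is_Ck_coord. Qed.

Lemma is_Ck_hcoef k i : is_Ck k (hcoef i).
Proof.
rewrite /hcoef; case: (fintype.split i) => j; last first.
  by apply: is_CkM; [exact: is_Ck_hX|exact: is_Ck_cst].
under eq_fun do rewrite -mulrN.
by apply: is_CkM; [exact: is_Ck_hX|exact: is_Ck_cst].
Qed.

Lemma is_Ck_hflow_coord k i s j : is_Ck k (fun x : H => hflow i s x ord0 j).
Proof.
case: (split_ordP j) => l ->.
  rewrite (_ : (fun _ => _) = fun x => hX x l + s * (l == i)%:R).
    by apply: is_CkD; [exact: is_Ck_hX|exact: is_Ck_cst].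
  by apply/funext => x; rewrite -[LHS]/(hX (hflow i s x) l) hXD hXZ hX_field.
rewrite (ord1 l) (_ : (fun _ => _) = fun x => hT x + s * hcoef i x).
  apply: is_CkD; first exact: is_Ck_hT.
  by apply: is_CkM; [exact: is_Ck_cst|exact: is_Ck_hcoef].
by apply/funext => x; rewrite -[LHS]/(hT (hflow i s x)) hTD hTZ hT_field.
Qed.

Lemma hfieldE i x : hfield i x =
  delta_mx ord0 (lshift 1 i) + hcoef i x *: delta_mx ord0 (rshift (N + N) ord0).
Proof. by []. Qed.

Definition hD i (phi : H -> R) x := 'D_(hfield i x) phi x.

Lemma is_derive_hfield phi i x : is_Ck 1 phi -> is_derive x (hfield i x) phi
  ('D_(delta_mx ord0 (lshift 1 i)) phi x +
   hcoef i x * 'D_(delta_mx ord0 (rshift (N + N) ord0)) phi x).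
Proof.
move=> Cphi; rewrite hfieldE.
apply: (@is_deriveDdir R H phi x _ _ _ (fun y => hcoef i x * 'D_(delta_mx ord0 (rshift (N + N) ord0)) phi y)).
- by move=> y; apply: is_derive_scale; exact: is_Ck_derive Cphi.
- have c : continuous (fun y => 'D_(delta_mx ord0 (rshift (N + N) ord0)) phi y).
    by have [_ /(_ (rshift (N + N) ord0))[_]] := Cphi.
  by apply: continuousM (c x); exact: cst_continuous.
- exact: is_Ck_derive Cphi.
Qed.

Lemma hDE phi i : is_Ck 1 phi -> hD i phi = fun x =>
  'D_(delta_mx ord0 (lshift 1 i)) phi x +
   hcoef i x * 'D_(delta_mx ord0 (rshift (N + N) ord0)) phi x.
Proof.
by move=> Cphi; apply/funext => x; have [_] := is_derive_hfield i x Cphi.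
Qed.

Lemma hD_continuous phi i : is_Ck 1 phi -> continuous (hD i phi).
Proof.
move=> Cphi; rewrite hDE//.
apply: (@is_Ck_continuous _ _ 0); case: Cphi => [_ Cphi].
apply: is_CkD; first by case: (Cphi (lshift 1 i)).
by apply: is_CkM; [exact: is_Ck_hcoef|case: (Cphi (rshift (N + N) ord0))].
Qed.

Lemma is_derive_hflow phi i x s : is_Ck 1 phi ->
  is_derive s (1 : R) (fun s => phi (hflow i s x)) (hD i phi (hflow i s x)).
Proof.
move=> Cphi; apply: (iffLR (is_derive_line phi x (hfield i x) s _)).
rewrite hDE//; have := is_derive_hfield i (hflow i s x) Cphi.
by rewrite hfield_flow.
Qed.

(** X_i commutes with its own flow. This is used when a test function composed with the flow is put
    into the definition of the weak gradient. *)
Lemma hD_flow phi i s x : hD i (fun y => phi (hflow i s y)) x = hD i phi (hflow i s x).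
Proof.
rewrite /hD /derive hfield_flow.
apply: (congr1 (fun F : R -> R => lim (F @ 0^'))); apply/funext => h /=.
congr (_ *: (phi _ - _)).
have E : hflow i h (hflow i s x) = hflow i s (hflow i h x) by rewrite -!hflowD addrC.
by rewrite addrC -[h *: _ + _]addrC -(hfield_flow i s x) -[RHS]/(hflow i h (hflow i s x)) E hfield_flow.
Qed.

Lemma hflow_continuous i x : continuous (fun s => hflow i s x).
Proof.
move=> s; apply: cvgD; first exact: cvg_cst.
by apply: cvgZr_tmp; exact: cvg_id.
Qed.

End heisenberg_group.

(* [dpsi] is the derivative of the C^{1,1} function [psi]. *)
Definition C11 {R : realType} (psi dpsi : R -> R) (C : R) :=
  (forall a b, `|psi b - psi a - dpsi a * (b - a)| <= C * (b - a) ^+ 2) /\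
  (forall a b, `|dpsi b - dpsi a| <= C * `|b - a|).

(** * Chain rule along measure preserving flows *)

Section real_integrable.
Context d (X : measurableType d) (R : realType) (mu : {measure set X -> \bar R}).
Variables (D : set X) (mD : measurable D).
Implicit Types f g : X -> R.

Lemma integrable_rD f g : mu.-integrable D (EFin \o f) -> mu.-integrable D (EFin \o g) ->
  mu.-integrable D (EFin \o (fun x => f x + g x)).
Proof. by move=> fi gi; apply: eq_integrable (integrableD mD fi gi). Qed.

Lemma integrable_rB f g : mu.-integrable D (EFin \o f) -> mu.-integrable D (EFin \o g) ->
  mu.-integrable D (EFin \o (fun x => f x - g x)).
Proof. by move=> fi gi; apply: eq_integrable (integrableB mD fi gi). Qed.

Lemma integrable_rZ f (k : R) : mu.-integrable D (EFin \o f) ->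
  mu.-integrable D (EFin \o (fun x => k * f x)).
Proof. by move=> fi; apply: eq_integrable (integrableZl mD k fi). Qed.

Lemma integrable_rle f g : measurable_fun D f -> (forall x, D x -> `|f x| <= g x) ->
  mu.-integrable D (EFin \o g) -> mu.-integrable D (EFin \o f).
Proof.
move=> mf fg gi; apply: (le_integrable mD _ _ gi); first exact/measurable_EFinP.
by move=> x Dx /=; rewrite lee_fin (le_trans (fg _ Dx))// ler_norm.
Qed.

Lemma ae_eq_Rintegral f g : measurable_fun D f -> measurable_fun D g ->
  {ae mu, forall x, D x -> f x = g x} -> \int[mu]_(x in D) f x = \int[mu]_(x in D) g x.
Proof.
move=> mf mg fg; rewrite /Rintegral; congr fine.
apply: ae_eq_integral => //; [exact/measurable_EFinP|exact/measurable_EFinP|].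
by apply: filterS fg => x + Dx => /(_ Dx) ->.
Qed.

End real_integrable.

Section primitive_chain_rule.
Context {R : realType}.
Local Notation leb := (@lebesgue_measure R).

Lemma Rintegral_split (h : R -> R) (a b t : R) :
  leb.-integrable `[0, t] (EFin \o h) -> 0 <= a -> a <= b -> b <= t ->
  \int[leb]_(s in `[0, b]) h s - \int[leb]_(s in `[0, a]) h s =
  \int[leb]_(s in `[a, b]) h s.
Proof.
move=> hi a0 ab bt.
have hib : leb.-integrable `[0, b] (EFin \o h).
  apply: integrableS hi => //; apply: subset_itv; rewrite bnd_simp//.
rewrite Rintegral_itvB//.
apply: Rintegral_itv_obnd_cbnd.
by apply: integrableS hib => //; apply: subset_itv; rewrite bnd_simp.
Qed.

Lemma C11_continuous (psi dpsi : R -> R) C : C11 psi dpsi C -> continuous dpsi.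
Proof.
move=> [_ H] x; apply/cvgrPdist_le => e e0.
exists (e / (`|C| + 1)); first by rewrite /= divr_gt0// ltr_wpDl.
move=> y /= xy; rewrite (le_trans (H _ _))//.
rewrite ltr_pdivlMr ?ltr_wpDl// in xy.
have := ler_wpM2r (normr_ge0 (x - y)) (ler_norm C); have := normr_ge0 (x - y); lra.
Qed.

Lemma C11_continuous0 (psi dpsi : R -> R) C : C11 psi dpsi C -> continuous psi.
Proof.
move=> [H _] x; apply/cvgrPdist_le => e e0.
pose K := `|C| + `|dpsi x| + 1.
have K0 : 0 < K by rewrite ltr_wpDl// addr_ge0.
exists (Num.min 1 (e / K)); first by rewrite /= lt_min ltr01 divr_gt0.
move=> y /=; rewrite lt_min ltr_pdivlMr// => /andP[xy1 xyK].
have h1 := H x y; rewrite distrC.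
have h2 : `|psi y - psi x| <= C * (y - x) ^+ 2 + `|dpsi x| * `|y - x|.
  rewrite -normrM.
  have := ler_normD (psi y - psi x - dpsi x * (y - x)) (dpsi x * (y - x)).
  by rewrite subrK => h3; apply: le_trans h3 _; rewrite lerD2r.
apply: le_trans h2 _; rewrite -real_normK ?num_real// distrC.
have q2 : `|x - y| ^+ 2 <= `|x - y| by have := normr_ge0 (x - y); nra.
have := ler_wpM2l (normr_ge0 C) q2; have := ler_wpM2r (sqr_ge0 `|x - y|) (ler_norm C).
have := normr_ge0 (x - y); rewrite /K in xyK; lra.
Qed.

Section chain.
Variables (h : R -> R) (t c : R).
Hypothesis (hi : leb.-integrable `[0, t] (EFin \o h)) (t0 : 0 <= t).
Variables (psi dpsi : R -> R) (C M : R).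
Hypotheses (psiC : C11 psi dpsi C) (C0 : 0 <= C) (dpsiM : forall x, `|dpsi x| <= M).

Let U s := c + \int[leb]_(r in `[0, s]) h r.
Let V s := \int[leb]_(r in `[0, s]) `|h r|.
(** The defect of the chain rule. U need not be differentiable everywhere, so D is shown to be
    constant through its increments, which are quadratic in those of V. *)
Let D s := psi (U s) - \int[leb]_(r in `[0, s]) (dpsi (U r) * h r).

Let hni : leb.-integrable `[0, t] (EFin \o (fun s => `|h s|)).
Proof. exact: integrable_norm. Qed.

Lemma primitive_continuous : {within `[0, t], continuous U}.
Proof.
have H := parameterized_integral_continuous t0 hi.
move=> x; have /= Hx := H x.
apply: (@cvgD _ _ _ _ _ (fun=> c : R^o) (fun s => \int[leb]_(r in `[0, s]) h r : R^o)) => //.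
exact: cvg_cst.
Qed.

Lemma integrable_chain : leb.-integrable `[0, t] (EFin \o (fun s => dpsi (U s) * h s)).
Proof.
have mh : measurable_fun `[0, t]%classic h by apply/measurable_EFinP; exact: measurable_int hi.
have mU : measurable_fun `[0, t]%classic (dpsi \o U).
  apply: measurableT_comp.
    by apply: continuous_measurable_fun; exact: C11_continuous psiC.
  by apply: subspace_continuous_measurable_fun => //; exact: primitive_continuous.
apply: (@le_integrable _ _ R leb `[0, t]%classic _ _ (fun s => (M * `|h s|)%:E)) => //.
- by apply/measurable_EFinP; exact: measurable_funM.
- move=> s _ /=; rewrite lee_fin !normrM normr_id ler_wpM2r//.
  exact: le_trans (dpsiM _) (ler_norm _).
- exact: (integrableZl _ _ hni).
Qed.

Let Vmon u v : 0 <= u -> u <= v -> v <= t -> V u <= V v.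
Proof.
by move=> u0 uv vt; rewrite -subr_ge0 /V (Rintegral_split hni)//; exact: Rintegral_ge0.
Qed.

(** The increment of D is the Taylor remainder of psi between U a and U b, minus the integral of
    (dpsi(U s) - dpsi(U a)) h. As U varies by at most V b - V a on [a, b], each of the two is at
    most C (V b - V a)^2. *)
Let Dle a b : 0 <= a -> a <= b -> b <= t -> `|D b - D a| <= (C *+ 2) * (V b - V a) ^+ 2.
Proof.
move=> a0 ab bt.
have sub0 u v : 0 <= u -> v <= t -> `[u, v]%classic `<=` `[0, t]%classic.
  by move=> ? ?; apply: subset_itv; rewrite bnd_simp.
have Vab : V b - V a = \int[leb]_(s in `[a, b]) `|h s| by rewrite /V (Rintegral_split hni).
have hab : leb.-integrable `[a, b] (EFin \o h) by apply: integrableS hi => //; exact: sub0.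
have hnab : leb.-integrable `[a, b] (EFin \o (fun s => `|h s|)) by apply: integrableS hni => //; exact: sub0.
have cab : leb.-integrable `[a, b] (EFin \o (fun s => dpsi (U s) * h s)).
  by apply: integrableS integrable_chain => //; exact: sub0.
have UV r : a <= r -> r <= b -> `|U r - U a| <= V b - V a.
  move=> ar rb; have rt := le_trans rb bt.
  have -> : U r - U a = \int[leb]_(s in `[a, r]) h s.
    by rewrite /U opprD addrACA subrr add0r (Rintegral_split hi).
  have hr : leb.-integrable `[a, r] (EFin \o h) by apply: integrableS hi => //; exact: sub0.
  apply: le_trans (le_normr_Rintegral _ hr) _ => //.
  by rewrite -(Rintegral_split hni)// lerD2r Vmon// (le_trans a0).
have -> : D b - D a = (psi (U b) - psi (U a) - dpsi (U a) * (U b - U a)) -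
    \int[leb]_(s in `[a, b]) ((dpsi (U s) - dpsi (U a)) * h s).
  have -> : \int[leb]_(s in `[a, b]) ((dpsi (U s) - dpsi (U a)) * h s) =
     \int[leb]_(s in `[a, b]) (dpsi (U s) * h s) - dpsi (U a) * \int[leb]_(s in `[a, b]) h s.
    rewrite -RintegralZl// -RintegralB//; last exact: (integrableZl _ _ hab).
    by apply: eq_Rintegral => s _; rewrite mulrBl.
  rewrite -(Rintegral_split integrable_chain)// -(Rintegral_split hi)// /D /U; ring.
have dh : leb.-integrable `[a, b] (EFin \o (fun s => (dpsi (U s) - dpsi (U a)) * h s)).
  have mab : measurable (`[a, b]%classic : set (measurableTypeR R)) by exact: measurable_itv.
  have := integrable_rB mab cab (integrable_rZ mab (dpsi (U a)) hab).
  by apply: eq_integrable => // s _; rewrite /= mulrBl.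
rewrite (le_trans (ler_normB _ _))// mulr2n mulrDl lerD//.
  rewrite (le_trans (psiC.1 _ _))// ler_wpM2l// -[(U b - U a) ^+ 2]real_normK ?num_real//.
  by rewrite lerXn2r ?nnegrE ?UV// subr_ge0 Vmon.
rewrite (le_trans (le_normr_Rintegral _ dh))// expr2 mulrA {2}Vab -RintegralZl//.
apply: le_Rintegral => //.
- exact: integrable_norm.
- exact: (integrableZl _ _ hnab).
move=> s /=; rewrite in_itv/= => /andP[as_ sb]; rewrite normrM ler_wpM2r//.
by rewrite (le_trans (psiC.2 _ _))// ler_wpM2l// UV.
Qed.

Let V_continuous : {within `[0, t], continuous V}.
Proof. exact: parameterized_integral_continuous. Qed.

(* Halving the variation of V turns the quadratic modulus of Dle into 0. *)
Let Dhalf n a b : 0 <= a -> a <= b -> b <= t ->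
  `|D b - D a| <= (C *+ 2) * (V b - V a) ^+ 2 / 2 ^+ n.
Proof.
elim: n a b => [|n ih] a b a0 ab bt; first by rewrite expr0 divr1; exact: Dle.
have [m mab Vm] : exists2 m, m \in `[a, b] & V m = (V a + V b) / 2.
  apply: IVT => //.
    apply: continuous_subspaceW V_continuous.
    by apply: subset_itv; rewrite bnd_simp.
  have := Vmon a0 ab bt => h1.
  by rewrite min_l// max_r//; apply/andP; split; lra.
move: mab; rewrite in_itv/= => /andP[am mb].
have h1 := ih _ _ a0 am (le_trans mb bt).
have h2 := ih _ _ (le_trans a0 am) mb bt.
rewrite -[D b - D a](subrKA (D m)) (le_trans (ler_normD _ _))//.
apply: le_trans (lerD h2 h1) _.
rewrite Vm [2 ^+ n.+1]exprS invfM le_eqVlt; apply/orP; left; apply/eqP.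
set k := (2 ^+ n)^-1; by field.
Qed.

Lemma primitive_chain_rule :
  psi (c + \int[leb]_(s in `[0, t]) h s) - psi c =
  \int[leb]_(s in `[0, t]) (dpsi (c + \int[leb]_(r in `[0, s]) h r) * h s).
Proof.
have D0 : D t - D 0 = 0.
  apply/eqP; rewrite -normr_eq0 eq_le normr_ge0 andbT.
  apply/ler_addgt0Pr => e e0; rewrite add0r.
  set K := (C *+ 2) * (V t - V 0) ^+ 2.
  have K0 : 0 <= K by rewrite mulr_ge0// ?mulrn_wge0// sqr_ge0.
  (* Chosen so that 2^n > n >= K / e - 1, whence K / 2^n <= e. *)
  pose n := Num.Def.truncn (K / e).
  apply: le_trans (Dhalf n (lexx 0) t0 (lexx t)) _; rewrite -/K.
  rewrite ler_pdivrMr ?exprn_gt0// -ler_pdivrMl//.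
  rewrite mulrC (le_trans (ltW (truncnS_gt _)))// -/n -natrX ler_nat.
  by rewrite ltn_expl.
move: D0; rewrite /D /U.
have z (g : R -> R) : \int[leb]_(s in `[0, 0]) g s = 0.
  by rewrite set_itv1 Rintegral_set1.
rewrite !z addr0 subr0 => /eqP; rewrite subr_eq0 subr_eq => /eqP ->; ring.
Qed.

End chain.
End primitive_chain_rule.

Lemma measurable_comp2 d1 d2 d3 d4 (A : measurableType d1) (B : measurableType d2)
    (C : measurableType d3) (Y : measurableType d4) (F : A * B -> C) (a : Y -> A) (b : Y -> B) :
  measurable_fun setT F -> measurable_fun setT a -> measurable_fun setT b ->
  measurable_fun setT (fun y => F (a y, b y)).
Proof.
by move=> mF ma mb; exact: (measurableT_comp mF (measurable_fun_pair ma mb)).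
Qed.

(** * Jensen's inequality for powers on an interval *)

Section jensen.
Context {R : realType}.
Local Notation leb := (@lebesgue_measure R).

Lemma powR_pred_mul (a p : R) : 0 <= a -> p != 0 -> a `^ (p - 1) * a = a `^ p.
Proof.
move=> a0 p0; have [->|an0] := eqVneq a 0; first by rewrite mulr0 powR0.
by rewrite -[X in _ * X](powRr1 a0) -powRD ?an0 ?implybT// subrK.
Qed.

(** The convexity inequality for y^p, obtained from Young's inequality for a^(p-1) and y with
    exponents p/(p-1) and p. *)
Lemma powR_tangent (a y p : R) : 0 <= a -> 0 <= y -> 1 < p ->
  a `^ p + p * a `^ (p - 1) * (y - a) <= y `^ p.
Proof.
move=> a0 y0 p1; have p0 : 0 < p by lra.
have pm : 0 < p - 1 by lra.
have H := @conjugate_powR R (a `^ (p - 1)) y (p / (p - 1)) p (powR_ge0 _ _) y0.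
have {}H : a `^ (p - 1) * y <= (a `^ (p - 1)) `^ (p / (p - 1)) / (p / (p - 1)) + y `^ p / p.
  by apply: H => //; rewrite ?divr_gt0//; field; rewrite !gt_eqF.
rewrite -powRrM mulrCA divff ?gt_eqF// mulr1 in H.
have E := powR_pred_mul a0 (lt0r_neq0 p0).
have -> : p * a `^ (p - 1) * (y - a) = p * (a `^ (p - 1) * y) - p * a `^ p.
  by rewrite -E; ring.
have : p * (a `^ (p - 1) * y) <= (p - 1) * a `^ p + y `^ p.
  rewrite -ler_pdivlMl//; apply: le_trans H _.
  by rewrite le_eqVlt; apply/orP; left; apply/eqP; field; rewrite !gt_eqF.
lra.
Qed.

Lemma ler1_powR (y p : R) : 0 <= y -> 1 <= p -> y <= 1 + y `^ p.
Proof.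
move=> y0 p1; have [y1|y1] := leP y 1; first by have := powR_ge0 y p; lra.
by have := ler_powR (ltW y1) p1; rewrite powRr1//; lra.
Qed.

Lemma lebesgue_measure_itv0 (t : R) : 0 <= t -> leb `[0, t]%classic = t%:E.
Proof.
move=> t0; rewrite lebesgue_measure_itv/= lte_fin; case: ltP => [_|t0'].
  by rewrite oppr0 adde0.
by congr EFin; apply/eqP; rewrite eq_le t0 t0'.
Qed.

Lemma integrable_powR (h : R -> R) (t p : R) : measurable_fun `[0, t]%classic h ->
  0 <= t -> 1 <= p -> (\int[leb]_(s in `[0%R, t]) (`|h s| `^ p)%:E < +oo)%E ->
  leb.-integrable `[0, t] (EFin \o h).
Proof.
move=> mh t0 p1 hoo.
have mit : measurable (`[0, t]%classic : set (measurableTypeR R)) by exact: measurable_itv.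
have hp : leb.-integrable `[0, t] (EFin \o (fun s => `|h s| `^ p)).
  apply/integrableP; split.
    apply/measurable_EFinP; apply: (measurableT_comp (measurable_powR p)).
    exact: measurableT_comp.
  rewrite (le_lt_trans _ hoo)// le_eqVlt; apply/orP; left; apply/eqP.
  by apply: eq_integral => s _ /=; rewrite ger0_norm ?powR_ge0.
have c1 : leb.-integrable `[0, t] (EFin \o (fun=> 1 : R)).
  apply/integrableP; split; first exact/measurable_EFinP.
  rewrite (_ : (fun x => _) = cst 1%E); last by apply/funext => x /=; rewrite normr1.
  by rewrite integral_cst//= mul1e lebesgue_measure_itv0// ltry.
apply: integrable_rle (integrable_rD mit c1 hp) => //.
by move=> s _; exact: ler1_powR.
Qed.

Lemma jensen_powR (h : R -> R) (t p : R) : measurable_fun `[0, t]%classic h -> 0 < t -> 1 < p ->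
  ((`|\int[leb]_(s in `[0, t]) h s| `^ p)%:E <=
  (t `^ (p - 1))%:E * \int[leb]_(s in `[0%R, t]) (`|h s| `^ p)%:E)%E.
Proof.
move=> mh t0 p1.
have mit : measurable (`[0, t]%classic : set (measurableTypeR R)) by exact: measurable_itv.
have I0 : (0 <= \int[leb]_(s in `[0%R, t]) (`|h s| `^ p)%:E)%E.
  by apply: integral_ge0 => s _; rewrite lee_fin powR_ge0.
have [hoo|hoo] := eqVneq (\int[leb]_(s in `[0%R, t]) (`|h s| `^ p)%:E)%E +oo%E.
  by rewrite hoo gt0_muley ?leey// lte_fin powR_gt0.
have hlt : (\int[leb]_(s in `[0%R, t]) (`|h s| `^ p)%:E < +oo)%E by rewrite lt_neqAle hoo leey.
have hi := integrable_powR mh (ltW t0) (ltW p1) hlt.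
have hni : leb.-integrable `[0, t] (EFin \o (fun s => `|h s|)) by exact: integrable_norm.
have hp : leb.-integrable `[0, t] (EFin \o (fun s => `|h s| `^ p)).
  apply/integrableP; split.
    apply/measurable_EFinP; apply: (measurableT_comp (measurable_powR p)).
    exact: measurableT_comp.
  rewrite (le_lt_trans _ hlt)// le_eqVlt; apply/orP; left; apply/eqP.
  by apply: eq_integral => s _ /=; rewrite ger0_norm ?powR_ge0.
have c1 (k : R) : leb.-integrable `[0, t] (EFin \o (fun=> k : R)).
  apply/integrableP; split; first exact/measurable_EFinP.
  rewrite (_ : (fun x => _) = cst `|k|%:E)//.
  by rewrite integral_cst//= lebesgue_measure_itv0 ?ltW// -EFinM ltry.
rewrite -(@fineK _ (integral _ _ _)); last by rewrite ge0_fin_numE.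
rewrite -EFinM lee_fin -[fine _]/(\int[leb]_(s in `[0, t]) (`|h s| `^ p)).
set A := `|\int[leb]_(s in `[0, t]) h s|.
pose a := A / t.
have a0 : 0 <= a by apply: divr_ge0; [exact: normr_ge0|exact: ltW].
have Acst (k : R) : \int[leb]_(s in `[0, t]) k = k * t.
  by rewrite Rintegral_cst// [X in fine X]lebesgue_measure_itv0 ?ltW.
have K : a `^ p * t + p * a `^ (p - 1) * (\int[leb]_(s in `[0, t]) `|h s| - a * t)
    <= \int[leb]_(s in `[0, t]) (`|h s| `^ p).
  rewrite -!Acst -RintegralB// -RintegralZl//; last exact: integrable_rB.
  rewrite -RintegralD//; last exact/integrable_rZ/integrable_rB.
  apply: le_Rintegral => //.
    by apply: integrable_rD => //; exact/integrable_rZ/integrable_rB.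
  by move=> s _; exact: powR_tangent.
have nn : A <= \int[leb]_(s in `[0, t]) `|h s| by exact: le_normr_Rintegral.
have at_ : a * t = A by rewrite /a divfK// gt_eqF.
have : a `^ p * t <= \int[leb]_(s in `[0, t]) (`|h s| `^ p).
  apply: le_trans K; rewrite lerDl at_ mulr_ge0 ?subr_ge0//.
  by rewrite mulr_ge0 ?powR_ge0//; lra.
move=> K2.
have -> : A `^ p = a `^ p * t `^ p by rewrite -at_ powRM// ltW.
rewrite -(powR_pred_mul (ltW t0)) ?gt_eqF//; last lra.
by rewrite mulrCA ler_wpM2l ?powR_ge0.
Qed.

End jensen.

(** * Integrals along a measurable, measure-preserving family of maps *)

Section flow.
Context d (X : measurableType d) (R : realType) (mu : {sigma_finite_measure set X -> \bar R}).
Local Notation leb := (@lebesgue_measure R).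
Variable T : R -> X -> X.
Hypothesis mT : measurable_fun setT (fun p : measurableTypeR R * X => T p.1 p.2).
Hypothesis TP : forall s, measure_preserving mu (T s).

Definition flow_avg (g : X -> R) (t : R) (x : X) := \int[leb]_(s in `[0, t]) g (T s x).

Lemma flow_measurable d' (Y : measurableType d') (g : X -> Y) x : measurable_fun setT g ->
  measurable_fun [set: measurableTypeR R] (fun s => g (T s x)).
Proof.
move=> mg; apply: measurableT_comp mg _.
exact: (measurable_comp2 mT (@measurable_id _ _ _) (@measurable_cst _ _ _ _ _ _)).
Qed.

(** After exchanging the integrals, the inner one does not depend on s, because T s preserves mu. *)
Lemma flow_tonelli (f : X -> \bar R) (t : R) : measurable_fun setT f ->
  (forall x, 0 <= f x)%E -> 0 <= t ->
  (\int[mu]_x \int[leb]_(s in `[0%R, t]) f (T s x) = t%:E * \int[mu]_x f x)%E.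
Proof.
move=> mf f0 t0.
pose F (p : measurableTypeR R * X) := ((\1_(`[0, t]%classic) p.1)%:E * f (T p.1 p.2))%E.
have mF : measurable_fun setT F.
  apply: emeasurable_funM.
    apply/measurable_EFinP; apply: measurableT_comp measurable_fst.
    exact: measurable_indic.
  exact: measurableT_comp.
have F0 p : (0 <= F p)%E by rewrite mule_ge0// lee_fin.
transitivity (\int[mu]_x \int[leb]_s F (s, x))%E.
  apply: eq_integral => x _; rewrite integral_mkcond; apply: eq_integral => s _.
  by rewrite patchE /F indicE; case: ifPn => _ /=; rewrite ?mul1e ?mul0e.
rewrite -(@fubini_tonelli _ _ _ _ _ leb mu F mF F0).
transitivity (\int[leb]_(s in `[0%R, t]) \int[mu]_x f x)%E.
  rewrite [RHS]integral_mkcond; apply: eq_integral => s _.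
  rewrite patchE; case: ifPn => st.
    transitivity (\int[mu]_x f (T s x))%E; last exact: ge0_integral_preserved.
    apply: eq_integral => x _.
    by rewrite /F /= indicE st mul1e.
  by apply: integral0_eq => x _; rewrite /F /= indicE (negPf st) mul0e.
rewrite integral_cst// muleC; congr (_ * _)%E; exact: lebesgue_measure_itv0.
Qed.

(** An identity known for each time s off a null set depending on s is needed for one x and almost
    all s; Tonelli on the set B of failures provides this. *)
Lemma ae_flow_swap (B : set (measurableTypeR R * X)) (t : R) : measurable B ->
  (forall s, 0 <= s <= t -> {ae mu, forall x, ~ B (s, x)}) ->
  {ae mu, forall x, {ae leb, forall s, `[0, t]%classic s -> ~ B (s, x)}}.
Proof.
move=> mB Bae.
pose F (p : measurableTypeR R * X) : \bar R := ((\1_(`[0, t]%classic) p.1)%:E * (\1_B p)%:E)%E.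
have mF : measurable_fun setT F.
  apply: emeasurable_funM; apply/measurable_EFinP.
    by apply: measurableT_comp measurable_fst; exact: measurable_indic.
  exact: measurable_indic.
have F0 p : (0 <= F p)%E by rewrite mule_ge0// lee_fin.
have I0 : (\int[mu]_x \int[leb]_s F (s, x) = 0)%E.
  rewrite -(@fubini_tonelli _ _ _ _ _ leb mu F mF F0).
  apply: integral0_eq => s _.
  have [st|st] := boolP (s \in `[0, t]%classic); last first.
    by apply: integral0_eq => x _; rewrite /F /= indicE (negPf st) mul0e.
  have /Bae Bs : 0 <= s <= t by move: st; rewrite inE/= in_itv.
  transitivity (\int[mu]_x (cst 0 x))%E; last by rewrite integral0.
  apply: ge0_ae_eq_integral => //.
    exact: (measurable_comp2 mF (@measurable_cst _ _ _ _ _ _) (@measurable_id _ _ _)).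
  apply: filterS Bs => x nB _; rewrite /F /= [\1_B _]indicE.
  by rewrite memNset// mule0.
have mG : measurable_fun setT (fun x => \int[leb]_s F (s, x))%E.
  exact: (measurable_fun_fubini_tonelli_G F mF F0).
have : ae_eq mu setT (fun x => \int[leb]_s F (s, x))%E (cst 0%E).
  apply/(ae_eq_integral_abs mu measurableT mG).
  rewrite -[RHS]I0; apply: eq_integral => x _.
  by rewrite gee0_abs//; apply: integral_ge0.
apply: filterS => x /(_ I) /= Fx.
have mFx : measurable_fun setT (fun s => F (s, x)).
  exact: (measurable_comp2 mF (@measurable_id _ _ _) (@measurable_cst _ _ _ _ _ _)).
have : ae_eq leb setT (fun s => F (s, x)) (cst 0%E).
  apply/(ae_eq_integral_abs leb measurableT mFx).
  rewrite -[RHS]Fx; apply: eq_integral => s _.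
  by rewrite gee0_abs.
apply: filterS => s /(_ I) /= Fs st Bsx.
by move: Fs; rewrite /F /= !indicE !mem_set// mul1e => -[] /eqP; rewrite oner_eq0.
Qed.

Lemma measurable_flow_avg (g : X -> R) : measurable_fun setT g ->
  measurable_fun setT (fun p : measurableTypeR R * X => flow_avg g p.1 p.2).
Proof.
move=> mg.
(* The moving interval [0, t] becomes a condition on three variables. No integrability is assumed,
   so the two signs of F are integrated separately. *)
pose F (q : (measurableTypeR R * X) * measurableTypeR R) : \bar R :=
  ((if (0 <= q.2) && (q.2 <= q.1.1) then g (T q.2 q.1.2) else 0)%:E)%E.
have m1 : measurable_fun setT (fun q : (measurableTypeR R * X) * measurableTypeR R => q.1.1).
  exact: measurableT_comp measurable_fst measurable_fst.
have mF : measurable_fun setT F.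
  apply/measurable_EFinP; apply: measurable_fun_ifT => //.
    apply: measurable_and; first by apply: measurable_fun_ler => //; exact: measurable_snd.
    by apply: measurable_fun_ler => //; exact: measurable_snd.
  apply: measurableT_comp mg _.
  apply: (measurable_comp2 mT); first exact: measurable_snd.
  exact: measurableT_comp measurable_snd measurable_fst.
have -> : (fun p : measurableTypeR R * X => flow_avg g p.1 p.2) =
   fun p => fine (\int[leb]_s (F^\+ (p, s)) - \int[leb]_s (F^\- (p, s)))%E.
  apply/funext => p; rewrite /flow_avg Rintegral_mkcond /Rintegral; congr fine.
  rewrite integralE; congr (_ - _)%E; apply: eq_integral => s _.
    rewrite !funeposE; congr (maxe _ _); rewrite /F/= patchE; congr EFin.
    by rewrite mem_setE in_itv/=.
  rewrite !funenegE; congr (maxe _ _); rewrite /F/= patchE; congr (- EFin _)%E.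
  by rewrite mem_setE in_itv/=.
apply: measurableT_comp => //; apply: emeasurable_funB.
  exact: (measurable_fun_fubini_tonelli_F _ (measurable_funepos mF)).
exact: (measurable_fun_fubini_tonelli_F _ (measurable_funeneg mF)).
Qed.

Section Lp.
Variables (g : X -> R) (p : R).
Hypotheses (mg : measurable_fun setT g) (p1 : 1 < p).

Let mgp : measurable_fun setT (fun x => (`|g x| `^ p)%:E).
Proof.
apply/measurable_EFinP; apply: (measurableT_comp (measurable_powR p)).
exact: measurableT_comp.
Qed.

(** Jensen in time costs t^(p-1) and Tonelli contributes another factor t. *)
Lemma flow_avg_Lp t : 0 < t ->
  (\int[mu]_x (`|flow_avg g t x| `^ p)%:E <= (t `^ p)%:E * \int[mu]_x (`|g x| `^ p)%:E)%E.
Proof.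
move=> t0.
have mtx x : measurable_fun `[0, t]%classic (fun s => g (T s x)).
  exact: (measurable_funTS (flow_measurable x mg)).
have mavg : measurable_fun setT (fun x => flow_avg g t x).
  exact: (measurable_comp2 (measurable_flow_avg mg) (@measurable_cst _ _ _ _ _ _) (@measurable_id _ _ _)).
have mI : measurable_fun setT (fun x => \int[leb]_(s in `[0%R, t]) (`|g (T s x)| `^ p)%:E)%E.
  rewrite (_ : (fun x => _) = fun x => (\int[leb]_s ((\1_(`[0, t]%classic) s)%:E * (`|g (T s x)| `^ p)%:E))%E).
    apply: (@measurable_fun_fubini_tonelli_G _ _ _ _ _ leb (fun q : measurableTypeR R * X => ((\1_(`[0, t]%classic) q.1)%:E * (`|g (T q.1 q.2)| `^ p)%:E)%E)).
      apply: emeasurable_funM.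
        apply/measurable_EFinP; apply: measurableT_comp measurable_fst.
        exact: measurable_indic.
      exact: (measurableT_comp mgp mT).
    by move=> q; rewrite mule_ge0// lee_fin// powR_ge0.
  apply/funext => x; rewrite integral_mkcond; apply: eq_integral => s _.
  by rewrite patchE indicE; case: ifPn => _ /=; rewrite ?mul1e ?mul0e.
apply: (@le_trans _ _ (\int[mu]_x ((t `^ (p - 1))%:E * \int[leb]_(s in `[0%R, t]) (`|g (T s x)| `^ p)%:E))%E).
  apply: ge0_le_integral => //.
  - apply/measurable_EFinP; apply: (measurableT_comp (measurable_powR p)).
    exact: measurableT_comp.
  - exact: measurable_funeM.
  - by move=> x _; exact: jensen_powR.
rewrite ge0_integralZl//; last 2 first.
  by move=> x _; apply: integral_ge0 => s _; rewrite lee_fin powR_ge0.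
  by rewrite lee_fin powR_ge0.
rewrite (flow_tonelli mgp); [|by move=> x; rewrite lee_fin powR_ge0|exact: ltW].
have p0 : p != 0 by rewrite gt_eqF// (lt_trans _ p1).
by rewrite muleA -EFinM (powR_pred_mul (ltW t0) p0).
Qed.

Hypothesis gp : (\int[mu]_x (`|g x| `^ p)%:E < +oo)%E.

Lemma flow_integrable t : 0 <= t ->
  {ae mu, forall x, leb.-integrable `[0, t] (EFin \o (fun s => g (T s x)))}.
Proof.
move=> t0.
have mI : measurable_fun setT (fun x => \int[leb]_(s in `[0%R, t]) (`|g (T s x)| `^ p)%:E)%E.
  rewrite (_ : (fun x => _) = fun x => (\int[leb]_s ((\1_(`[0, t]%classic) s)%:E * (`|g (T s x)| `^ p)%:E))%E).
    apply: (@measurable_fun_fubini_tonelli_G _ _ _ _ _ leb (fun q : measurableTypeR R * X => ((\1_(`[0, t]%classic) q.1)%:E * (`|g (T q.1 q.2)| `^ p)%:E)%E)).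
      apply: emeasurable_funM.
        apply/measurable_EFinP; apply: measurableT_comp measurable_fst.
        exact: measurable_indic.
      exact: (measurableT_comp mgp mT).
    by move=> q; rewrite mule_ge0// lee_fin// powR_ge0.
  apply/funext => x; rewrite integral_mkcond; apply: eq_integral => s _.
  by rewrite patchE indicE; case: ifPn => _ /=; rewrite ?mul1e ?mul0e.
have I0 x : (0 <= \int[leb]_(s in `[0%R, t]) (`|g (T s x)| `^ p)%:E)%E.
  by apply: integral_ge0 => s _; rewrite lee_fin powR_ge0.
have : mu.-integrable setT (fun x => \int[leb]_(s in `[0%R, t]) (`|g (T s x)| `^ p)%:E)%E.
  apply/integrableP; split => //.
  under eq_integral do rewrite gee0_abs//.
  rewrite (flow_tonelli mgp)//.
  by rewrite lte_mul_pinfty// lee_fin.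
move=> /(integrable_ae measurableT); apply: filterS => x /(_ I) hx.
apply: (@integrable_powR R _ t p) => //.
- exact: (measurable_funTS (flow_measurable x mg)).
- exact: ltW.
- by rewrite -ge0_fin_numE.
Qed.

Variables (u : X -> R).
Hypotheses (mu_ : measurable_fun setT u)
 (ug : forall t, 0 < t -> {ae mu, forall x, u (T t x) - u x = flow_avg g t x}).
Variables (psi dpsi : R -> R) (C M : R).
Hypotheses (psiC : C11 psi dpsi C) (C0 : 0 <= C) (dpsiM : forall x, `|dpsi x| <= M).

Lemma flow_chain_rule t : 0 < t -> {ae mu, forall x,
  psi (u (T t x)) - psi (u x) = flow_avg (fun x => dpsi (u x) * g x) t x}.
Proof.
move=> t0.
(* The pairs where the flow identity fails. Only s > 0 is included, since [ug] covers positive times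
   only; the single time s = 0 is discarded below as a null set. *)
pose B : set (measurableTypeR R * X) := [set q | 0 < q.1 /\ u (T q.1 q.2) - u q.2 != flow_avg g q.1 q.2].
have mB : measurable B.
  rewrite (_ : B = (fun q : measurableTypeR R * X => (0 < q.1) && (u (T q.1 q.2) - u q.2 != flow_avg g q.1 q.2)) @^-1` [set true]).
    rewrite -[X in measurable X]setTI.
    suff mb : measurable_fun [set: measurableTypeR R * X] (fun q : measurableTypeR R * X => (0 < q.1) && (u (T q.1 q.2) - u q.2 != flow_avg g q.1 q.2)).
      exact: mb.
    apply: measurable_and; first by apply: measurable_fun_ltr => //; exact: measurable_fst.
    apply: measurable_neg; apply: measurable_fun_eqr.
      apply: measurable_funB; first exact: (measurableT_comp mu_ mT).
      exact: measurableT_comp mu_ measurable_snd.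
    exact: measurable_flow_avg.
  by apply/seteqP; split => q /=; [move=> [-> ->]|move=> /andP[]].
have /ae_flow_swap H : measurable B by [].
have {}H := H t.
have {}H : {ae mu, forall x, {ae leb, forall s, `[0, t]%classic s -> ~ B (s, x)}}.
  apply: H => s /andP[s0 st]; move: s0; rewrite le_eqVlt => /predU1P[<-|s0].
    by apply: aeW => x [] /=; rewrite ltxx.
  by apply: filterS (ug s0) => x E [_] /=; rewrite E eqxx.
apply: filterS3 H (flow_integrable (ltW t0)) (ug t0) => x Hx ix ux.
have E1 : u (T t x) = u x + \int[leb]_(s in `[0, t]) g (T s x) by move: ux; rewrite /flow_avg => <-; ring.
rewrite E1 (primitive_chain_rule (u x) ix (ltW t0) psiC C0 dpsiM) /flow_avg.
apply: ae_eq_Rintegral => //.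
- have ic := integrable_chain (u x) ix (ltW t0) psiC dpsiM.
  by apply/measurable_EFinP; exact: measurable_int ic.
- apply: measurable_funM; last exact: (measurable_funTS (flow_measurable x mg)).
  apply: (@measurable_funTS _ _ _ _ _ (fun s => dpsi (u (T s x)))).
  apply: (@flow_measurable _ _ (dpsi \o u)).
  apply: measurableT_comp mu_; apply: continuous_measurable_fun.
  exact: C11_continuous psiC.
have z : {ae leb, forall s : R, s <> 0}.
  exists [set 0]; split => //; first exact: lebesgue_measure_set1.
  by move=> s /= /contrapT.
move: z Hx; apply: (@filterS2 _ _ (ae_filter_ringOfSetsType leb)) => s s0 Bs st.
have {}Bs := Bs st.
congr (dpsi _ * _).
have s1 : 0 < s by rewrite lt_neqAle eq_sym; apply/andP; split; [exact/eqP|by move: st; rewrite /= in_itv => /andP[]].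
apply/eqP; apply: contra_notT Bs => ne; split => //=.
by apply: contra ne => /eqP; rewrite /flow_avg => <-; apply/eqP; ring.
Qed.

End Lp.
End flow.

(** * Bump functions *)

Section box_bump.
Context {R : realType} {n : nat}.
Local Notation V := 'rV[R]_n.
Local Notation mu := (lebesgue_rV R n).
Implicit Types (a b : 'I_n -> R).

(** Each factor e^(-1/((k+1) y)) is smooth, flat at y = 0 and tends to 1 for y > 0, so these test
    functions approximate the indicator of the open box. *)
Definition bump (k : nat) a b (x : V) : R :=
  \prod_(j < n) (flatp 1 (k.+1%:R * (x ord0 j - a j)) * flatp 1 (k.+1%:R * (b j - x ord0 j))).

Lemma bump_ge0 k a b x : 0 <= bump k a b x.
Proof. by apply: prodr_ge0 => j _; rewrite mulr_ge0// flatp_ge0. Qed.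

Lemma bump_le1 k a b x : bump k a b x <= 1.
Proof.
have : 0 <= bump k a b x <= 1; last by case/andP.
rewrite /bump; elim/big_ind : _ => [|u v /andP[u0 u1] /andP[v0 v1]|j _].
- by rewrite ler01 lexx.
- by rewrite mulr_ge0//= mulr_ile1.
- by rewrite mulr_ge0 ?flatp_ge0//= mulr_ile1 ?flatp_ge0 ?flatp_le1.
Qed.

Lemma bump_eq0 k a b x : ~ obox a b x -> bump k a b x = 0.
Proof.
move=> nab; apply/eqP; rewrite prodf_seq_eq0; apply/hasP.
have /existsNP[j jab] := nab.
exists j; first by rewrite mem_index_enum.
rewrite /= mulf_eq0 /flatp !pmulr_rgt0// !subr_gt0.
by move: jab; case: (a j < x ord0 j) => /=; rewrite ?eqxx//; case: (x ord0 j < b j) => //; rewrite eqxx orbT.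
Qed.

(** The map F is there because bumps composed with a flow also serve as test functions. *)
Lemma bump_smooth m k a b (F : 'rV[R]_m -> V) : (forall j, is_smooth (fun x => F x ord0 j)) ->
  is_smooth (fun x => bump k a b (F x)).
Proof.
move=> Fs l; apply: is_Ck_prod => j; apply: is_CkM; apply: is_smooth_flatp => {}l.
  apply: is_CkM; first exact: is_Ck_cst.
  by apply: is_CkD; [exact: Fs|exact: is_Ck_cst].
apply: is_CkM; first exact: is_Ck_cst.
apply: is_CkD; first exact: is_Ck_cst.
rewrite (_ : (fun x => _) = fun x => (-1) * F x ord0 j); last by apply/funext => x; rewrite mulN1r.
by apply: is_CkM; [exact: is_Ck_cst|exact: Fs].
Qed.

Lemma cvg_flatp (y : R) : flatp 1 (k.+1%:R * y) @[k --> \oo] --> ((0 < y)%R%:R : R).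
Proof.
have [y0|y0] := ltP 0 y; last first.
  rewrite (_ : (fun k => _) = cst 0); first exact: cvg_cst.
  apply/funext => k; rewrite /flatp ifF//; apply/negbTE.
  by rewrite -leNgt pmulr_rle0.
rewrite (_ : (fun k => _) = (fun k => expR (- (k.+1%:R^-1 * y^-1)))); last first.
  by apply/funext => k; rewrite /flatp mulr_gt0//= hornerE mul1r invfM.
have c : (- (k.+1%:R^-1 * y^-1) : R) @[k --> \oo] --> (0 : R).
  rewrite -[X in _ --> X]oppr0; apply: cvgN.
  rewrite -[X in _ --> X](mul0r y^-1); apply: cvgM; last exact: cvg_cst.
  exact: cvg_harmonic.
have := cvg_comp _ _ c (@continuous_expR R 0); rewrite expR0.
exact.
Qed.

Lemma cvg_prod_ord m (F : 'I_m -> nat -> R) (l : 'I_m -> R) :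
  (forall j, F j k @[k --> \oo] --> l j) ->
  (\prod_(j < m) F j k) @[k --> \oo] --> \prod_(j < m) l j.
Proof.
elim: m F l => [|m ih] F l Fl.
  rewrite big_ord0 (_ : (fun k => _) = cst 1); first exact: cvg_cst.
  by apply/funext => k; rewrite big_ord0.
rewrite big_ord_recl (_ : (fun k => _) = (fun k => F ord0 k * \prod_(j < m) F (lift ord0 j) k)).
  by apply: cvgM; [exact: Fl|apply: (ih (fun j => F (lift ord0 j))) => j; exact: Fl].
by apply/funext => k; rewrite big_ord_recl.
Qed.

Lemma cvg_bump a b x : bump k a b x @[k --> \oo] --> (\1_(obox a b) x : R).
Proof.
rewrite indicE; have [xab|xab] := pselect (obox a b x); last first.
  rewrite memNset// (_ : (fun k => _) = cst 0); first exact: cvg_cst.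
  by apply/funext => k; rewrite bump_eq0.
rewrite mem_set//= (_ : 1%:R = \prod_(j < n) (1 : R)); last by rewrite big1.
apply: (@cvg_prod_ord _ (fun j k => flatp 1 (k.+1%:R * (x ord0 j - a j)) * flatp 1 (k.+1%:R * (b j - x ord0 j)))) => j.
have /andP[aj bj] := xab j.
rewrite -[X in _ --> X]mulr1; apply: cvgM.
  by have := @cvg_flatp (x ord0 j - a j); rewrite subr_gt0 aj.
by have := @cvg_flatp (b j - x ord0 j); rewrite subr_gt0 bj.
Qed.

Lemma measurable_bump k a b : measurable_fun setT (bump k a b).
Proof.
apply: continuous_measurable_rV.
apply: (@is_Ck_continuous _ _ 0); apply: (@bump_smooth n k a b id) => j l.
exact: is_Ck_coord.
Qed.

Section fundamental_lemma.
Variable W : V -> R.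
Hypotheses (mW : measurable_fun setT W)
  (iW : forall a b, mu.-integrable (obox a b) (EFin \o W))
  (W0 : forall k a b, \int[mu]_x (W x * bump k a b x) = 0).

Let iW1 a b : mu.-integrable setT (fun x => (`|W x| * \1_(obox a b) x)%:E).
Proof.
have /integrable_norm/(integrable_mkcond _ (measurable_obox a b)) := iW a b.
apply: eq_integrable => // x _; rewrite patchE indicE.
by case: ifPn => /= _; rewrite ?mulr1 ?mulr0.
Qed.

Let Wbump_le k a b x : `|W x * bump k a b x| <= `|W x| * \1_(obox a b) x.
Proof.
rewrite normrM ler_wpM2l// (ger0_norm (bump_ge0 _ _ _ _)) indicE.
have [xab|xab] := pselect (obox a b x); first by rewrite mem_set// bump_le1.
by rewrite memNset// bump_eq0.
Qed.

Lemma integrable_mul_bump k a b : mu.-integrable setT (fun x => (W x * bump k a b x)%:E).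
Proof.
have H := @integrable_rle _ _ _ mu setT measurableT (fun x => W x * bump k a b x) (fun x => `|W x| * \1_(obox a b) x).
apply: H => //; first exact: (measurable_funM mW (measurable_bump k a b)).
exact: iW1.
Qed.

Lemma bump_integral_eq0 a b : (\int[mu]_(x in obox a b) (W x)%:E = 0)%E.
Proof.
have mWb k : measurable_fun setT (fun x => (W x * bump k a b x)%:E).
  by apply/measurable_EFinP; exact: measurable_funM mW (measurable_bump k a b).
have mWi : measurable_fun setT (fun x => (W x * \1_(obox a b) x)%:E).
  apply/measurable_EFinP; apply: measurable_funM mW _.
  by apply: measurable_indic; exact: measurable_obox.
have [||_ _] := @dominated_convergence _ _ _ mu setT measurableT
  (fun k x => (W x * bump k a b x)%:E) (fun x => (W x * \1_(obox a b) x)%:E)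
  (fun x => (`|W x| * \1_(obox a b) x)%:E) mWb mWi _ (iW1 a b).
- apply: aeW => x _; apply/fine_cvgP; split; first exact: nearW.
  by apply: cvgM; [exact: cvg_cst|exact: cvg_bump].
- by apply: aeW => x k _; rewrite lee_fin.
rewrite (_ : [sequence _]_k = cst 0%E) => [cv|]; last first.
  apply/funext => k; have := W0 k a b; rewrite /Rintegral /= => E.
  rewrite -[LHS]fineK ?E//.
  exact: (integrable_fin_num measurableT (integrable_mul_bump k a b)).
transitivity (\int[mu]_x (W x * \1_(obox a b) x)%:E)%E.
  rewrite integral_mkcond; apply: eq_integral => x _.
  by rewrite patchE indicE; case: ifPn => _; rewrite ?mulr1 ?mulr0.
apply: (cvg_unique _ cv); first exact: ereal_hausdorff.
exact: cvg_cst.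
Qed.

(* A Dynkin class argument, from boxes to all measurable subsets of a big box. *)
Lemma ae_eq0_bump : {ae mu, forall x, W x = 0}.
Proof.
suff H (m : nat) : {ae mu, forall x, obox (fun=> - m%:R) (fun=> m%:R) x -> W x = 0}.
  have /ae_foralln := H; apply: filterS => x Hx.
  have [m _ xm] : (\bigcup_k obox (fun=> - k%:R) (fun=> k%:R)) x by rewrite obox_cover.
  exact: Hx xm.
set B := obox _ _.
have mB : measurable B by exact: measurable_obox.
pose W' := (EFin \o W) \_ B.
have iW' : mu.-integrable setT W' by exact: ((integrable_mkcond (EFin \o W) mB).1 (iW _ _)).
have P0 S : measurable S -> (\int[mu]_(x in S) W' x = 0)%E.
  rewrite measurable_rV_obox; apply: (@dynkin_induction _ _ _ (fun S => (\int[mu]_(x in S) W' x = 0)%E) measurable_rV_obox).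
  - move=> _ _ [a [b ->]] [c [d ->]]; rewrite obox_setI.
    by do 2 eexists.
  - by rewrite -integral_mkcond bump_integral_eq0.
  - move=> _ [a [b ->]]; rewrite /W' integral_mkcond -patch_setI -integral_mkcond.
    by rewrite setIC obox_setI bump_integral_eq0.
  - move=> A mA A0.
    have := @integral_setU _ _ _ mu _ _ W' mA (measurableC mA).
    rewrite setUv A0 add0e => <-.
    + by rewrite -integral_mkcond bump_integral_eq0.
    + exact: measurable_int iW'.
    + by apply/disj_setPS; rewrite setICr.
  - move=> F mF tF F0; rewrite integral_bigcup//; last first.
      by apply: integrableS iW' => //; exact: bigcup_measurable.
    by apply: eseries0 => i _ _.
have := integral_ae_eq measurableT iW' (measurable_cst 0%E).
move=> /(_ (fun E _ mE => etrans (P0 E mE) (esym (integral0 _ _)))).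
apply: filterS => x /(_ I); rewrite /W' patchE => + Bx.
by rewrite mem_set// => -[].
Qed.

End fundamental_lemma.

End box_bump.

(** * Weak derivatives and flows *)

Section fubini_interval.
Context d (X : measurableType d) (R : realType).
Local Notation leb := (@lebesgue_measure R).

Lemma integrable_fine d' (Y : measurableType d') (nu : {measure set Y -> \bar R}) (f : Y -> \bar R) :
  nu.-integrable setT f -> nu.-integrable setT (fun x => (fine (f x))%:E).
Proof.
move=> fi; apply: (le_integrable measurableT _ _ fi).
  by apply/measurable_EFinP; apply: measurableT_comp => //; exact: measurable_int fi.
by move=> x _; case: (f x) => [r| |]//=; rewrite normr0 leey.
Qed.

(** In Fubini's theorem the inner integral may be infinite on a null set, where [fine] returns 0;
    this does not change the outer integral. *)
Lemma Rintegral_fine d' (Y : measurableType d') (nu : {measure set Y -> \bar R}) (f : Y -> \bar R) :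
  nu.-integrable setT f -> \int[nu]_x fine (f x) = fine (\int[nu]_x f x)%E.
Proof.
move=> fi; rewrite /Rintegral; congr fine; apply: ae_eq_integral => //.
- exact: measurable_int (integrable_fine fi).
- exact: measurable_int fi.
- have := integrable_ae measurableT fi.
  by apply: filterS => x /(_ I) xf _; rewrite fineK.
Qed.

Variables (mu : {sigma_finite_measure set X -> \bar R}) (F : R -> X -> R) (t : R).
Hypotheses (mF : measurable_fun setT (fun p : measurableTypeR R * X => F p.1 p.2))
  (iF : (\int[leb]_(s in `[0%R, t]) \int[mu]_x `|F s x|%:E < +oo)%E).

Let G (p : measurableTypeR R * X) : \bar R := ((\1_(`[0, t]%classic) p.1) * F p.1 p.2)%:E.

Let GE1 s x : G (s, x) = (if s \in `[0, t]%classic then F s x else 0)%:E.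
Proof. by rewrite /G /= indicE; case: ifPn; rewrite ?mul1r ?mul0r. Qed.

Let iG : (leb \x mu)%E.-integrable setT G.
Proof.
have mG : measurable_fun setT G.
  apply/measurable_EFinP; apply: measurable_funM => //.
  by apply: measurableT_comp measurable_fst; exact: measurable_indic.
apply: (integrable12ltyP leb mu mG).2.
apply: le_lt_trans iF; rewrite [X in (_ <= X)%E]integral_mkcond.
rewrite le_eqVlt; apply/orP; left; apply/eqP; apply: eq_integral => s _.
rewrite patchE; case: ifPn => st.
  by apply: eq_integral => x _; rewrite GE1 st.
by apply: integral0_eq => x _; rewrite GE1 (negPf st) abse0.
Qed.

Let inner1 s : fine (\int[mu]_x G (s, x))%E = (fun s => \int[mu]_x F s x) \_ `[0, t]%classic s.
Proof.
rewrite patchE; case: ifPn => st.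
  by rewrite /Rintegral; congr fine; apply: eq_integral => x _; rewrite GE1 st.
by rewrite integral0_eq// => x _; rewrite GE1 (negPf st).
Qed.

Let inner2 x : fine (\int[leb]_s G (s, x))%E = \int[leb]_(s in `[0, t]) F s x.
Proof.
rewrite Rintegral_mkcond /Rintegral; congr fine; apply: eq_integral => s _.
by rewrite GE1 patchE.
Qed.

Let iG2 : mu.-integrable setT (fun x => \int[leb]_s G (s, x))%E.
Proof.
have mG := measurable_int _ iG.
apply/integrableP; split; first exact: (measurable_fubini_G iG).
apply: le_lt_trans ((integrable21ltyP leb mu mG).1 iG).
apply: ge0_le_integral => //.
- by apply: measurableT_comp => //; exact: (measurable_fubini_G iG).
- apply: (measurable_fun_fubini_tonelli_G (abse \o G)) => //.
    exact: measurableT_comp.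
  by move=> q; exact: abse_ge0.
- move=> x _; apply: le_abse_integral => //.
  exact: (measurable_comp2 mG (@measurable_id _ _ _) (@measurable_cst _ _ _ _ _ _)).
Qed.

Lemma integrable_Rfubini_left : leb.-integrable `[0, t] (EFin \o (fun s => \int[mu]_x F s x)).
Proof.
have mit : measurable (`[0, t]%classic : set (measurableTypeR R)) by exact: measurable_itv.
apply/(integrable_mkcond _ mit); have := integrable_fine (integrable_fubini_F iG).
apply: eq_integrable => // s _; rewrite /fubini_F inner1 !patchE.
by case: ifPn.
Qed.

Lemma integrable_Rfubini : mu.-integrable setT (fun x => (\int[leb]_(s in `[0, t]) F s x)%:E).
Proof.
have := integrable_fine iG2.
by apply: eq_integrable => // x _; rewrite -inner2.
Qed.

Lemma Rfubini : \int[leb]_(s in `[0, t]) \int[mu]_x F s x = \int[mu]_x \int[leb]_(s in `[0, t]) F s x.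
Proof.
transitivity (fine (\int[(leb \x mu)%E]_p G p)%E).
  rewrite -integral12_prod_meas1// -Rintegral_fine; last exact: integrable_fubini_F.
  by rewrite Rintegral_mkcond; apply: eq_Rintegral => s _; rewrite -inner1.
rewrite -integral21_prod_meas1// -Rintegral_fine; last exact: iG2.
by apply: eq_Rintegral => x _; rewrite -inner2.
Qed.

End fubini_interval.

Section weak_flow.
Context {R : realType} {N : nat}.
Local Notation H := 'rV[R]_(N + N + 1).
Local Notation mu := (lebesgue_rV R (N + N + 1)).
Local Notation leb := (@lebesgue_measure R).
Variable i : 'I_(N + N).
Local Notation T := (hflow i).

Definition cube (k : nat) : set H := cbox (fun=> - k%:R) (fun=> k%:R).

Lemma cubeE k (x : H) : cube k x <-> forall j, `|x ord0 j| <= k%:R.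
Proof. by split=> h j; have := h j; rewrite ler_norml. Qed.

Lemma hflow_cube (k : nat) (t : R) : exists k' : nat, forall s x, `|s| <= t ->
  cube k x -> cube k' (T s x).
Proof.
(* On the cube of half-side k every component of X_i is at most 1 + k in absolute value. *)
exists (Num.Def.truncn (k%:R + t * (1 + k%:R))).+1 => s x st /cubeE kx; apply/cubeE => j.
apply: ltW; apply: le_lt_trans (truncnS_gt _).
have t0 : 0 <= t by apply: le_trans st.
have -> : (T s x) ord0 j = x ord0 j + s * hfield i x ord0 j.
  by rewrite /hflow [LHS]mxE; congr (_ + _); rewrite [LHS]mxE.
apply: le_trans (ler_normD _ _) _; apply: lerD; first exact: kx.
rewrite normrM ler_pM//.
case: (split_ordP j) => l ->.
  rewrite -[hfield _ _ _ _]/(hX (hfield i x) l) hX_field ger0_norm//.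
  by case: (l == i); rewrite ?lerDl// addr_ge0.
rewrite (ord1 l) -[hfield _ _ _ _]/(hT (hfield i x)) hT_field /hcoef.
case: (fintype.split i) => m; rewrite ?normrN normrM (@ger0_norm _ 2^-1)// /hX.
  by have := kx (lshift 1 (rshift N m)); have := ler0n R k; lra.
by have := kx (lshift 1 (lshift N m)); have := ler0n R k; lra.
Qed.

Lemma continuous_cube_bounded (psi : H -> R) (k : nat) : continuous psi ->
  (forall x, ~ cube k x -> psi x = 0) -> exists2 M, 0 <= M & forall x, `|psi x| <= M.
Proof.
move=> cpsi psi0.
have /compact_bounded[M [_ MP]] : compact [set psi x | x in cube k].
  apply: continuous_compact; last exact: cbox_compact.
  exact: continuous_subspaceT.
exists (`|M| + 1); first by rewrite addr_ge0.
move=> x; have [xk|xk] := pselect (cube k x); last by rewrite psi0// normr0 addr_ge0.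
apply: MP; last by exists x.
by rewrite (le_lt_trans (ler_norm _))// ltrDl.
Qed.

Lemma L1loc_cube w k : L1loc setT w -> mu.-integrable (cube k) (EFin \o w).
Proof. by move=> [_]; apply => //; exact: cbox_compact. Qed.

Section pairing.
Variables (w psi : H -> R) (k : nat).
Hypotheses (lw : L1loc setT w) (mpsi : measurable_fun setT psi)
  (psiM : exists2 M, 0 <= M & forall x, `|psi x| <= M)
  (psi0 : forall x, ~ cube k x -> psi x = 0).

Let mw : measurable_fun setT w. Proof. by case: lw. Qed.

Let mTT : measurable_fun setT (fun p : measurableTypeR R * H => T (- p.1) p.2).
Proof.
apply: (measurable_comp2 (measurable_hflow i)); last exact: measurable_snd.
by apply: measurable_funN; exact: measurable_fst.
Qed.

(** For all |s| <= t the supports of psi o T(-s) lie in one common cube, on which w is integrable. A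
    single majorant thus serves for continuity in s as well as for Fubini. *)
Lemma flow_dominated (t : R) : exists2 g : H -> R, mu.-integrable setT (EFin \o g) &
  forall s x, `|s| <= t -> `|w x * psi (T (- s) x)| <= g x.
Proof.
have [M M0 psi_le] := psiM.
have [k' kk'] := hflow_cube k t.
exists (fun x => M * (`|w x| * \1_(cube k') x)).
  apply: integrable_rZ => //.
  have /integrable_norm/(integrable_mkcond _ (measurable_cbox _ _)) := L1loc_cube k' lw.
  apply: eq_integrable => // x _; rewrite patchE /= indicE.
  by case: ifPn => /= _; rewrite ?mulr1 ?mulr0.
move=> s x st; rewrite normrM mulrC indicE.
have [xk|xk] := pselect (cube k' x); first by rewrite mem_set// mulr1 ler_wpM2r.
rewrite psi0 ?normr0 ?mul0r; first by rewrite !mulr_ge0.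
move=> Tk; apply: xk.
have -> : x = T s (T (- s) x) by rewrite -hflowD subrr hflow0.
exact: kk'.
Qed.

Lemma flow_pairing_integrable s : mu.-integrable setT (EFin \o (fun x => w x * psi (T (- s) x))).
Proof.
have [g ig gle] := flow_dominated `|s|.
apply: integrable_rle ig => //; last by move=> x _; exact: gle.
apply: measurable_funM => //; apply: measurableT_comp mpsi _.
exact: (hflow_preserving i (- s)).1.
Qed.

Lemma flow_pairing_continuous : continuous psi ->
  {for 0, continuous (fun s => \int[mu]_x (w x * psi (T (- s) x)))}.
Proof.
move=> cpsi; have [g ig gle] := flow_dominated 1.
have := @continuity_under_integral R _ H mu (fun s x => w x * psi (T (- s) x)) setT measurableT (-1) 1.
move=> /(_ (fun s _ => flow_pairing_integrable s)) CI.
apply: CI ig _ 0 _.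
- apply: aeW => x _ s _.
  apply: continuousM; first exact: cst_continuous.
  apply: continuous_comp; last exact: cpsi.
  apply: (@continuous_comp _ _ _ -%R (fun r => T r x)); first exact: opp_continuous.
  exact: hflow_continuous.
- move=> s /=; rewrite in_itv/= => /andP[s1 s2]; apply: aeW => x _; apply: gle.
  by rewrite ler_norml !ltW.
- by rewrite inE/= in_itv/= oppr_lt0 ltr01.
Qed.

Lemma flow_pairing_finite (t : R) : 0 <= t ->
  (\int[leb]_(s in `[0%R, t]) \int[mu]_x `|w x * psi (T (- s) x)|%:E < +oo)%E.
Proof.
move=> t0; have [g ig gle] := flow_dominated t.
apply: (@le_lt_trans _ _ (\int[leb]_(s in `[0%R, t]) \int[mu]_x (g x)%:E)%E).
  apply: ge0_le_integral => //.
  - by move=> s _; apply: integral_ge0.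
  - apply: measurable_funTS.
    apply: (measurable_fun_fubini_tonelli_F (fun p : measurableTypeR R * H => `|w p.2 * psi (T (- p.1) p.2)|%:E)) => //.
    apply/measurable_EFinP; apply: measurableT_comp => //; apply: measurable_funM.
      exact: measurableT_comp mw measurable_snd.
    exact: measurableT_comp mpsi mTT.
  - move=> s /=; rewrite in_itv/= => /andP[s0 st]; apply: ge0_le_integral => //.
    + apply/measurable_EFinP; apply: measurableT_comp => //.
      by apply/measurable_EFinP; exact: measurable_int (flow_pairing_integrable s).
    + exact: measurable_int ig.
    + by move=> x _; rewrite lee_fin; apply: gle; rewrite ger0_norm.
have -> : (\int[leb]_(s in `[0%R, t]) \int[mu]_x (g x)%:E = t%:E * \int[mu]_x (g x)%:E)%E.
  by rewrite integral_cst// muleC; congr (_ * _)%E; exact: lebesgue_measure_itv0.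
apply: lte_mul_pinfty => //.
by have := integrable_fin_num measurableT ig; rewrite fin_numElt => /andP[].
Qed.

Lemma flow_pairing_integrable_left (t : R) : 0 <= t ->
  leb.-integrable `[0, t] (EFin \o (fun s => \int[mu]_x (w x * psi (T (- s) x)))).
Proof.
move=> t0; apply: (integrable_Rfubini_left _ (flow_pairing_finite t0)).
apply: measurable_funM; first exact: measurableT_comp mw measurable_snd.
exact: measurableT_comp mpsi mTT.
Qed.

Lemma flow_pairing_fubini (t : R) : continuous psi -> 0 <= t ->
  \int[leb]_(s in `[0, t]) \int[mu]_x (w x * psi (T (- s) x)) =
  \int[mu]_x (w x * \int[leb]_(s in `[0, t]) psi (T (- s) x)).
Proof.
move=> cpsi t0; rewrite (Rfubini _ (flow_pairing_finite t0)); last first.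
  apply: measurable_funM; first exact: measurableT_comp mw measurable_snd.
  exact: measurableT_comp mpsi mTT.
apply: eq_Rintegral => x _; rewrite RintegralZl//.
apply: continuous_compact_integrable; first exact: segment_compact.
apply: continuous_subspaceT => s.
apply: continuous_comp; last exact: cpsi.
apply: (@continuous_comp _ _ _ -%R (fun r => T r x)); first exact: opp_continuous.
exact: hflow_continuous.
Qed.

Lemma flow_pairing_shift s : \int[mu]_x (w x * psi (T (- s) x)) = \int[mu]_x (w (T s x) * psi x).
Proof.
rewrite -(Rintegral_preserved (hflow_preserving i s) (flow_pairing_integrable s)).
by apply: eq_Rintegral => x _; rewrite -hflowD addNr hflow0.
Qed.

Let flow_shift_finite (t : R) : 0 <= t ->
  (\int[leb]_(s in `[0%R, t]) \int[mu]_x `|w (T s x) * psi x|%:E < +oo)%E.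
Proof.
move=> t0; apply: le_lt_trans (flow_pairing_finite t0).
rewrite le_eqVlt; apply/orP; left; apply/eqP; apply: eq_integral => s _.
rewrite -[RHS](ge0_integral_preserved (hflow_preserving i s))//; last first.
  apply/measurable_EFinP; apply: measurableT_comp => //; apply: measurable_funM => //.
  exact: measurableT_comp mpsi (hflow_preserving i (- s)).1.
by apply: eq_integral => x _; rewrite -hflowD addNr hflow0.
Qed.

Let m_flow_shift : measurable_fun setT (fun p : measurableTypeR R * H => w (T p.1 p.2) * psi p.2).
Proof.
apply: measurable_funM; first exact: measurableT_comp mw (measurable_hflow i).
exact: measurableT_comp mpsi measurable_snd.
Qed.

Section average.
Variable t : R.
Hypotheses (t0 : 0 <= t)
  (iw : {ae mu, forall x, leb.-integrable `[0, t] (EFin \o (fun s => w (T s x)))}).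

Let mavg : measurable_fun setT (fun x => flow_avg T w t x).
Proof.
exact: (measurable_comp2 (measurable_flow_avg (measurable_hflow i) mw)
  (@measurable_cst _ _ _ _ _ _) (@measurable_id _ _ _)).
Qed.

Let shift_avg : {ae mu, forall x,
  \int[leb]_(s in `[0, t]) (w (T s x) * psi x) = flow_avg T w t x * psi x}.
Proof. by apply: filterS iw => x ix; rewrite RintegralZr. Qed.

Lemma flow_avg_pairing_integrable : mu.-integrable setT (EFin \o (fun x => flow_avg T w t x * psi x)).
Proof.
have := integrable_Rfubini m_flow_shift (flow_shift_finite t0).
move=> /integrableP[mI Ioo]; apply/integrableP; split.
  by apply/measurable_EFinP; exact: measurable_funM.
apply: le_lt_trans Ioo; rewrite le_eqVlt; apply/orP; left; apply/eqP.
apply: ge0_ae_eq_integral => //.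
- apply: measurableT_comp => //; apply/measurable_EFinP; exact: measurable_funM.
- exact: measurableT_comp.
- by apply: filterS shift_avg => x /= -> _.
Qed.

Lemma flow_avg_pairing :
  \int[mu]_x (flow_avg T w t x * psi x) =
  \int[leb]_(s in `[0, t]) \int[mu]_x (w x * psi (T (- s) x)).
Proof.
transitivity (\int[mu]_x \int[leb]_(s in `[0, t]) (w (T s x) * psi x)).
  apply: ae_eq_Rintegral => //.
  - exact: measurable_funM.
  - apply/measurable_EFinP.
    exact: measurable_int (integrable_Rfubini m_flow_shift (flow_shift_finite t0)).
  - by apply: filterS shift_avg => x /= -> _.
rewrite -(Rfubini m_flow_shift (flow_shift_finite t0)).
by apply: eq_Rintegral => s _; rewrite flow_pairing_shift.
Qed.

End average.
End pairing.

Lemma flow_FTC phi t x : is_Ck 1 phi -> 0 < t ->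
  \int[leb]_(s in `[0, t]) hD i phi (T (- s) x) = phi x - phi (T (- t) x).
Proof.
move=> Cphi t0.
pose F (s : R) := - phi (T (- s) x).
have Fd s : is_derive s (1 : R) F (hD i phi (T (- s) x)).
  have d1 : is_derive s (1 : R) (fun s => phi (T (- s) x)) (hD i phi (T (- s) x) * (-1)).
    apply: (@is_derive1_comp R (fun s => phi (T s x)) -%R); first exact: is_derive_hflow.
  by have := is_deriveN d1; rewrite mulrN1 opprK.
have Fc : continuous F.
  move=> s; apply: differentiable_continuous; apply/derivable1_diffP.
  by have [] := Fd s.
have cD : continuous (fun s => hD i phi (T (- s) x)).
  move=> s; apply: continuous_comp; last exact: hD_continuous.
  apply: (@continuous_comp _ _ _ -%R (fun r => T r x)); first exact: opp_continuous.
  exact: hflow_continuous.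
rewrite /Rintegral (@continuous_FTC2 _ _ F)//.
- by rewrite /F oppr0 hflow0 -EFinB/=; ring.
- exact: continuous_subspaceT.
- split.
  + by move=> s _; have [] := Fd s.
  + by apply: cvg_at_right_filter; exact: Fc.
  + by apply: cvg_at_left_filter; exact: Fc.
- by move=> s _; rewrite derive1E; have [] := Fd s.
Qed.

Lemma hD_support (phi : H -> R) (S : set H) : closed S -> (forall x, ~ S x -> phi x = 0) ->
  forall x, ~ S x -> hD i phi x = 0.
Proof.
move=> cS phi0 x xS.
suff dx : is_derive x (hfield i x) phi 0 by case: dx.
apply: (@near_eq_is_derive R H R (cst 0) _ _ _ _ _ (is_derive_cst _ _ _)).
have /open_nbhs_nbhs : open_nbhs x (~` S) by split => //; exact: closed_openC.
by apply: filterS => y /phi0 ->.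
Qed.

Lemma compact_supp_cube (phi : H -> R) k : (forall x, ~ cube k x -> phi x = 0) ->
  compact_supp_in setT phi.
Proof.
move=> phi0; split => //.
apply: (@subclosed_compact _ _ (cube k)); [exact: closed_closure|exact: cbox_compact|].
have cc : closed (cube k) by exact: cbox_closed.
rewrite [X in _ `<=` X]((closure_id (cube k)).1 cc).
apply: closureS => x /= phix; apply: contrapT => xk.
by rewrite phi0 ?eqxx in phix.
Qed.

Lemma compact_supp_sub_cube (D : set H) (phi : H -> R) : compact_supp_in D phi ->
  exists k, forall x, ~ cube k x -> phi x = 0.
Proof.
move=> [cphi _]; have [k kP] := compact_sub_cbox cphi.
exists k => x xk; apply: contrapT => /eqP phix; apply: xk; apply: kP.
exact: subset_closure.
Qed.

(** Recovers an identity at time 0 from its time integrals; continuity is required at 0 only. *)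
Lemma avg_eq0 (h : R -> R) : {for 0, continuous h} ->
  (forall t, 0 < t -> \int[leb]_(s in `[0, t]) h s = 0) ->
  (forall t, 0 < t -> leb.-integrable `[0, t] (EFin \o h)) -> h 0 = 0.
Proof.
move=> ch h0 ih; apply/eqP; apply/negPn/negP => hn0.
have e0 : 0 < `|h 0| / 2 by rewrite divr_gt0// normr_gt0.
move/cvgrPdist_lt : ch => /(_ _ e0)/nbhs_ballP[r /= r0 hr].
pose t := r / 2.
have t0 : 0 < t by rewrite divr_gt0.
have mit : measurable (`[0, t]%classic : set (measurableTypeR R)) by exact: measurable_itv.
have c1 (c : R) : leb.-integrable `[0, t] (EFin \o (fun=> c : R)).
  by apply: continuous_compact_integrable; [exact: segment_compact|apply: continuous_subspaceT => s; exact: cst_continuous].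
have cst_int (c : R) : \int[leb]_(s in `[0, t]) c = c * t.
  by rewrite Rintegral_cst// [X in fine X]lebesgue_measure_itv0 ?ltW.
have : `|\int[leb]_(s in `[0, t]) (h 0 - h s)| <= `|h 0| / 2 * t.
  apply: le_trans (le_normr_Rintegral mit (integrable_rB mit (c1 (h 0)) (ih _ t0))) _.
  rewrite -cst_int.
  apply: le_Rintegral => //.
    exact: integrable_norm (integrable_rB mit (c1 (h 0)) (ih _ t0)).
  move=> s /=; rewrite in_itv/= => /andP[s0 st]; apply/ltW/hr.
  by rewrite /ball/= sub0r normrN ger0_norm// (le_lt_trans st)// /t; lra.
rewrite RintegralB//; last exact: ih.
rewrite h0// subr0 cst_int normrM [X in _ * X]gtr0_norm// ler_pM2r//.
by have hp : 0 < `|h 0| by [rewrite normr_gt0]; lra.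
Qed.

Lemma continuous_cube (psi : H -> R) k : continuous psi -> (forall x, ~ cube k x -> psi x = 0) ->
  measurable_fun setT psi /\ exists2 M, 0 <= M & forall x, `|psi x| <= M.
Proof.
move=> cpsi psi0; split; first exact: continuous_measurable_rV.
exact: continuous_cube_bounded psi0.
Qed.

(** From flow identity to weak derivative. Put h(s) for the sum of the pairings of v with (X_i phi)
    o T(-s) and of G with phi o T(-s). Its integral over [0, t] is the pairing of v - v o T_t +
    int_0^t G o T_r dr with phi, hence 0; letting t tend to 0 gives h(0) = 0. *)
Lemma flow_weak_derivative (v G : H -> R) : L1loc setT v -> L1loc setT G ->
  (forall t, 0 < t -> {ae mu, forall x, leb.-integrable `[0, t] (EFin \o (fun s => G (T s x)))}) ->
  (forall t, 0 < t -> {ae mu, forall x, v (T t x) - v x = flow_avg T G t x}) ->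
  forall phi, test_fun setT phi ->
  \int[mu]_x (v x * hD i phi x) = - \int[mu]_x (G x * phi x).
Proof.
move=> lv lG iG vG phi [sphi cphi].
have Cphi := sphi 1%N.
have [k phi0] := compact_supp_sub_cube cphi.
have cp := is_Ck_continuous Cphi.
have cD : continuous (hD i phi) := hD_continuous Cphi.
have D0 := hD_support (@cbox_closed _ _ _ _) phi0.
have [mphi bphi] := continuous_cube cp phi0.
have [mD bD] := continuous_cube cD D0.
pose h (s : R) := \int[mu]_x (v x * hD i phi (T (- s) x)) + \int[mu]_x (G x * phi (T (- s) x)).
suff : h 0 = 0.
  rewrite /h oppr0; under eq_Rintegral do rewrite hflow0.
  move=> /eqP; rewrite addr_eq0 => /eqP ->; congr (- _).
  by apply: eq_Rintegral => x _; rewrite hflow0.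
have mit (t : R) : measurable (`[0, t]%classic : set (measurableTypeR R)) by exact: measurable_itv.
apply: avg_eq0.
- apply: continuousD; [exact: (flow_pairing_continuous lv mD bD D0 cD)|exact: (flow_pairing_continuous lG mphi bphi phi0 cp)].
- move=> t t0; rewrite RintegralD//; last 2 first.
  + exact: (flow_pairing_integrable_left lv mD bD D0 (ltW t0)).
  + exact: (flow_pairing_integrable_left lG mphi bphi phi0 (ltW t0)).
  rewrite (flow_pairing_fubini lv mD bD D0 cD (ltW t0)).
  under eq_Rintegral do rewrite flow_FTC//.
  rewrite -(flow_avg_pairing lG mphi bphi phi0 (ltW t0) (iG _ t0)).
  have i1 := flow_pairing_integrable lv mphi bphi phi0 0.
  have i2 := flow_pairing_integrable lv mphi bphi phi0 t.
  have -> : \int[mu]_x (v x * (phi x - phi (T (- t) x))) =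
     \int[mu]_x (v x * phi (T (- 0) x)) - \int[mu]_x (v (T t x) * phi x).
    rewrite -(flow_pairing_shift lv mphi bphi phi0) -RintegralB//.
    by apply: eq_Rintegral => x _; rewrite oppr0 hflow0 mulrBr.
  have i3 : mu.-integrable setT (EFin \o (fun x => v (T t x) * phi x)).
    have := integrable_preserved (hflow_preserving i t) i2.
    by apply: eq_integrable => // x _ /=; rewrite -hflowD addNr hflow0.
  rewrite -RintegralB// -RintegralD//; last 2 first.
  + exact: integrable_rB.
  + exact: (flow_avg_pairing_integrable lG mphi bphi phi0 (ltW t0) (iG _ t0)).
  transitivity (\int[mu]_(x in setT) (0 : R)); last by rewrite Rintegral_cst// mul0r.
  apply: ae_eq_Rintegral => //.
  + have i4 := integrable_rD measurableT (integrable_rB measurableT i1 i3)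
      (flow_avg_pairing_integrable lG mphi bphi phi0 (ltW t0) (iG _ t0)).
    by apply/measurable_EFinP; exact: (measurable_int mu i4).
  + apply: filterS (vG _ t0) => x <- _; rewrite oppr0 hflow0; ring.
- move=> t t0; apply: integrable_rD => //.
  + exact: (flow_pairing_integrable_left lv mD bD D0 (ltW t0)).
  + exact: (flow_pairing_integrable_left lG mphi bphi phi0 (ltW t0)).
Qed.

(** The converse: the weak identity is tested with phi o T(-s) and integrated over s in [0, t],
    which shows that W is orthogonal to every bump. The L^p bound on the component of the gradient
    makes its integral along almost every flow line meaningful. *)
Lemma weak_derivative_flow (u : H -> R) (Gv : H -> 'rV[R]_(N + N)) (p t : R) : 1 < p -> 0 < t ->
  weak_hgrad setT u Gv ->
  (\int[mu]_x (`|Gv x ord0 i| `^ p)%:E < +oo)%E ->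
  {ae mu, forall x, u (T t x) - u x = flow_avg T (fun x => Gv x ord0 i) t x}.
Proof.
move=> p1 t0 [lu /(_ i) [lG uG]] Gp.
set G := fun x => Gv x ord0 i in lG uG Gp *.
have mG : measurable_fun setT G by case: lG.
have iGt s : 0 < s -> {ae mu, forall x, leb.-integrable `[0, s] (EFin \o (fun r => G (T r x)))}.
  by move=> s0; apply: (flow_integrable (measurable_hflow i) (hflow_preserving i) mG p1 Gp); exact: ltW.
pose W x := u (T t x) - u x - flow_avg T G t x.
have mu_ : measurable_fun setT u by case: lu.
have mW : measurable_fun setT W.
  apply: measurable_funB; first apply: measurable_funB => //.
    exact: measurableT_comp mu_ (hflow_preserving i t).1.
  exact: (measurable_comp2 (measurable_flow_avg (measurable_hflow i) mG)
    (@measurable_cst _ _ _ _ _ _) (@measurable_id _ _ _)).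
suff : {ae mu, forall x, W x = 0}.
  by apply: filterS => x /eqP; rewrite subr_eq0 => /eqP.
have pair (psi : H -> R) k : measurable_fun setT psi -> (exists2 M, 0 <= M & forall x, `|psi x| <= M) ->
   (forall x, ~ cube k x -> psi x = 0) ->
   [/\ mu.-integrable setT (EFin \o (fun x => u (T t x) * psi x)),
       mu.-integrable setT (EFin \o (fun x => u x * psi x)) &
       mu.-integrable setT (EFin \o (fun x => flow_avg T G t x * psi x))].
  move=> mpsi bpsi psi0; split.
  - have := integrable_preserved (hflow_preserving i t) (flow_pairing_integrable lu mpsi bpsi psi0 t).
    by apply: eq_integrable => // x _ /=; rewrite -hflowD addNr hflow0.
  - have := flow_pairing_integrable lu mpsi bpsi psi0 0.
    by apply: eq_integrable => // x _ /=; rewrite oppr0 hflow0.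
  - exact: (flow_avg_pairing_integrable lG mpsi bpsi psi0 (ltW t0) (iGt _ t0)).
apply: ae_eq0_bump => // [a b|m a b].
  have [k kP] := bounded_sub_obox (obox_bounded a b).
  have ab0 x : ~ cube k x -> (\1_(obox a b) x : R) = 0.
    move=> xk; rewrite indicE memNset// => /kP xk'; apply: xk => j.
    by have /andP[? ?] := xk' j; apply/andP; split; exact: ltW.
  have m1 : measurable_fun setT (\1_(obox a b) : H -> R).
    by apply: measurable_indic; exact: measurable_obox.
  have b1 : exists2 M, 0 <= M & forall x, `|(\1_(obox a b) : H -> R) x| <= M.
    by exists 1 => // x; rewrite indicE; case: (_ \in _); rewrite ?normr1// normr0.
  have [i1 i2 i3] := pair _ k m1 b1 ab0.
  apply/(integrable_mkcond _ (measurable_obox a b)).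
  have := integrable_rB measurableT (integrable_rB measurableT i1 i2) i3.
  apply: eq_integrable => // x _; rewrite patchE /= indicE /W.
  by case: ifPn => _; rewrite ?mulr1// !mulr0 !subr0.
have [k kP] := bounded_sub_obox (obox_bounded a b).
pose phi := bump m a b.
have phi0 x : ~ cube k x -> phi x = 0.
  move=> xk; apply: bump_eq0 => /kP xk'; apply: xk => j.
  by have /andP[? ?] := xk' j; apply/andP; split; exact: ltW.
have sphi (F : H -> H) : (forall j, is_smooth (fun x => F x ord0 j)) -> is_smooth (fun x => phi (F x)).
  exact: bump_smooth.
have Cphi : is_Ck 1 phi by apply: (sphi id) => j l; exact: is_Ck_coord.
have cp := is_Ck_continuous Cphi.
have cD : continuous (hD i phi) := hD_continuous Cphi.
have D0 := hD_support (@cbox_closed _ _ _ _) phi0.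
have [mphi bphi] := continuous_cube cp phi0.
have [mD bD] := continuous_cube cD D0.
have [i1 i2 i3] := pair phi k mphi bphi phi0.
transitivity (\int[mu]_x (u (T t x) * phi x) - \int[mu]_x (u x * phi x) - \int[mu]_x (flow_avg T G t x * phi x)).
  rewrite -RintegralB// -RintegralB//; last exact: integrable_rB.
  by apply: eq_Rintegral => x _; rewrite /W !mulrBl.
rewrite (flow_avg_pairing lG mphi bphi phi0 (ltW t0) (iGt _ t0)).
have E : \int[leb]_(s in `[0, t]) \int[mu]_x (u x * hD i phi (T (- s) x)) =
  - \int[leb]_(s in `[0, t]) \int[mu]_x (G x * phi (T (- s) x)).
  rewrite -mulN1r -RintegralZl//; last exact: (flow_pairing_integrable_left lG mphi bphi phi0 (ltW t0)).
  apply: eq_Rintegral => s _; rewrite mulN1r -uG.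
    by apply: eq_Rintegral => x _; rewrite -hD_flow.
  split; first by apply: sphi => j l; exact: is_Ck_hflow_coord.
  (* The support of phi moves with the flow, so it is enclosed in a larger cube. *)
  have [k' kk'] := hflow_cube k `|s|.
  apply: (@compact_supp_cube _ k') => x xk; apply: phi0 => Txk; apply: xk.
  have -> : x = T s (T (- s) x) by rewrite -hflowD subrr hflow0.
  exact: kk'.
rewrite -[X in _ - X]opprK -E opprK (flow_pairing_fubini lu mD bD D0 cD (ltW t0)).
under [X in _ + X]eq_Rintegral do rewrite flow_FTC//.
have -> : \int[mu]_x (u x * (phi x - phi (T (- t) x))) =
     \int[mu]_x (u x * phi x) - \int[mu]_x (u (T t x) * phi x).
  rewrite -(flow_pairing_shift lu mphi bphi phi0) -RintegralB//.
    by apply: eq_Rintegral => x _; rewrite mulrBr.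
  exact: (flow_pairing_integrable lu mphi bphi phi0 t).
ring.
Qed.

End weak_flow.

(** * Truncated test functions and the energy estimate *)

Section Lfun_characterization.
Context d (X : measurableType d) (R : realType) (mu : {measure set X -> \bar R}).
Implicit Type f : X -> R.

Lemma Lfun_powRP f (p : R) : 0 < p ->
  f \in Lfun mu p%:E <-> measurable_fun setT f /\ (\int[mu]_x (`|f x| `^ p)%:E < +oo)%E.
Proof.
move=> p0.
have E : (Lnorm mu p%:E (EFin \o f) < +oo)%E <-> (\int[mu]_x (`|f x| `^ p)%:E < +oo)%E.
  have -> : (\int[mu]_x (`|f x| `^ p)%:E = Lnorm mu p%:E (EFin \o f) `^ p)%E.
    by rewrite poweR_Lnorm ?gt_eqF//; apply: eq_integral.
  split=> [|]; first by move=> ?; exact: poweR_lty.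
  have := Lnorm_ge0 mu p%:E (EFin \o f); case: (Lnorm _ _ _) => [r _ _|_|//]; first exact: ltry.
  by rewrite poweRyr// gt_eqF.
split=> [/andP[/set_mem mf]|[mf /E fi]].
  by rewrite inE /= => fi; split => //; apply/E.
by apply/andP; split; apply/mem_set.
Qed.

Lemma Lfun_inftyP f : f \in Lfun mu +oo%E <->
  measurable_fun setT f /\ exists M : R, {ae mu, forall x, `|f x| <= M}.
Proof.
have E : (Lnorm mu +oo%E (EFin \o f) < +oo)%E <-> exists M : R, {ae mu, forall x, `|f x| <= M}.
  (* The norm at infinity is 0 by convention when the measure vanishes; in that case the whole space
     is an admissible exceptional set. *)
  rewrite unlock; case: ifPn => [mu0|mu0]; (split=> [|[M fM]]) => //=.
  - case Ee : (ess_sup_inf.ess_sup _ _) => [r| |] // _.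
      exists r; have := ess_sup_inf.ess_sup_ge mu (abse \o (EFin \o f)).
      by apply: filterS => x; rewrite Ee lee_fin.
    by exists 0; have /ess_sup_inf.ess_sup_eqNyP := Ee; apply: filterS.
  - apply: (@le_lt_trans _ _ M%:E); last exact: ltry.
    by apply/ess_sup_inf.ess_supP; move: fM; apply: filterS => x; rewrite lee_fin.
  - exists 0, setT; split => //; apply/eqP; rewrite eq_le measure_ge0 andbT leNgt//.
split=> [/andP[/set_mem mf]|[mf /E fi]].
  by rewrite inE /= => fi; split => //; apply/E.
by apply/andP; split; apply/mem_set.
Qed.

End Lfun_characterization.

Section enorm.
Context {R : realType} {n : nat}.
Implicit Type v : 'rV[R]_n.

Lemma dotvv_ge0 v : 0 <= dotv v v.
Proof. by apply: sumr_ge0 => i _; rewrite -expr2 sqr_ge0. Qed.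

Lemma enorm_ge0 v : 0 <= enorm v. Proof. exact: sqrtr_ge0. Qed.

Lemma enormZ a v : enorm (a *: v) = `|a| * enorm v.
Proof.
rewrite /enorm (_ : dotv _ _ = a ^+ 2 * dotv v v); last first.
  by rewrite /dotv mulr_sumr; apply: eq_bigr => i _; rewrite !mxE; ring.
by rewrite sqrtrM ?sqr_ge0// sqrtr_sqr.
Qed.

Lemma coord_le_enorm v i : `|v ord0 i| <= enorm v.
Proof.
rewrite -sqrtr_sqr; apply: ler_wsqrtr; rewrite /dotv (bigD1 i)//= -expr2 lerDl.
by apply: sumr_ge0 => j _; rewrite -expr2 sqr_ge0.
Qed.

Lemma dotvZr a v w : dotv v (a *: w) = a * dotv v w.
Proof. by rewrite /dotv mulr_sumr; apply: eq_bigr => i _; rewrite mxE mulrCA. Qed.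

Lemma enorm_sq v : enorm v ^+ 2 = dotv v v.
Proof. by rewrite sqr_sqrtr// dotvv_ge0. Qed.

Lemma measurable_enorm d (X : measurableType d) (F : X -> 'rV[R]_n) :
  (forall i, measurable_fun setT (fun x => F x ord0 i)) ->
  measurable_fun setT (fun x => enorm (F x)).
Proof.
move=> mF; apply: (@measurableT_comp _ _ _ _ _ _ (@Num.sqrt R)); first exact: (continuous_measurable_fun (@sqrt_continuous R)).
rewrite /dotv; apply: measurable_sum => i; exact: measurable_funM.
Qed.

End enorm.

Section tent.
Context {R : realType}.
Variables (k h : R).
Hypothesis h0 : 0 < h.
Let pos (u : R) := Num.max u 0.

(* The primitive of [dtent], the tent function of height 1 on [k, k + h]. *)
Definition tent (u : R) :=
  (pos (u - k) ^+ 2 - 2 * pos (u - k - h / 2) ^+ 2 + pos (u - k - h) ^+ 2) / h.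
Definition dtent (u : R) :=
  2 * (pos (u - k) - 2 * pos (u - k - h / 2) + pos (u - k - h)) / h.

Let posP u : (u <= 0 /\ pos u = 0) \/ (0 <= u /\ pos u = u).
Proof.
rewrite /pos; have [u0|u0] := leP u 0; [left|right]; split => //.
exact: ltW.
Qed.

Lemma dtent_ge0 u : 0 <= dtent u.
Proof.
rewrite /dtent divr_ge0 ?(ltW h0)//.
case: (posP (u - k)) => -[] ? ->; case: (posP (u - k - h / 2)) => -[] ? ->;
  case: (posP (u - k - h)) => -[] ? ->; have := h0; lra.
Qed.

Lemma dtent_le1 u : dtent u <= 1.
Proof.
rewrite /dtent ler_pdivrMr// mul1r.
case: (posP (u - k)) => -[] ? ->; case: (posP (u - k - h / 2)) => -[] ? ->;
  case: (posP (u - k - h)) => -[] ? ->; have := h0; lra.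
Qed.

Lemma dtent_eq0 u : u <= k -> dtent u = 0.
Proof.
move=> uk; rewrite /dtent.
suff -> : pos (u - k) - 2 * pos (u - k - h / 2) + pos (u - k - h) = 0 by rewrite mulr0 mul0r.
case: (posP (u - k)) => -[] ? ->; case: (posP (u - k - h / 2)) => -[] ? ->;
  case: (posP (u - k - h)) => -[] ? ->; have := h0; lra.
Qed.

Lemma tent_eq0 u : u <= k -> tent u = 0.
Proof.
move=> uk; rewrite /tent.
have p0 x : x <= 0 -> pos x = 0 by case: (posP x) => -[] // ? ->; lra.
have hh := h0; have [x1 x2 x3] : [/\ u - k <= 0, u - k - h / 2 <= 0 & u - k - h <= 0] by split; lra.
by rewrite !p0// expr0n/= mulr0 subrr addr0 mul0r.
Qed.

Lemma tent_max u : k + h <= u -> tent u = h / 2.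
Proof.
move=> uk; rewrite /tent.
have p0 x : 0 <= x -> pos x = x by case: (posP x) => -[] // ? ->; lra.
have hn : h != 0 by rewrite gt_eqF.
have hh := h0; have [x1 x2 x3] : [/\ 0 <= u - k, 0 <= u - k - h / 2 & 0 <= u - k - h] by split; lra.
by rewrite !p0//; field.
Qed.

Lemma tent_le a b : a <= b -> tent a <= tent b.
Proof.
move=> ab; rewrite /tent ler_pM2r ?invr_gt0//.
have := h0.
case: (posP (a - k)) => -[] ? ->; case: (posP (a - k - h / 2)) => -[] ? ->;
  case: (posP (a - k - h)) => -[] ? ->; try (move=> ?; exfalso; lra);
case: (posP (b - k)) => -[] ? ->; case: (posP (b - k - h / 2)) => -[] ? ->;
  case: (posP (b - k - h)) => -[] ? ->; try (move=> ?; exfalso; lra); move=> ?; nra.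
Qed.

Lemma tent_ge0 u : 0 <= tent u.
Proof.
have [uk|uk] := leP u k; first by rewrite tent_eq0.
by rewrite -(tent_eq0 (lexx k)) tent_le// ltW.
Qed.

Lemma tent_leh u : tent u <= h / 2.
Proof.
have [uk|uk] := leP (k + h) u; first by rewrite tent_max.
by rewrite -(tent_max (lexx (k + h))) tent_le// ltW.
Qed.

(** The square of a positive part has Taylor remainder at most (b - a)^2 and derivative with
    Lipschitz constant 2. The weights 1, 2, 1 add up to 4, which gives 4/h for the remainder and 8/h
    for the derivative. *)
Lemma tent_C11 : C11 tent dtent (8 / h).
Proof.
have q0 a b : `|pos b ^+ 2 - pos a ^+ 2 - 2 * pos a * (b - a)| <= (b - a) ^+ 2.
  rewrite ler_norml; apply/andP.
  have := sqr_ge0 a; have := sqr_ge0 b; have := sqr_ge0 (b - a); rewrite !expr2.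
  case: (posP a) => -[ha ->]; case: (posP b) => -[hb ->].
  - by move=> *; split; lra.
  - have : 0 <= - a * b by rewrite mulr_ge0// oppr_ge0.
    by move=> *; split; nra.
  - have : 0 <= a * - b by rewrite mulr_ge0// oppr_ge0.
    by move=> *; split; nra.
  - by move=> *; split; nra.
have q1 a b : `|pos b - pos a| <= `|b - a|.
  rewrite -(ler_pXn2r (n := 2))// ?nnegrE// !real_normK ?num_real//.
  have := sqr_ge0 a; have := sqr_ge0 b; have := sqr_ge0 (b - a); rewrite !expr2.
  case: (posP a) => -[ha ->]; case: (posP b) => -[hb ->].
  - by move=> *; lra.
  - have : 0 <= - a * b by rewrite mulr_ge0// oppr_ge0.
    by move=> *; nra.
  - have : 0 <= a * - b by rewrite mulr_ge0// oppr_ge0.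
    by move=> *; nra.
  - by move=> *; nra.
have nA (x y z : R) : `|x - 2 * y + z| <= `|x| + 2 * `|y| + `|z|.
  apply: le_trans (ler_normD _ _) _; rewrite lerD2r; apply: le_trans (ler_normB _ _) _.
  by rewrite normrM (ger0_norm (_ : 0 <= 2 :> R)).
split=> a b.
  have -> : tent b - tent a - dtent a * (b - a) =
    ((pos (b - k) ^+ 2 - pos (a - k) ^+ 2 - 2 * pos (a - k) * ((b - k) - (a - k)))
     - 2 * (pos (b - k - h / 2) ^+ 2 - pos (a - k - h / 2) ^+ 2
       - 2 * pos (a - k - h / 2) * ((b - k - h / 2) - (a - k - h / 2)))
     + (pos (b - k - h) ^+ 2 - pos (a - k - h) ^+ 2
       - 2 * pos (a - k - h) * ((b - k - h) - (a - k - h)))) / h.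
    by rewrite /tent /dtent; field; rewrite gt_eqF.
  rewrite normrM (gtr0_norm (_ : 0 < h^-1)) ?invr_gt0// [leRHS]mulrAC ler_pM2r ?invr_gt0//.
  apply: le_trans (nA _ _ _) _.
  have := q0 (a - k) (b - k); have := q0 (a - k - h / 2) (b - k - h / 2).
  have := q0 (a - k - h) (b - k - h).
  have -> : b - k - h - (a - k - h) = b - a by ring.
  have -> : b - k - h / 2 - (a - k - h / 2) = b - a by ring.
  have -> : b - k - (a - k) = b - a by ring.
  by have := sqr_ge0 (b - a); lra.
have -> : dtent b - dtent a = 2 * ((pos (b - k) - pos (a - k))
     - 2 * (pos (b - k - h / 2) - pos (a - k - h / 2)) + (pos (b - k - h) - pos (a - k - h))) / h.
  by rewrite /dtent; field; rewrite gt_eqF.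
rewrite normrM (gtr0_norm (_ : 0 < h^-1)) ?invr_gt0// [leRHS]mulrAC ler_pM2r ?invr_gt0//.
rewrite normrM (ger0_norm (_ : 0 <= 2 :> R))//.
have := nA (pos (b - k) - pos (a - k)) (pos (b - k - h / 2) - pos (a - k - h / 2)) (pos (b - k - h) - pos (a - k - h)).
have := q1 (a - k) (b - k); have := q1 (a - k - h / 2) (b - k - h / 2).
have := q1 (a - k - h) (b - k - h).
have -> : b - k - h - (a - k - h) = b - a by ring.
have -> : b - k - h / 2 - (a - k - h / 2) = b - a by ring.
have -> : b - k - (a - k) = b - a by ring.
lra.
Qed.

Lemma tent_le_norm u : 0 <= k -> `|tent u| <= `|u|.
Proof.
move=> k0; rewrite ger0_norm ?tent_ge0//.
have [uk|uk] := leP u k; first by rewrite tent_eq0.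
rewrite ger0_norm ?(le_trans k0 (ltW uk))// /tent ler_pdivrMr//.
have := h0.
case: (posP (u - k)) => -[] ? ->; case: (posP (u - k - h / 2)) => -[] ? ->;
  case: (posP (u - k - h)) => -[] ? ->; try (move=> ?; exfalso; lra); move=> ?; nra.
Qed.

End tent.

Section weak_hgrad.
Context {R : realType} {N : nat}.
Local Notation H := 'rV[R]_(N + N + 1).
Local Notation mu := (lebesgue_rV R (N + N + 1)).
Implicit Types (u phi : H -> R) (G : H -> 'rV[R]_(N + N)).

(** Membership in [HW0] provides gradients on the whole group, but the weak identity asks for
    gradients in Omega. *)
Lemma weak_hgrad_restrict u G (Omega : set H) : open Omega ->
  weak_hgrad setT u G -> weak_hgrad Omega u G.
Proof.
move=> oO [lu Gi].
have mO := open_measurable_rV oO.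
have lO v : L1loc setT v -> L1loc Omega v.
  by move=> [mv iv]; split=> [|K cK KO]; [exact: measurable_funTS|exact: iv].
split=> [|i]; first exact: lO.
have [lG uG] := Gi i; split=> [|phi [sphi [cphi phiO]]]; first exact: lO.
have phi0 x : ~ closure [set x | phi x != 0] x -> phi x = 0.
  by move=> xc; apply: contrapT => /eqP x0; apply: xc; exact: subset_closure.
have D0 := hD_support i (@closed_closure _ _) phi0.
have out (F : H -> R) : (forall x, ~ closure [set x | phi x != 0] x -> F x = 0) ->
    \int[mu]_(x in Omega) F x = \int[mu]_x F x.
  move=> F0; rewrite Rintegral_mkcond; apply: eq_Rintegral => x _.
  by rewrite patchE; case: ifPn => // /negP xO; rewrite F0// => /phiO /mem_set.
rewrite !out; first by apply: uG; split => //; split.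
- by move=> x /phi0 ->; rewrite mulr0.
- by move=> x /D0 e; rewrite -/(hD i phi x) e mulr0.
Qed.

Lemma le_integral_powR (p : R) (v w : H -> R) : 0 <= p -> measurable_fun setT v ->
  measurable_fun setT w -> (forall x, `|w x| <= `|v x|) ->
  (\int[mu]_x (`|w x| `^ p)%:E <= \int[mu]_x (`|v x| `^ p)%:E)%E.
Proof.
move=> p0 mv mw wv; apply: ge0_le_integral => //.
- by apply/measurable_EFinP/(@measurableT_comp _ _ _ _ _ _ (@powR R ^~ p)) => //; exact: measurableT_comp.
- by apply/measurable_EFinP/(@measurableT_comp _ _ _ _ _ _ (@powR R ^~ p)) => //; exact: measurableT_comp.
- by move=> x _; rewrite lee_fin ge0_ler_powR ?nnegrE//; exact: wv.
Qed.

Lemma coord_powR_le (p : R) G i : 0 <= p -> (forall i, measurable_fun setT (fun x => G x ord0 i)) ->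
  (\int[mu]_x (`|G x ord0 i| `^ p)%:E <= \int[mu]_x (enorm (G x) `^ p)%:E)%E.
Proof.
move=> p0 mG.
rewrite (_ : (\int[mu]_x (enorm (G x) `^ p)%:E = \int[mu]_x (`|enorm (G x)| `^ p)%:E)%E); last first.
  by apply: eq_integral => x _; rewrite ger0_norm ?enorm_ge0.
apply: le_integral_powR => //; first exact: measurable_enorm.
by move=> x; rewrite [leRHS]ger0_norm ?enorm_ge0// coord_le_enorm.
Qed.

Lemma coord_powR_lty (p : R) G i : 0 <= p -> (forall i, measurable_fun setT (fun x => G x ord0 i)) ->
  (\int[mu]_x (enorm (G x) `^ p)%:E < +oo)%E -> (\int[mu]_x (`|G x ord0 i| `^ p)%:E < +oo)%E.
Proof. by move=> p0 mG; apply: le_lt_trans; exact: coord_powR_le. Qed.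

(** Goes from the weak gradient to the flow identity, applies the chain rule on almost every flow
    line, and returns. The bounds on psi and dpsi keep the new functions in the same local and L^p
    classes. *)
Lemma chain_weak_hgrad (p : R) (psi dpsi : R -> R) (C : R) u G : 1 < p ->
  C11 psi dpsi C -> 0 <= C -> (forall a, `|dpsi a| <= 1) -> (forall a, `|psi a| <= `|a|) ->
  weak_hgrad setT u G -> (\int[mu]_x (enorm (G x) `^ p)%:E < +oo)%E ->
  weak_hgrad setT (psi \o u) (fun x => dpsi (u x) *: G x).
Proof.
move=> p1 psiC C0 dpsi1 psi1 uG Gp.
have p0 : 0 <= p := le_trans ler01 (ltW p1).
have [lu Gi] := uG.
have mG i : measurable_fun setT (fun x => G x ord0 i) by have [[]] := Gi i.
have mu_ : measurable_fun setT u by case: lu.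
have mpsi : measurable_fun setT psi.
  exact: (continuous_measurable_fun (C11_continuous0 psiC)).
have mdpsi : measurable_fun setT dpsi.
  exact: (continuous_measurable_fun (C11_continuous psiC)).
have Gip i := coord_powR_lty i p0 mG Gp.
have le_loc (v w : H -> R) : L1loc setT v -> measurable_fun setT w -> (forall x, `|w x| <= `|v x|) -> L1loc setT w.
  move=> [mv iv] mw wv; split=> // K cK _.
  have mK := compact_measurable_rV cK.
  apply: (integrable_rle mK (g := fun x => `|v x|)).
  - exact: measurable_funTS.
  - by move=> x _; exact: wv.
  - exact: integrable_norm (iv _ cK _).
have lpsi : L1loc setT (psi \o u).
  by apply: le_loc lu _ _ => [|x]; [exact: measurableT_comp|exact: psi1].
have lG i : L1loc setT (fun x => (dpsi (u x) *: G x) ord0 i).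
  have [lGi _] := Gi i; apply: le_loc lGi _ _ => [|x].
    under eq_fun do rewrite mxE.
    by apply: measurable_funM => //; exact: measurableT_comp.
  by rewrite mxE normrM ler_piMl.
split=> // i; split=> // phi Tphi.
have E : (fun x => (dpsi (u x) *: G x) ord0 i) = (fun x => dpsi (u x) * G x ord0 i).
  by apply/funext => x; rewrite mxE.
have lGi := lG i; rewrite E in lGi *.
have mdG : measurable_fun setT (fun x => dpsi (u x) * G x ord0 i) by case: lGi.
rewrite (_ : \int[mu]_x ((dpsi (u x) *: G x) ord0 i * phi x) =
    \int[mu]_x (dpsi (u x) * G x ord0 i * phi x)); last by under eq_Rintegral do rewrite mxE.
apply: (flow_weak_derivative lpsi lGi) => // t t0.
  apply: (flow_integrable (measurable_hflow i) (hflow_preserving i) mdG p1 _ (ltW t0)).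
  apply: le_lt_trans (Gip i); apply: le_integral_powR => // x.
  by rewrite normrM ler_piMl.
apply: (flow_chain_rule (measurable_hflow i) (hflow_preserving i) (mG i) p1 (Gip i) mu_ _ psiC C0 dpsi1 t0).
by move=> r r0; exact: (weak_derivative_flow p1 r0 uG).
Qed.

Lemma tent_HW0 (p k h : R) (Omega : set H) u G : 1 < p -> 0 <= k -> 0 < h ->
  LpOn setT p%:E u -> weak_hgrad setT u G -> LpOn setT p%:E (fun x => enorm (G x)) ->
  {ae mu, forall x, ~ Omega x -> u x = 0} ->
  weak_hgrad setT (tent k h \o u) (fun x => dtent k h (u x) *: G x) /\
  HW0 Omega p (tent k h \o u).
Proof.
move=> p1 k0 h0 up uG Gp u0.
have p0 : 0 < p := lt_trans ltr01 p1.
have pow_lp (v w : H -> R) : measurable_fun setT w -> (forall x, `|w x| <= `|v x|) ->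
    LpOn setT p%:E v -> LpOn setT p%:E w.
  move=> mw wv; rewrite /LpOn !patch_setT => /(Lfun_powRP _ _ p0)[mv vi].
  apply/(Lfun_powRP _ _ p0); split; first exact: mw.
  exact: (le_lt_trans (le_integral_powR (ltW p0) mv mw wv) vi).
have Gfin : (\int[mu]_x (enorm (G x) `^ p)%:E < +oo)%E.
  move: Gp; rewrite /LpOn patch_setT => /(Lfun_powRP _ _ p0)[_].
  by under eq_integral do rewrite ger0_norm ?enorm_ge0//.
have dt1 a : `|dtent k h a| <= 1 by rewrite ger0_norm ?dtent_ge0// dtent_le1.
have tG : weak_hgrad setT (tent k h \o u) (fun x => dtent k h (u x) *: G x).
  apply: (chain_weak_hgrad p1 (tent_C11 _ h0)) => //; first by rewrite divr_ge0// ltW.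
  by move=> a; exact: tent_le_norm.
have [[mt _] dGi] := tG.
split=> //; split; last first.
  by apply: filterS u0 => x u0 /u0 /= ->; rewrite tent_eq0.
split; first by apply: (pow_lp u) => // x; exact: tent_le_norm.
exists (fun x => dtent k h (u x) *: G x) => //.
apply: (pow_lp (fun x => enorm (G x))) => //.
  by apply: measurable_enorm => i; have [[]] := dGi i.
by move=> x; rewrite enormZ normrM normr_id ler_piMl.
Qed.

End weak_hgrad.

Section energy.
Context {R : realType} {N : nat}.
Local Notation H := 'rV[R]_(N + N + 1).
Local Notation mu := (lebesgue_rV R (N + N + 1)).

Lemma enorm_pairing n (p c : R) (v : 'rV[R]_n) : 1 < p ->
  enorm v `^ (p - 2) * dotv v (c *: v) = c * enorm v `^ p.
Proof.
move=> p1; rewrite dotvZr -enorm_sq mulrCA; congr (_ * _).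
have p0 : p != 0 by rewrite gt_eqF// (lt_trans ltr01).
(* Where v vanishes both sides are 0, whatever value the power p - 2 takes at 0. *)
have [e0|e0] := eqVneq (enorm v) 0; first by rewrite e0 expr0n/= mulr0 powR0.
by rewrite -powR_mulrn ?enorm_ge0// -powRD ?e0 ?implybT//; congr (_ `^ _); ring.
Qed.

Lemma powR_le_id (c p : R) : 0 <= c -> c <= 1 -> 1 < p -> c `^ p <= c.
Proof.
move=> c0 c1 p1; rewrite -powR_pred_mul ?gt_eqF ?(lt_trans ltr01)// ler_piMl//.
have p10 : 0 <= p - 1 by rewrite subr_ge0 ltW.
by have := ge0_ler_powR p10; rewrite /= => /(_ _ _ _ _ c1); rewrite powR1 !nnegrE; apply.
Qed.

Lemma approx_energy (Omega : set H) (s p alpha : R) (delta f v : H -> R) (n : nat) (k h : R) :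
  open Omega -> 1 < p -> 0 < alpha -> (forall x, Omega x -> 0 < delta x) ->
  mu.-integrable setT (EFin \o (f \_ Omega)) -> (0 < n)%N ->
  approx_solution Omega p s alpha delta f n v -> 1 <= k -> 0 < h ->
  exists2 G, weak_hgrad setT (tent k h \o v) G &
    (\int[mu]_x (enorm (G x) `^ p)%:E <=
     (h / 2 * \int[mu]_x (`|(f \_ Omega) x| * \1_[set x | k < v x] x))%:E)%E.
Proof.
move=> oO p1 al0 de0 fi n0 [[[vp [G vG Gp]] v0] _ _ vE] k1 h0.
have mO := open_measurable_rV oO.
have p0 : 0 < p := lt_trans ltr01 p1.
have mv : measurable_fun setT v by case: vG => -[].
have [tG tHW] := tent_HW0 p1 (le_trans ler01 k1) h0 vp vG Gp v0.
have [_ tGi] := tG.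
exists (fun x => dtent k h (v x) *: G x) => //.
have mt : measurable_fun setT (tent k h).
  exact: (continuous_measurable_fun (C11_continuous0 (tent_C11 k h0))).
have [iloc inl irhs E] := vE _ tHW _ _ (weak_hgrad_restrict oO vG) (weak_hgrad_restrict oO tG).
set loc := (X in mu.-integrable _ (EFin \o X)) in iloc E.
have locE x : loc x = dtent k h (v x) * enorm (G x) `^ p by rewrite /loc enorm_pairing.
set A := [set x | k < v x].
have mA : measurable A.
  rewrite (_ : A = v @^-1` `]k, +oo[%classic); last first.
    by apply/seteqP; split => x; rewrite /A/= in_itv/= andbT.
  by rewrite -[X in measurable X]setTI; apply: mv.
have mGw : measurable_fun setT (fun x => enorm (dtent k h (v x) *: G x) `^ p).
  apply: (@measurableT_comp _ _ _ _ _ _ (@powR R ^~ p)) => //.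
  by apply: measurable_enorm => i; have [[]] := tGi i.
(* The identity controls the integral of Psi'(v) |grad v|^p over Omega. Since 0 <= Psi' <= 1, this
   dominates the integral of (Psi')^p |grad v|^p; outside Omega v = 0 almost everywhere and Psi'(0)
   = 0. *)
apply: (@le_trans _ _ (\int[mu]_(x in Omega) (loc x)%:E)%E).
  rewrite (_ : (\int[mu]_x _ = \int[mu]_(x in Omega) (enorm (dtent k h (v x) *: G x) `^ p)%:E)%E); last first.
    rewrite [RHS]integral_mkcond; apply: ge0_ae_eq_integral => //.
    - by apply/measurable_EFinP.
    - by apply/(measurable_restrictT _ mO)/measurable_funTS/measurable_EFinP.
    - by move=> x _; rewrite lee_fin powR_ge0.
    - by move=> x _; rewrite patchE; case: ifPn => // _; rewrite lee_fin powR_ge0.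
    - apply: filterS v0 => x v0 _; rewrite patchE; case: ifPn => // /negP xO.
      rewrite v0; last by move=> /mem_set.
      by rewrite dtent_eq0 ?(le_trans ler01)// enormZ normr0 mul0r powR0// gt_eqF.
  apply: ge0_le_integral => //.
  - by move=> x _; rewrite lee_fin powR_ge0.
  - exact/measurable_EFinP/measurable_funTS.
  - exact: (measurable_int mu iloc).
  - move=> x _; rewrite lee_fin locE enormZ powRM ?enorm_ge0// ger0_norm ?dtent_ge0//.
    by rewrite ler_wpM2r ?powR_ge0// powR_le_id ?dtent_ge0 ?dtent_le1.
rewrite -(fineK (integrable_fin_num mO iloc)) lee_fin -/(Rintegral _ _ _).
(* [Jp p] preserves signs and [tent] is nondecreasing, so both increments in the integrand have the
   same sign. *)
have nl0 : 0 <= \int[(mu \x mu)%E]_z (Jp p (v z.1 - v z.2) *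
   ((tent k h \o v) z.1 - (tent k h \o v) z.2) /
    hnorm (hmul (hinv z.2) z.1) `^ (hdim R N + s * p)).
  apply: Rintegral_ge0 => z _; rewrite divr_ge0 ?powR_ge0//= /Jp -mulrA mulr_ge0 ?powR_ge0//.
  have [z12|z12] := leP (v z.1) (v z.2).
    by rewrite mulr_le0// subr_le0 // tent_le.
  by rewrite mulr_ge0// subr_ge0 ?tent_le// ltW.
have le1 : \int[mu]_(x in Omega) loc x <= \int[mu]_(x in Omega)
   (Num.min (f x) n%:R * (Num.max (v x) 0 + n%:R^-1) `^ (- delta x) * (tent k h \o v) x).
  by rewrite -E lerDl mulr_ge0// ltW.
apply: le_trans le1 _.
have ig : mu.-integrable setT (EFin \o (fun x => `|(f \_ Omega) x| * \1_A x)).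
  apply: (integrable_rle measurableT (g := fun x => `|(f \_ Omega) x|)).
  - apply: measurable_funM; last exact: measurable_indic.
    by apply: measurableT_comp => //; apply/measurable_EFinP; exact: (measurable_int mu fi).
  - move=> x _; rewrite normrM normr_id ler_piMr// indicE.
    by case: (_ \in _); rewrite ?normr1 ?normr0.
  - exact: integrable_norm fi.
rewrite -RintegralZl// [leLHS]Rintegral_mkcond.
apply: le_Rintegral => //.
- have := irhs; rewrite (integrable_mkcond _ mO); apply: eq_integrable => // x _.
  by rewrite /= !patchE; case: ifP.
- by have := integrable_rZ measurableT (h / 2) ig.
move=> x _; rewrite patchE; case: ifPn => xO; last first.
  by rewrite mulr_ge0 ?divr_ge0 ?(ltW h0)// mulr_ge0// indicE; case: (_ \in _).
rewrite patchE xO /= indicE.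
have [xk|xk] := leP (v x) k.
  by rewrite tent_eq0// mulr0 mulr_ge0 ?divr_ge0 ?(ltW h0)// mulr_ge0//; case: (_ \in _).
rewrite mem_set//= mulr1 [leRHS]mulrC.
have vx0 : 0 <= v x by rewrite (le_trans _ (ltW xk))// (le_trans ler01).
have b1 : 1 <= Num.max (v x) 0 + n%:R^-1.
  by rewrite max_l// (le_trans k1)// (le_trans (ltW xk))// lerDl invr_ge0.
have b2 : (Num.max (v x) 0 + n%:R^-1) `^ (- delta x) <= 1.
  rewrite -[leRHS](powRr0 (Num.max (v x) 0 + n%:R^-1)); apply: ler_powR => //.
  by rewrite oppr_le0 ltW// de0// -inE.
apply: (@le_trans _ _ (`|f x| * ((Num.max (v x) 0 + n%:R^-1) `^ (- delta x) * tent k h (v x)))).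
  rewrite -mulrA ler_wpM2r//; first by rewrite mulr_ge0 ?powR_ge0 ?tent_ge0.
  by rewrite (le_trans _ (ler_norm _))// ge_min lexx.
by rewrite ler_wpM2l// -[leRHS]mul1r ler_pM ?powR_ge0 ?tent_ge0 ?tent_leh.
Qed.

End energy.

(** * Right increments and decay of the level sets *)

Section powRD.
Context {R : realType}.

Lemma powRD_le (a b p : R) : 0 <= a -> 0 <= b -> 0 <= p ->
  (a + b) `^ p <= 2 `^ p * (a `^ p + b `^ p).
Proof.
move=> a0 b0 p0.
wlog ab : a b a0 b0 / a <= b.
  move=> W; have [/W->//|/ltW/W] := leP a b.
  by rewrite [b + a]addrC [b `^ p + _]addrC; exact.
apply: (@le_trans _ _ ((2 * b) `^ p)).
  by rewrite ge0_ler_powR ?nnegrE ?addr_ge0 ?mulr_ge0//; lra.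
by rewrite powRM// ler_wpM2l ?powR_ge0// lerDr powR_ge0.
Qed.

Lemma le_integral_powRD d (X : measurableType d) (nu : {measure set X -> \bar R})
    (a b c : X -> R) (p : R) : 0 <= p -> measurable_fun setT a -> measurable_fun setT b ->
  measurable_fun setT c -> (forall x, `|c x| <= `|a x| + `|b x|) ->
  (\int[nu]_x (`|c x| `^ p)%:E <=
   (2 `^ p)%:E * (\int[nu]_x (`|a x| `^ p)%:E + \int[nu]_x (`|b x| `^ p)%:E))%E.
Proof.
move=> p0 ma mb mc cab.
have mp (e : X -> R) : measurable_fun setT e -> measurable_fun setT (fun x => (`|e x| `^ p)%:E).
  move=> me; apply/measurable_EFinP/(@measurableT_comp _ _ _ _ _ _ (@powR R ^~ p)) => //.
  exact: measurableT_comp.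
have [mpa mpb mpc] := And3 (mp _ ma) (mp _ mb) (mp _ mc).
have mab := emeasurable_funD mpa mpb.
rewrite -ge0_integralD// -ge0_integralZl//; last first.
  by move=> x _; rewrite adde_ge0 ?lee_fin ?powR_ge0.
apply: ge0_le_integral => //.
- exact: measurable_funeM.
- move=> x _; rewrite lee_fin; apply: le_trans (powRD_le _ _ p0) => //.
  by rewrite ge0_ler_powR ?nnegrE ?addr_ge0.
Qed.

End powRD.

Section right_increment.
Context {R : realType} {N : nat}.
Local Notation H := 'rV[R]_(N + N + 1).
Local Notation mu := (lebesgue_rV R (N + N + 1)).

Lemma hmulxV (x : H) : hmul x (hinv x) = 0.
Proof. by rewrite -{1}[x]opprK; exact: hmulVx. Qed.

Lemma hinv_exp i (s : R) : hinv (hexp i s : H) = hexp i (- s).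
Proof. by rewrite /hinv /hexp opp_row_mx oppr0 scaleNr. Qed.

Definition hcentral (t : R) : H := row_mx 0 (const_mx t).

Lemma hX_central t i : hX (hcentral t) i = 0.
Proof. by rewrite /hcentral hX_row mxE. Qed.

Lemma hT_central t : hT (hcentral t) = t.
Proof. by rewrite /hcentral hT_row. Qed.

Lemma hmul_central x t :
  (forall i, hX (hmul x (hcentral t)) i = hX x i) /\ hT (hmul x (hcentral t)) = hT x + t.
Proof.
split=> [i|]; first by rewrite hX_mul hX_central addr0.
rewrite hT_mul hT_central [symp _ _]big1 ?mulr0 ?addr0// => k _.
by rewrite !hX_central; ring.
Qed.

(** The relation [X_j, X_(N+j)] = d_tau at the level of the group: a central element of size a b
    costs horizontal moves of size |a| and |b|. *)
Lemma commutator_exp (j : 'I_N) (a b : R) :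
  hmul (hmul (hmul (hexp (lshift N j) a) (hexp (rshift N j) b)) (hexp (lshift N j) (- a)))
    (hexp (rshift N j) (- b)) = hcentral (a * b).
Proof.
apply: hP => [i|].
  by rewrite !hX_mul !hX_exp hX_central; do 2 case: (i == _); rewrite ?mulr0n ?mulr1n; ring.
rewrite !hT_mul !hT_exp hT_central !symp_exp /hcoef (unsplitK (inl j)) (unsplitK (inr j)).
rewrite !hX_mul !hX_exp !eqxx eq_lrshift eq_rlshift !mulr0n !mulr1n; by field.
Qed.

Lemma hcoef_bound i (x : H) (r : R) : (forall j, `|hX x j| <= r) -> `|hcoef i x| <= r / 2.
Proof.
by move=> xr; rewrite /hcoef; case: fintype.split => j; rewrite ?normrN normrM ler_pM// gtr0_norm.
Qed.

Definition osc (p : R) (w : H -> R) (y : H) : \bar R :=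
  (\int[mu]_x (`|w (hmul x y) - w x| `^ p)%:E)%E.

Variables (p : R) (w : H -> R).
Hypotheses (p1 : 1 < p) (mw : measurable_fun setT w).
Let p0 : 0 < p. Proof. exact: lt_trans ltr01 p1. Qed.

Lemma measurable_increment0 y : measurable_fun setT (fun x : H => w (hmul x y) - w x).
Proof.
by apply: measurable_funB => //; exact: measurableT_comp mw (hmul_right_preserving y).1.
Qed.

Lemma measurable_increment y :
  measurable_fun setT (fun x : H => (`|w (hmul x y) - w x| `^ p)%:E).
Proof.
apply/measurable_EFinP/(@measurableT_comp _ _ _ _ _ _ (@powR R ^~ p)) => //.
by apply: measurableT_comp => //; exact: measurable_increment0.
Qed.

(** The increment by y z is the increment by y at x plus the increment by z at x y; right invariance
    turns the second one into [osc p w z]. *)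
Lemma osc_mul y z : (osc p w (hmul y z) <= (2 `^ p)%:E * (osc p w y + osc p w z))%E.
Proof.
have E : osc p w z = (\int[mu]_x (`|w (hmul (hmul x y) z) - w (hmul x y)| `^ p)%:E)%E.
  exact: (esym (ge0_integral_preserved (hmul_right_preserving y) (measurable_increment z) _)).
rewrite E /osc; 
apply: (@le_integral_powRD _ _ _ mu (fun x => w (hmul x y) - w x)
  (fun x => w (hmul (hmul x y) z) - w (hmul x y)) (fun x => w (hmul x (hmul y z)) - w x) p (ltW p0)).
- exact: measurable_increment0.
- exact: measurableT_comp (measurable_increment0 z) (hmul_right_preserving y).1.
- exact: measurable_increment0.
- move=> x; rewrite hmulA; move: (w _) (w _) (w x) => b c a.
  rewrite (_ : c - a = (b - a) + (c - b)); last by ring.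
  exact: ler_normD.
Qed.

Lemma osc_inv y : osc p w (hinv y) = osc p w y.
Proof.
rewrite /osc.
have <- := ge0_integral_preserved (hmul_right_preserving y) (measurable_increment (hinv y)).
  by apply: eq_integral => x _; rewrite -hmulA hmulxV hmul0 distrC.
by move=> x; rewrite lee_fin powR_ge0.
Qed.

Lemma osc0 : osc p w 0 = 0%E.
Proof.
rewrite /osc integral0_eq// => x _.
by rewrite hmul0 subrr normr0 powR0// gt_eqF.
Qed.

Variables (E : R).
Hypotheses (E0 : 0 <= E)
  (oscE : forall i t, 0 < t -> (osc p w (hexp i t) <= (t `^ p * E)%:E)%E).

Lemma osc_exp i t : (osc p w (hexp i t) <= (`|t| `^ p * E)%:E)%E.
Proof.
have [t0|t0|->] := ltgtP t 0.
- rewrite -osc_inv hinv_exp ltr0_norm//; apply: oscE; by rewrite oppr_gt0.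
- by rewrite gtr0_norm//; exact: oscE.
- rewrite (_ : hexp i 0 = 0) ?osc0 ?lee_fin ?mulr_ge0 ?powR_ge0//.
  by rewrite /hexp scale0r row_mx0.
Qed.

Variable r : R.
Hypothesis r0 : 0 <= r.
Local Notation osc_le c y := (osc p w y <= (c * (r `^ p * E))%:E)%E.

Lemma osc_le_mul c d y z : osc_le c y -> osc_le d z -> osc_le (2 `^ p * (c + d)) (hmul y z).
Proof.
move=> cy dz; apply: le_trans (osc_mul y z) _.
rewrite -mulrA EFinM lee_wpmul2l ?lee_fin ?powR_ge0//.
by rewrite mulrDl EFinD leeD.
Qed.

Lemma osc_le_exp i a t : 0 <= a -> `|t| <= a * r -> osc_le (a `^ p) (hexp i t).
Proof.
move=> a0 ta; apply: le_trans (osc_exp i t) _.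
rewrite lee_fin mulrA ler_wpM2r// -powRM// ge0_ler_powR ?nnegrE ?mulr_ge0//; exact: ltW.
Qed.

(** Three uses of [osc_le_mul] join the four factors of a commutator, each of which costs a. *)
Definition central_const (a : R) := 2 `^ p * (2 `^ p * (2 `^ p * (a + a) + a) + a).

Lemma osc_le_central (t : R) : (0 < N)%N -> `|t| <= N.+1%:R * r ^+ 2 ->
  osc_le (central_const (N.+1%:R `^ p)) (hcentral t).
Proof.
move=> N0 tr.
(* Both factors have size sqrt |t|, of the order of r, and the sign of t goes into b. *)
pose a := Num.sqrt `|t|; pose b := Num.sg t * a.
have -> : t = a * b.
  by rewrite /b mulrCA -expr2 sqr_sqrtr// -numEsg.
(* The exact bound sqrt (N + 1) r is rounded up to (N + 1) r. *)
have ar : `|a| <= N.+1%:R * r.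
  rewrite ger0_norm ?sqrtr_ge0// -(ler_pXn2r (n := 2))// ?nnegrE ?sqrtr_ge0 ?mulr_ge0//.
  rewrite sqr_sqrtr// (le_trans tr)// exprMn ler_wpM2r ?sqr_ge0//.
  by rewrite -natrX ler_nat expnS expn1 leq_pmulr.
have br : `|b| <= N.+1%:R * r.
  rewrite normrM normr_sg; apply: le_trans ar.
  by case: (t != 0); rewrite ?mul1r// mul0r.
rewrite -(commutator_exp (Ordinal N0)).
by do 3 (apply: osc_le_mul; last by apply: osc_le_exp; rewrite ?normrN);
  apply: osc_le_exp.
Qed.

Fixpoint path_const m : R := if m is m'.+1 then 2 `^ p * (path_const m' + 1) else 0.

(** The horizontal coordinates of y are reached one at a time. Each move shifts the centre by a
    coordinate of y times a coefficient of X_i, hence by at most r^2 / 2. *)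
Lemma osc_le_coords y m : (m <= N + N)%N -> (forall i, `|hX y i| <= r) ->
  exists z, [/\ forall i, hX z i = hX y i *+ (i < m)%N, `|hT z| <= m%:R * (r ^+ 2 / 2) &
    osc_le (path_const m) z].
Proof.
move=> + yr; elim: m => [_|m IH mN].
  exists 0; split.
  - by move=> i; rewrite hX0 mulr0n.
  - by rewrite hT0 normr0 mul0r.
  - by rewrite osc0 mul0r.
have [z [zX zT zO]] := IH (ltnW mN).
pose i := Ordinal mN.
have zr j : `|hX z j| <= r.
  by rewrite zX; case: (_ < _)%N; rewrite ?mulr1n// mulr0n normr0.
exists (hmul z (hexp i (hX y i))); split.
- move=> j; rewrite hX_mul hX_exp zX ltnS [in RHS]leq_eqVlt.
  have [->|ji] := eqVneq j i; first by rewrite /= ltnn eqxx mulr0n add0r.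
  by rewrite mulr0n addr0 (_ : (j == m :> nat) = false)//; apply/negbTE.
- have -> : hT (hmul z (hexp i (hX y i))) = hT z + hX y i * hcoef i z.
    by rewrite hT_mul hT_exp symp_exp; field.
  apply: le_trans (ler_normD _ _) _; rewrite -natr1 mulrDl lerD// mul1r normrM.
  by rewrite expr2 -mulrA ler_pM// (hcoef_bound _ zr).
- rewrite /=; apply: osc_le_mul => //.
  by have := @osc_le_exp i 1 (hX y i) ler01; rewrite powR1 mul1r; apply.
Qed.

Lemma osc_le_box y : (0 < N)%N -> (forall i, `|hX y i| <= r) -> `|hT y| <= r ^+ 2 ->
  osc_le (2 `^ p * (path_const (N + N) + central_const (N.+1%:R `^ p))) y.
Proof.
move=> N0 yr yT.
have [z [zX zT zO]] := osc_le_coords (leqnn _) yr.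
have -> : y = hmul z (hcentral (hT y - hT z)).
  have [hx ht] := hmul_central z (hT y - hT z).
  by apply: hP => [i|]; [rewrite hx zX ltn_ord mulr1n|rewrite ht; ring].
apply: osc_le_mul => //; apply: osc_le_central => //.
apply: le_trans (ler_normB _ _) _; rewrite -natr1 mulrDl mul1r addrC lerD//.
apply: le_trans zT _; rewrite natrD; set n := N%:R; set x := r ^+ 2; lra.
Qed.

End right_increment.

Lemma integral_cst_indic d (X : measurableType d) (R : realType)
    (nu : {measure set X -> \bar R}) (A : set X) (c : R) : measurable A -> 0 <= c ->
  (\int[nu]_x (c%:E * (\1_A x)%:E) = c%:E * nu A)%E.
Proof.
move=> mA c0; have m1 : measurable_fun setT (fun x => (\1_A x)%:E : \bar R).
  by apply/measurable_EFinP; exact: measurable_indic.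
have i0 x : setT x -> (0 <= (\1_A x)%:E :> \bar R)%E by rewrite lee_fin.
by rewrite (ge0_integralZl nu measurableT m1 i0) ?lee_fin// integral_indic// setIT.
Qed.

(** * Decay of the level sets over one gap *)

Section level_gap.
Context {R : realType} {N : nat}.
Local Notation H := 'rV[R]_(N + N + 1).
Local Notation mu := (lebesgue_rV R (N + N + 1)).

(** Sides follow the dilations of the group, r horizontally and r^2 in the centre, so the volume is
    proportional to r^Q. *)
Definition hbox_bound (r : R) (j : 'I_(N + N + 1)) : R :=
  match fintype.split j with inl _ => r | inr _ => r ^+ 2 end.

Definition hbox (r : R) : set H := obox (fun j => - hbox_bound r j) (hbox_bound r).

Lemma hboxP r x : hbox r x -> (forall i, `|hX x i| <= r) /\ `|hT x| <= r ^+ 2.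
Proof.
move=> xr; split=> [i|].
  have := xr (lshift 1 i); rewrite /hbox_bound (unsplitK (inl i)) => /andP[? ?].
  by rewrite ler_norml !ltW.
have := xr (rshift (N + N) ord0); rewrite /hbox_bound (unsplitK (inr ord0)) => /andP[? ?].
by rewrite ler_norml !ltW.
Qed.

Lemma lebesgue_hbox r : 0 <= r -> mu (hbox r) = (2 ^+ (N + N + 1) * r ^+ (2 * N + 2))%:E.
Proof.
move=> r0; rewrite /hbox lebesgue_obox.
have E j : lebesgue_measure `] - hbox_bound r j, hbox_bound r j[%classic = (2 * hbox_bound r j)%:E.
  have b0 : 0 <= hbox_bound r j by rewrite /hbox_bound; case: fintype.split => _ //; rewrite sqr_ge0.
  rewrite lebesgue_measure_itv /= lte_fin; case: ifPn => [_|]; first by rewrite -EFinB; congr EFin; lra.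
  by rewrite -leNgt => h; congr EFin; lra.
under eq_bigr do rewrite E.
rewrite prodEFin; congr EFin; rewrite big_split_ord /= big_ord1 /hbox_bound (unsplitK (inr ord0)).
under eq_bigr => i _ do rewrite (unsplitK (inl i)).
rewrite prodr_const card_ord exprMn addn1 !exprS (_ : (2 * N + 2 = N + N + 2)%N); last by rewrite mul2n -addnn.
rewrite [r ^+ (N + N + 2)]exprD; ring.
Qed.

Let mu_cst_indic (A : set H) (c : R) : measurable A -> 0 <= c ->
  (\int[mu]_x (c%:E * (\1_A x)%:E) = c%:E * mu A)%E.
Proof. exact: integral_cst_indic. Qed.

(* Fubini for [|w (x y) - w x|^p] over [A] and a box of measure [2^(2N+1) mu B]: for each
   [x] in [A], left invariance leaves at most [mu B] of the [y]'s with [x y] in [B]. *)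
Lemma level_gap (p E : R) (w : H -> R) (A B : set H) (d : R) :
  (0 < N)%N -> 1 < p -> measurable_fun setT w -> 0 <= E ->
  (forall i t, 0 < t -> (osc p w (hexp i t) <= (t `^ p * E)%:E)%E) ->
  measurable A -> measurable B -> (mu B < +oo)%E -> A `<=` B -> 0 <= d ->
  (forall x, A x -> d <= `|w x|) -> (forall x, ~ B x -> w x = 0) ->
  d `^ p * fine (mu A) <=
    2 * (2 `^ p * (path_const p (N + N) + central_const p (N.+1%:R `^ p))) *
    fine (mu B) `^ (p / hdim R N) * E.
Proof.
move=> N0 p1 mw E0 oscE mA mB Bfin AB d0 dA wB.
set K := 2 `^ p * _; set b := fine (mu B); set a := fine (mu A).
have p0 : 0 < p := lt_trans ltr01 p1.
have bE : mu B = b%:E by rewrite fineK// ge0_fin_numE.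
have Afin : (mu A < +oo)%E by apply: le_lt_trans Bfin; rewrite le_measure ?inE.
have aE : mu A = a%:E by rewrite fineK// ge0_fin_numE.
have b0 : 0 <= b by rewrite fine_ge0.
have a0 : 0 <= a by rewrite fine_ge0.
have ab : a <= b by rewrite -lee_fin -aE -bE le_measure ?inE.
have pc0 m : 0 <= path_const p m.
  by elim: m => //= m IH; rewrite mulr_ge0 ?powR_ge0// addr_ge0.
have K0 : 0 <= K.
  by rewrite /K /central_const; rewrite !(mulr_ge0, addr_ge0) ?powR_ge0.
(* If B is null then so is A, and no positive radius would be available. *)
have [b_eq0|bn0] := eqVneq b 0.
  have -> : a = 0 by apply/eqP; rewrite eq_le a0 andbT -b_eq0.
  by rewrite mulr0 mulr_ge0// mulr_ge0 ?powR_ge0// mulr_ge0.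
have bp : 0 < b by rewrite lt_neqAle eq_sym bn0.
have Q0 : 0 < hdim R N by rewrite /hdim ltr0n addn2.
(* With r^Q = mu B the box has exactly M times the measure of B, and r^p becomes the power p/Q of mu
   B in the conclusion. *)
pose r := b `^ (hdim R N)^-1.
have r0 : 0 <= r by exact: powR_ge0.
have rQ : r ^+ (2 * N + 2) = b.
  by rewrite -powR_mulrn// /r -powRrM mulVf ?gt_eqF// powRr1.
have rp : r `^ p = b `^ (p / hdim R N) by rewrite /r -powRrM mulrC.
pose M : R := 2 ^+ (N + N + 1).
have M2 : 2 <= M by rewrite /M addn1 exprS ler_peMr// exprn_ege1// ler1n.
have D : mu (hbox r) = (M * b)%:E by rewrite lebesgue_hbox// rQ.
have mD : measurable (hbox r) by exact: measurable_obox.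
pose L := r `^ p * E.
have L0 : 0 <= L by rewrite mulr_ge0 ?powR_ge0.
pose F (z : H * H) : \bar R := (\1_(hbox r) z.1 * `|w (hmul z.2 z.1) - w z.2| `^ p)%:E.
have F0 z : (0 <= F z)%E by rewrite lee_fin mulr_ge0 ?powR_ge0// indicE; case: (_ \in _).
have mF : measurable_fun setT F.
  apply/measurable_EFinP; apply: measurable_funM.
    by apply: measurableT_comp measurable_fst; exact: measurable_indic.
  apply/(@measurableT_comp _ _ _ _ _ _ (@powR R ^~ p)) => //.
  apply: measurableT_comp => //; apply: measurable_funB.
    apply: (measurableT_comp mw).
    exact: (measurable_comp2 (@measurable_hmul R N) measurable_snd measurable_fst).
  exact: measurableT_comp mw measurable_snd.
have upper : (\int[mu]_y \int[mu]_x F (y, x) <= (K * L * (M * b))%:E)%E.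
  apply: (@le_trans _ _ (\int[mu]_y ((K * L)%:E * (\1_(hbox r) y)%:E))%E).
    apply: ge0_le_integral => //.
    - by move=> y _; exact: integral_ge0.
    - exact: (measurable_fun_fubini_tonelli_F F).
    - by apply: measurable_funeM; apply/measurable_EFinP; exact: measurable_indic.
    move=> y _; rewrite /F /= indicE; have [yr|yr] := boolP (y \in hbox r).
      under eq_integral do rewrite mul1r.
      rewrite mule1 -/(osc p w y).
      have [yX yT] := hboxP (set_mem yr).
      exact: (osc_le_box p1 mw E0 oscE r0 N0 yX yT).
    by rewrite mule0; under eq_integral do rewrite mul0r; rewrite integral0.
  have e := etrans (mu_cst_indic mD (mulr_ge0 K0 L0)) (congr1 (mule (K * L)%:E) D).
  by rewrite e -EFinM.
have lower : ((d `^ p * (M * b - b) * a)%:E <= \int[mu]_x \int[mu]_y F (y, x))%E.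
  have c0 : 0 <= d `^ p * (M * b - b).
    by rewrite mulr_ge0 ?powR_ge0// subr_ge0 ler_peMl// (le_trans _ M2)// ler1n.
  apply: (@le_trans _ _ (\int[mu]_x ((d `^ p * (M * b - b))%:E * (\1_A x)%:E))%E).
    have e := etrans (mu_cst_indic mA c0) (congr1 (mule _) aE).
    by rewrite e -EFinM.
  apply: ge0_le_integral => //.
  - by move=> x _; rewrite mule_ge0 ?lee_fin// indicE; case: (_ \in _).
  - by apply: measurable_funeM; apply/measurable_EFinP; exact: measurable_indic.
  - exact: (@measurable_fun_fubini_tonelli_G _ _ _ _ _ mu F).
  move=> x _; rewrite indicE; have [xA|xA] := boolP (x \in A); last first.
    by rewrite mule0; exact: integral_ge0.
  rewrite mule1.
  pose P := hmul x @^-1` B.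
  have mP : measurable P.
    by rewrite /P -[X in measurable X]setTI; apply: (hmul_left_preserving x).1.
  have PE : mu P = b%:E by rewrite -bE; exact: (hmul_left_preserving x).2.
  apply: (@le_trans _ _ (\int[mu]_y ((d `^ p)%:E * (\1_(hbox r `\` P) y)%:E))%E).
    have e := mu_cst_indic (measurableD mD mP) (powR_ge0 d p).
    rewrite e EFinM lee_wpmul2l ?lee_fin ?powR_ge0//.
    rewrite EFinB leeBlDr// -PE -D.
    apply: (@le_trans _ _ (mu ((hbox r `\` P) `|` P))).
      apply: le_measure; rewrite ?inE//; first by apply: measurableU => //; exact: measurableD.
      by move=> y yr; have [yP|yP] := pselect (P y); [right|left].
    by apply: measureU2 => //; exact: measurableD.
  apply: ge0_le_integral => //.
  - by move=> y _; rewrite mule_ge0 ?lee_fin ?powR_ge0// indicE; case: (_ \in _).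
  - by apply: measurable_funeM; apply/measurable_EFinP; apply: measurable_indic; exact: measurableD.
  - exact: (measurable_comp2 mF (@measurable_id _ _ _) (@measurable_cst _ _ _ _ _ _)).
  move=> y _; rewrite /F /= indicE; have [yr|yr] := boolP (y \in _); last first.
    by rewrite mulr0n mule0; exact: (F0 (y, x)).
  have [yr1 yr2] := set_mem yr.
  rewrite mulr1n mule1 indicE mem_set// mul1r lee_fin wB// sub0r normrN.
  by rewrite ge0_ler_powR ?nnegrE ?(ltW p0)// dA//; exact: set_mem.
have : d `^ p * (M * b - b) * a <= K * L * (M * b).
  rewrite -lee_fin; apply: le_trans lower _; apply: le_trans upper.
  by rewrite le_eqVlt; apply/orP; left; apply/eqP/esym; exact: (fubini_tonelli F mF F0).
have -> : d `^ p * (M * b - b) * a = (d `^ p * a) * (M - 1) * b by ring.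
rewrite mulrA ler_pM2r// => le1.
have -> : 2 * K * b `^ (p / hdim R N) * E = 2 * (K * L) by rewrite /L rp; ring.
have KL0 : 0 <= K * L by rewrite mulr_ge0.
have M1 : 0 < M - 1 by rewrite subr_gt0 (lt_le_trans _ M2)// ltr1n.
(* The factor M / (M - 1) is at most 2 because M >= 2; this is the leading 2 of the constant. *)
rewrite -(ler_pM2r M1) (le_trans le1)//.
rewrite [leRHS](_ : _ = (K * L) * (2 * (M - 1))); last by ring.
by rewrite ler_wpM2l//; lra.
Qed.

Definition level_const (p : R) :=
  2 * (2 `^ p * (path_const p (N + N) + central_const p (N.+1%:R `^ p))).

Definition level_measure (v : H -> R) (k : R) := fine (mu [set x | k < v x]).

Lemma measurable_superlevel (v : H -> R) (k : R) : measurable_fun setT v ->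
  measurable [set x | k < v x].
Proof.
move=> mv; rewrite (_ : [set x | _] = v @^-1` `]k, +oo[%classic); last first.
  by apply/seteqP; split => x; rewrite /= in_itv/= andbT.
by rewrite -[X in measurable X]setTI; apply: mv.
Qed.

Lemma superlevel_le (Omega : set H) (v : H -> R) (k : R) : measurable Omega ->
  measurable_fun setT v -> {ae mu, forall x, ~ Omega x -> v x = 0} -> 0 <= k ->
  (mu [set x | (k < v x)%R] <= mu Omega)%E.
Proof.
move=> mO mv [Z [mZ Z0 vZ]] k0.
apply: (@le_trans _ _ (mu (Omega `|` Z))).
  apply: le_measure; rewrite ?inE; [exact: measurable_superlevel|exact: measurableU|].
  move=> x /= kx; have [xO|xO] := pselect (Omega x); [by left|right].
  by apply: vZ => /(_ xO) vx; move: kx; rewrite vx ltNge k0.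
apply: le_trans (measureU2 mu mO mZ) _.
by rewrite [X in (_ + X)%E]Z0 adde0.
Qed.

(** [level_gap] is applied to the tent of v, which equals h / 2 on {v > k + h} and vanishes outside
    {v > k}. The factor h / 2 in the energy cancels one power of h / 2, leaving p - 1. *)
Lemma level_decay (Omega : set H) (s p alpha : R) (delta f v : H -> R) (n : nat) (k h : R) :
  (0 < N)%N -> open Omega -> (mu Omega < +oo)%E -> 1 < p -> 0 < alpha ->
  (forall x, Omega x -> 0 < delta x) ->
  mu.-integrable setT (EFin \o (f \_ Omega)) -> (0 < n)%N ->
  approx_solution Omega p s alpha delta f n v -> 1 <= k -> 0 < h ->
  (h / 2) `^ (p - 1) * level_measure v (k + h) <=
    level_const p * level_measure v k `^ (p / hdim R N) *
    \int[mu]_x (`|(f \_ Omega) x| * \1_[set x | k < v x] x).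
Proof.
move=> N0 oO Ofin p1 al0 de0 fi n0 sol k1 h0.
have p0 : 0 < p := lt_trans ltr01 p1.
have mO := open_measurable_rV oO.
have [[[vp [G0 vG _]] v0] _ _ _] := sol.
have mv : measurable_fun setT v by case: vG => -[].
have [G wG Gp] := approx_energy oO p1 al0 de0 fi n0 sol k1 h0.
set F := \int[mu]_x _ in Gp *.
have F0 : 0 <= F by apply: Rintegral_ge0 => x _; rewrite mulr_ge0.
have mw : measurable_fun setT (tent k h \o v) by case: wG => -[].
have mG i : measurable_fun setT (fun x => G x ord0 i) by have [_ /(_ i) [[]]] := wG.
have oscE i t : 0 < t -> (osc p (tent k h \o v) (hexp i t) <= (t `^ p * (h / 2 * F))%:E)%E.
  move=> t0.
  have Gfin : (\int[mu]_x (enorm (G x) `^ p)%:E < +oo)%E := le_lt_trans Gp (ltry _).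
  have Gi := coord_powR_lty i (ltW p0) mG Gfin.
  have mavg : measurable_fun setT (fun x => flow_avg (hflow i) (fun x => G x ord0 i) t x).
    exact: (measurable_comp2 (measurable_flow_avg (measurable_hflow i) (mG i))
      (@measurable_cst _ _ _ _ _ _) (@measurable_id _ _ _)).
  have -> : osc p (tent k h \o v) (hexp i t) =
      (\int[mu]_x (`|flow_avg (hflow i) (fun x => G x ord0 i) t x| `^ p)%:E)%E.
    apply: ge0_ae_eq_integral => //.
    - exact: measurable_increment.
    - apply/measurable_EFinP/(@measurableT_comp _ _ _ _ _ _ (@powR R ^~ p)) => //.
      exact: measurableT_comp.
    - have := weak_derivative_flow p1 t0 wG Gi; apply: filterS => x <- _.
      by rewrite hmul_exp.
  apply: le_trans (flow_avg_Lp (measurable_hflow i) (hflow_preserving i) (mG i) p1 t0) _.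
  rewrite EFinM; apply: lee_wpmul2l; first by rewrite lee_fin powR_ge0.
  apply: le_trans Gp; apply: coord_powR_le => //; exact: ltW.
have Bfin : (mu [set x | (k < v x)%R] < +oo)%E.
  by apply: le_lt_trans Ofin; apply: superlevel_le => //; exact: le_trans ler01 k1.
have h2 : 0 < h / 2 by rewrite divr_gt0.
have := level_gap N0 p1 mw (mulr_ge0 (ltW h2) F0) oscE
  (measurable_superlevel (k + h) mv) (measurable_superlevel k mv) Bfin _ (ltW h2).
move=> /(_ _ _ _)/wrap[|||le1].
- by move=> x /=; apply: lt_trans; rewrite ltrDl.
- by move=> x /= xk; rewrite tent_max// ?ler_norm//; exact: ltW.
- by move=> x /= /negP; rewrite -leNgt => xk; exact: tent_eq0.
rewrite -/(level_const p) -/(level_measure v k) -/(level_measure v (k + h)) in le1.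
rewrite -(@powR_pred_mul _ (h / 2) p (ltW h2)) ?gt_eqF// in le1.
rewrite -(ler_pM2r h2) (le_trans _ (le_trans le1 _))//; rewrite le_eqVlt; apply/orP; left; apply/eqP; ring.
Qed.

End level_gap.

(** * Iteration *)

Section iteration.
Context {R : realType}.

Lemma powR_natE (a : R) (n : nat) (t : R) : 0 <= a -> (a ^+ n) `^ t = (a `^ t) ^+ n.
Proof.
move=> a0; elim: n => [|n IH]; first by rewrite !expr0 powR1.
by rewrite !exprS powRM ?exprn_ge0// IH.
Qed.

Lemma powRV (a q : R) : 0 <= a -> a^-1 `^ q = (a `^ q)^-1.
Proof. by move=> a0; rewrite -(powR_inv1 a0) -powRrM mulN1r powRN. Qed.

(* Stampacchia's lemma: [a (1 + d (1 - 2^-i))] decays geometrically in [i]. *)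
Lemma stampacchia (q M beta A : R) : 0 < q -> 0 <= M -> 1 < beta -> 0 <= A ->
  exists2 d : R, 0 < d & forall a : R -> R, (forall k l, 1 <= k -> k <= l -> a l <= a k) ->
    (forall k, 0 <= a k) -> a 1 <= A ->
    (forall k h, 1 <= k -> 0 < h -> (h / 2) `^ q * a (k + h) <= M * a k `^ beta) ->
    a (1 + d) = 0.
Proof.
move=> q0 M0 b1 A0.
have b0 : 0 < beta by exact: lt_trans ltr01 b1.
(* The geometric ratio satisfies th^(beta - 1) = 2^(-q), which compensates exactly for the halving
   of the steps h. *)
pose th : R := 2 `^ (- (q / (beta - 1))).
have th0 : 0 < th by rewrite powR_gt0.
have th1 : th < 1.
  rewrite /th powRN invf_lt1 ?powR_gt0//.
  have c0 : 0 < q / (beta - 1) by rewrite divr_gt0// subr_gt0.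
  by have := gt0_ltr_powR c0; rewrite /= => /(_ 1 2); rewrite powR1 !nnegrE; apply; rewrite ?ltr1n.
have thq : th `^ (beta - 1) = 2^-1 `^ q.
  rewrite /th -powRrM mulNr divfK ?gt_eqF ?subr_gt0// powRN powRV//.
(* X is to be d^q. The first term is what the induction step demands, the 4 coming from h / 2 = (d /
   4) 2^(-i); the added 1 makes d positive even if M or A is 0. *)
pose X := M * A `^ (beta - 1) * 4 `^ q / th + 1.
have X0 : 0 < X by rewrite ltr_wpDl// divr_ge0 ?(ltW th0)// mulr_ge0 ?powR_ge0// mulr_ge0 ?powR_ge0.
pose d := X `^ q^-1.
have d0 : 0 < d by rewrite powR_gt0.
have dq : d `^ q = X by rewrite /d -powRrM mulVf ?gt_eqF// powRr1// ltW.
(* d is fixed before a is introduced, so the resulting bound is common to all approximate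
   solutions. *)
clearbody d; exists d => // a a_mono a0 a1 decay.
pose k (i : nat) := 1 + d * (1 - 2^-1 ^+ i).
have half1 i : (2^-1 : R) ^+ i <= 1 by rewrite exprn_ile1// invf_le1 ?ler1n.
have key i : a (k i) <= A * th ^+ i.
  elim: i => [|i IH]; first by rewrite /k expr0 subrr mulr0 addr0 mulr1.
  pose h := d * 2^-1 ^+ i.+1.
  have h0 : 0 < h by rewrite mulr_gt0// exprn_gt0// invr_gt0.
  have ki : 1 <= k i by rewrite lerDl mulr_ge0 ?(ltW d0)// subr_ge0.
  have := decay _ _ ki h0.
  have -> : k i + h = k i.+1 by rewrite /k /h !exprS; field.
  have -> : h / 2 = d / 4 * 2^-1 ^+ i by rewrite /h exprS; field.
  have i0 : 0 <= (2^-1 : R) ^+ i by rewrite exprn_ge0// invr_ge0.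
  rewrite powRM ?divr_ge0 ?(ltW d0)// powR_natE ?invr_ge0// => le1.
  have le2 : M * a (k i) `^ beta <= M * (A * th ^+ i) `^ beta.
    by rewrite ler_wpM2l// ge0_ler_powR ?nnegrE ?a0 ?(ltW b0)// mulr_ge0// exprn_ge0// ltW.
  have E : M * (A * th ^+ i) `^ beta = (M * A `^ (beta - 1)) * A * (th ^+ i * (2^-1 `^ q) ^+ i).
    rewrite powRM ?exprn_ge0 ?(ltW th0)// -(@powR_pred_mul _ A beta A0) ?gt_eqF//.
    rewrite -(@powR_pred_mul _ (th ^+ i) beta) ?gt_eqF ?exprn_ge0 ?(ltW th0)//.
    by rewrite powR_natE ?(ltW th0)// thq; ring.
  have cpos : 0 < (d / 4) `^ q * (2^-1 `^ q) ^+ i.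
    by rewrite mulr_gt0 ?powR_gt0 ?divr_gt0// exprn_gt0// powR_gt0// invr_gt0.
  rewrite -(ler_pM2l cpos) (le_trans le1)// (le_trans le2)// E.
  have -> : (d / 4) `^ q * (2^-1 `^ q) ^+ i * (A * th ^+ i.+1) =
      ((d / 4) `^ q * th) * A * (th ^+ i * (2^-1 `^ q) ^+ i) by rewrite exprS; ring.
  rewrite ler_wpM2r ?mulr_ge0 ?exprn_ge0 ?powR_ge0 ?(ltW th0)// ler_wpM2r//.
  rewrite powRM ?invr_ge0 ?(ltW d0)// dq.
  rewrite powRV//.
  rewrite -ler_pdivrMr// ler_pdivlMr ?powR_gt0//.
  by rewrite /X mulrAC lerDl.
have bound i : a (1 + d) <= A * th ^+ i.
  apply: le_trans (key i); apply: a_mono; first by rewrite lerDl mulr_ge0 ?(ltW d0)// subr_ge0.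
  rewrite /k.
  have ih : 0 <= (2^-1 : R) ^+ i by rewrite exprn_ge0// invr_ge0.
  by rewrite mulrBr mulr1 lerD2l gerBl mulr_ge0// ltW.
apply/eqP; rewrite eq_le a0 andbT.
have cv : geometric A th @ \oo --> 0 by apply: cvg_geometric; rewrite gtr0_norm.
rewrite -(cvg_lim _ cv)//; apply: limr_ge; first by apply/cvg_ex; exists 0.
by near=> i; exact: bound.
Unshelve. all: by end_near.
Qed.

(** Either S <= 2 A, or more than half of S is paid for by C S^kap, and then S^(1 - kap) <= 2 C. *)
Lemma absorb (A C S kap : R) : 0 <= A -> 0 <= C -> 0 <= S -> 0 <= kap -> kap < 1 ->
  S <= A + C * S `^ kap -> S <= 2 * A + (2 * C) `^ (1 - kap)^-1.
Proof.
move=> A0 C0 S0 k0 k1 H.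
have [SA|SA] := leP S (2 * A); first by rewrite (le_trans SA)// lerDl powR_ge0.
apply: (@le_trans _ _ ((2 * C) `^ (1 - kap)^-1)); last by rewrite lerDr mulr_ge0.
have Sp : 0 < S by apply: le_lt_trans SA; rewrite mulr_ge0.
have H2 : S `^ (1 - kap) <= 2 * C.
  have SE : S `^ (1 - kap) * S `^ kap = S.
    by rewrite -powRD ?subrK ?powRr1// (gt_eqF Sp) implybT.
  by rewrite -(ler_pM2r (powR_gt0 kap Sp)) SE -mulrA; lra.
have k2 : 0 <= (1 - kap)^-1 by rewrite invr_ge0 subr_ge0 ltW.
have := ge0_ler_powR k2; rewrite /= => /(_ _ _ _ _ H2); rewrite !nnegrE.
rewrite -powRrM mulfV ?powRr1 ?gt_eqF ?subr_gt0//; apply; rewrite ?powR_ge0 ?mulr_ge0//.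
Qed.

(** For c > 0 and v > 1, comparable with min(v, 2^(J+1))^c up to constants. Being linear in the
    indicators of the level sets, it integrates to a weighted sum of their measures. *)
Definition dyadic (c : R) (J : nat) (v : R) : R :=
  \sum_(j < J.+1) (2 `^ c) ^+ j * (2 ^+ j < v)%R%:R.

Lemma dyadicS c J v : dyadic c J.+1 v = dyadic c J v + (2 `^ c) ^+ J.+1 * (2 ^+ J.+1 < v)%R%:R.
Proof. by rewrite /dyadic big_ord_recr. Qed.

Lemma dyadic0 c v : dyadic c 0 v = (1 < v)%R%:R.
Proof. by rewrite /dyadic big_ord1 !expr0 mul1r. Qed.

Lemma dyadic_ge0 c J v : 0 <= dyadic c J v.
Proof. by apply: sumr_ge0 => j _; rewrite mulr_ge0// exprn_ge0// powR_ge0. Qed.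

Lemma dyadic_le c J v : 1 <= c -> dyadic c J v <= 2 * (2 `^ c) ^+ J.
Proof.
move=> c1; have c2 : 2 <= (2 : R) `^ c by rewrite -[leLHS]powRr1// ler_powR// ler1n.
elim: J => [|J IH].
  by rewrite dyadic0 expr0 mulr1; case: (1 < v); rewrite ?ler1n.
rewrite dyadicS mulr2n mulrDl !mul1r lerD//.
  by rewrite (le_trans IH)// exprS ler_wpM2r ?exprn_ge0// powR_ge0.
by rewrite ler_piMr ?exprn_ge0 ?powR_ge0//; case: (_ < v).
Qed.

(** The largest active term dominates: as 2^c >= 2, the geometric sum is at most twice that term,
    whose e-th power is itself a term of the sum with exponent e c. *)
Lemma dyadic_powR c e J v : 1 <= c -> 0 < e ->
  dyadic c J v `^ e <= 2 `^ e * dyadic (e * c) J v.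
Proof.
move=> c1 e0; have E j : ((2 `^ c) ^+ j) `^ e = (2 `^ (e * c)) ^+ j :> R.
  by rewrite powR_natE ?powR_ge0// -powRrM mulrC.
elim: J => [|J IH].
  rewrite !dyadic0; case: (1 < v); last by rewrite powR0 ?gt_eqF// mulr0.
  rewrite -[true%:R]/(1 : R) powR1 mulr1 -[leLHS](powRr0 2) ler_powR ?ler1n//; exact: ltW.
have [vJ|vJ] := ltP (2 ^+ J.+1) v; last first.
  by rewrite !dyadicS ltNge vJ !mulr0 !addr0.
have p2 : 0 <= 2 * (2 `^ c) ^+ J.+1 :> R by rewrite mulr_ge0// exprn_ge0// powR_ge0.
apply: (@le_trans _ _ ((2 * (2 `^ c) ^+ J.+1) `^ e)).
  by rewrite ge0_ler_powR ?nnegrE ?dyadic_ge0 ?(ltW e0)// dyadic_le.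
rewrite powRM ?exprn_ge0 ?powR_ge0// E ler_wpM2l ?powR_ge0//.
by rewrite dyadicS vJ mulr1 lerDr dyadic_ge0.
Qed.

Lemma powR_le_dyadic t J v : 0 <= v -> 0 < t ->
  Num.min v (2 ^+ J) `^ t <= 1 + 2 `^ t * dyadic t J v.
Proof.
move=> v0 t0; elim: J => [|J IH].
  apply: (@le_trans _ _ 1); last by rewrite lerDl mulr_ge0 ?powR_ge0 ?dyadic_ge0.
  have := ge0_ler_powR (ltW t0); rewrite /= => /(_ (Num.min v (2 ^+ 0)) 1).
  by rewrite !nnegrE powR1; apply; rewrite ?le_min ?v0 ?ler01//= expr0 ?ler01// ge_min lexx orbT.
have [vJ|vJ] := ltP (2 ^+ J) v.
  apply: (@le_trans _ _ ((2 ^+ J.+1) `^ t)).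
    rewrite ge0_ler_powR ?nnegrE ?(ltW t0) ?le_min ?v0 ?exprn_ge0//.
    by rewrite ge_min lexx orbT.
  rewrite powR_natE// exprS (le_trans _ (_ : 2 `^ t * dyadic t J v <= _))//; last first.
    rewrite ler_wpDl// ler_wpM2l ?powR_ge0// dyadicS lerDl.
    by rewrite mulr_ge0// exprn_ge0// powR_ge0.
  rewrite ler_wpM2l ?powR_ge0//; case: J vJ {IH} => [|J] vJ.
    by rewrite dyadic0 -[1 < v]/(2 ^+ 0 < v) vJ.
  by rewrite dyadicS vJ mulr1 lerDr dyadic_ge0.
have -> : Num.min v (2 ^+ J.+1) = Num.min v (2 ^+ J).
  rewrite !min_l//; apply: le_trans vJ _.
  by rewrite exprS ler_peMl ?exprn_ge0// ler1n.
by rewrite (le_trans IH)// lerD2l ler_wpM2l ?powR_ge0// dyadicS lerDl mulr_ge0// exprn_ge0// powR_ge0.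
Qed.

End iteration.

(** * Fatou and Hoelder in the form used below *)

Section integration_tools.
Context d (X : measurableType d) (R : realType) (mu : {measure set X -> \bar R}).
Implicit Types f g : X -> R.

(** Fatou's lemma with eventual domination in place of convergence: dyadic sums jump at the levels
    2^j, so they need not converge along with their argument. *)
Lemma fatou_le (g : X -> R) (h : nat -> X -> R) (C : R) :
  measurable_fun setT g -> (forall x, 0 <= g x) ->
  (forall n, measurable_fun setT (h n)) -> (forall n x, 0 <= h n x) ->
  (forall n, (\int[mu]_x (h n x)%:E <= C%:E)%E) ->
  {ae mu, forall x, exists n0 : nat, forall n, (n0 <= n)%N -> g x <= h n x} ->
  (\int[mu]_x (g x)%:E <= C%:E)%E.
Proof.
move=> mg g0 mh h0 hC gh.
have mhE n : measurable_fun setT (EFin \o h n) by exact/measurable_EFinP.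
have h0E n x : setT x -> (0 <= (EFin \o h n) x)%E by rewrite lee_fin.
have einfs_le (a : nat -> \bar R) n : (einfs a n <= a n)%E.
  by apply: ereal_inf_lbound; exists n => /=.
have ae_le : (\int[mu]_x (g x)%:E <= \int[mu]_x limn_einf (fun n => (h n x)%:E))%E.
  apply: ae_ge0_le_integral => //.
  - by move=> x _; rewrite lee_fin.
  - exact/measurable_EFinP.
  - move=> x _; rewrite limn_einf_lim; apply: lime_ge; first exact: is_cvg_einfs.
    by apply: nearW => n; apply: le_ereal_inf_tmp => _ [k _ <-]; rewrite lee_fin.
  - rewrite (_ : (fun x => _) = fun x => (- limn_esup (fun n => - (h n x)%:E))%E); last first.
      by apply/funext => x; rewrite (limn_esupN (fun n => (h n x)%:E)) oppeK.
    apply: measurableT_comp => //; apply: measurable_fun_limn_esup => n.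
    by apply: (@measurableT_comp _ _ _ _ _ _ oppe) => //; exact: mhE.
  apply: filterS gh => x [n0 n0P] _; rewrite limn_einf_lim.
  apply: lime_ge; first exact: is_cvg_einfs.
  exists n0 => // n /= n0n; apply: le_ereal_inf_tmp => _ [k /= nk <-].
  by rewrite lee_fin n0P// (leq_trans n0n).
apply: le_trans ae_le _; apply: le_trans (fatou mu measurableT mhE h0E) _.
rewrite limn_einf_lim; apply: lime_le; first exact: is_cvg_einfs.
by apply: nearW => n; apply: le_trans (einfs_le _ _) _; exact: hC.
Qed.

Lemma real_hoelder f g (m : R) : 1 < m -> measurable_fun setT f -> measurable_fun setT g ->
  (\int[mu]_x (`|f x| `^ m)%:E < +oo)%E ->
  (\int[mu]_x (`|g x| `^ (m / (m - 1)))%:E < +oo)%E ->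
  mu.-integrable setT (EFin \o (fun x => `|f x| * g x)) /\
  \int[mu]_x (`|f x| * g x) <= (\int[mu]_x (`|f x| `^ m)) `^ m^-1 *
     (\int[mu]_x (`|g x| `^ (m / (m - 1)))) `^ (1 - m^-1).
Proof.
move=> m1 mf mg fm gm.
have m0 : 0 < m by exact: lt_trans ltr01 m1.
have m10 : 0 < m - 1 by rewrite subr_gt0.
have q0 : 0 < m / (m - 1) by rewrite divr_gt0.
have conj : m^-1 + (m / (m - 1))^-1 = 1 by field; rewrite !gt_eqF.
have mnf : measurable_fun setT (fun x => `|f x|) by exact: measurableT_comp.
have mfg : measurable_fun setT (fun x => `|f x| * g x) by exact: measurable_funM.
have H := hoelder mu mnf mg m0 q0 conj.
have normE (F : X -> R) r : 0 < r -> (\int[mu]_x (`|F x| `^ r)%:E < +oo)%E ->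
    Lnorm mu r%:E (EFin \o F) = ((\int[mu]_x (`|F x| `^ r)) `^ r^-1)%:E.
  move=> r0 Fr.
  have fin : (\int[mu]_x (`|F x| `^ r)%:E)%E \is a fin_num.
    rewrite ge0_fin_numE//; apply: integral_ge0 => x _; rewrite lee_fin; exact: powR_ge0.
  rewrite unlock -poweR_EFin /Rintegral (fineK fin).
  by congr poweR; apply: eq_integral.
have e : Lnorm mu m%:E (EFin \o (fun x => `|f x|)) = Lnorm mu m%:E (EFin \o f).
  by rewrite -[RHS]Lnorm_abse; exact: eq_Lnorm.
rewrite e (normE _ _ m0 fm) (normE _ _ q0 gm) Lnorm1 in H.
have ifg : mu.-integrable setT (EFin \o (fun x => `|f x| * g x)).
  apply/integrableP; split; first exact/measurable_EFinP.
  by apply: le_lt_trans H _; rewrite -EFinM ltry.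
split=> //; apply: le_trans (ler_norm _) _; apply: le_trans (le_normr_Rintegral _ ifg) _ => //.
have qE : 1 - m^-1 = (m / (m - 1))^-1 by lra.
rewrite qE -lee_fin EFinM.
apply: le_trans H.
rewrite /Rintegral fineK//.
by apply: integrable_fin_num => //; exact: integrable_norm ifg.
Qed.

Lemma integrable_powR_finite_support f (A : set X) (m : R) : measurable A ->
  (mu A < +oo)%E -> 1 <= m -> measurable_fun setT f -> (forall x, ~ A x -> f x = 0) ->
  (\int[mu]_x (`|f x| `^ m)%:E < +oo)%E -> mu.-integrable setT (EFin \o f).
Proof.
move=> mA Afin m1 mf f0 fm.
have m0 : m != 0 by rewrite gt_eqF// (lt_le_trans ltr01).
have mfm : measurable_fun setT (fun x => `|f x| `^ m).
  apply/(@measurableT_comp _ _ _ _ _ _ (@powR R ^~ m)) => //; exact: measurableT_comp.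
apply: (integrable_rle measurableT (g := fun x => \1_A x + `|f x| `^ m)) => //.
  move=> x _; have [xA|xA] := pselect (A x).
    by rewrite indicE mem_set//= ler1_powR.
  by rewrite f0// normr0 powR0// addr0.
apply: (@integrable_rD _ _ _ _ _ measurableT) => //.
  apply/integrableP; split; first by apply/measurable_EFinP; exact: measurable_indic.
  under eq_integral do rewrite /= ger0_norm//.
  by rewrite integral_indic// setIT.
apply/integrableP; split; first exact/measurable_EFinP.
by under eq_integral do rewrite /= ger0_norm ?powR_ge0//.
Qed.

End integration_tools.

(** * Bounds uniform in the approximate solutions *)

Section regularity.
Context {R : realType} {N : nat}.
Local Notation H := 'rV[R]_(N + N + 1).
Local Notation mu := (lebesgue_rV R (N + N + 1)).
Local Notation Q := (hdim R N).
Variables (Omega : set H) (s p alpha m : R) (delta f : H -> R).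
Hypotheses (N0 : (0 < N)%N) (oO : open Omega) (Ofin : (mu Omega < +oo)%E).
Hypotheses (p1 : 1 < p) (pQ : p < Q) (al0 : 0 < alpha) (m1 : 1 < m).
Hypotheses (de0 : forall x, Omega x -> 0 < delta x) (fm : LpOn Omega m%:E f).

Let fO := f \_ Omega.
Let mO : measurable Omega. Proof. exact: open_measurable_rV. Qed.
Let m0 : 0 < m. Proof. exact: lt_trans ltr01 m1. Qed.
Let p0 : 0 < p. Proof. exact: lt_trans ltr01 p1. Qed.
Let Q0 : 0 < Q. Proof. exact: lt_trans pQ. Qed.
Let mf : measurable_fun setT fO. Proof. by have [] := (Lfun_powRP _ _ m0).1 fm. Qed.
Let fOm : (\int[mu]_x (`|fO x| `^ m)%:E < +oo)%E.
Proof. by have [] := (Lfun_powRP _ _ m0).1 fm. Qed.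

Let fi : mu.-integrable setT (EFin \o fO).
Proof.
apply: (integrable_powR_finite_support mO Ofin (ltW m1) mf _ fOm) => x xO.
by rewrite /fO patchE; case: ifPn => // /set_mem.
Qed.

Let Nf := (\int[mu]_x (`|fO x| `^ m)) `^ m^-1.
Let Nf0 : 0 <= Nf. Proof. exact: powR_ge0. Qed.
Let mp0 : 0 < m / (m - 1). Proof. by rewrite divr_gt0// subr_gt0. Qed.

Let K := @level_const R N p.
Let K0 : 0 <= K.
Proof.
have pc0 l : 0 <= path_const p l by elim: l => //= l IH; rewrite mulr_ge0 ?powR_ge0// addr_ge0.
by rewrite /K /level_const /central_const !(mulr_ge0, addr_ge0) ?powR_ge0.
Qed.

Section solution.
Variables (n : nat) (v : H -> R).
Hypotheses (n0 : (0 < n)%N) (sol : approx_solution Omega p s alpha delta f n v).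

Let v0 : {ae mu, forall x, ~ Omega x -> v x = 0}. Proof. by case: sol => -[]. Qed.
Let mv : measurable_fun setT v.
Proof. by case: sol => -[[_ [G [[]]]]]. Qed.

Let a := level_measure v.
Let B k : set H := [set x | k < v x].
Let mB k : measurable (B k). Proof. exact: measurable_superlevel. Qed.
Let a0 k : 0 <= a k. Proof. exact: fine_ge0. Qed.

Let Bfin k : 0 <= k -> (mu (B k) < +oo)%E.
Proof. by move=> k0; apply: le_lt_trans Ofin; exact: superlevel_le. Qed.

Let aE k : 0 <= k -> mu (B k) = (a k)%:E.
Proof. by move=> k0; rewrite fineK// ge0_fin_numE// Bfin. Qed.

Lemma level_measure_le k : 0 <= k -> a k <= fine (mu Omega).
Proof.
move=> k0; rewrite -lee_fin -aE// fineK ?ge0_fin_numE//.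
exact: superlevel_le.
Qed.

Let F k := \int[mu]_x (`|fO x| * \1_(B k) x).

Let a_decay k h : 1 <= k -> 0 < h ->
  (h / 2) `^ (p - 1) * a (k + h) <= K * a k `^ (p / Q) * F k.
Proof. exact: (level_decay N0 oO Ofin p1 al0 de0 fi n0 sol). Qed.

Lemma level_mono k l : 1 <= k -> k <= l -> a l <= a k.
Proof.
move=> k1 kl; have k0 := le_trans ler01 k1; have l0 := le_trans k0 kl.
rewrite -lee_fin -!aE//; apply: le_measure; rewrite ?inE// => x /=.
exact: le_lt_trans.
Qed.

Let indic_powR k (r : R) : 0 < r -> 0 <= k ->
  (\int[mu]_x (`|\1_(B k) x : R| `^ r)%:E = (a k)%:E)%E.
Proof.
move=> r0 k0; rewrite -aE// -[in RHS](setIT (B k)) -integral_indic//.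
apply: eq_integral => x _; rewrite indicE; case: (_ \in _).
  by rewrite normr1 powR1.
by rewrite normr0 powR0// gt_eqF.
Qed.

Let F_le k : 0 <= k -> F k <= Nf * a k `^ (1 - m^-1).
Proof.
move=> k0; have E := indic_powR mp0 k0.
have [_] := real_hoelder m1 mf (measurable_indic (mB k) : measurable_fun setT (\1_(B k) : H -> R)) fOm
  (eq_ind_r (fun z => z < +oo)%E (ltry _) E).
by rewrite /Rintegral E.
Qed.

(** The power of the level measure left after Hoelder. It exceeds 1 exactly when m > Q/p, which
    decides between iteration and absorption. *)
Let beta := p / Q + (1 - m^-1).
Let im1 : 0 < 1 - m^-1. Proof. by rewrite subr_gt0 invf_lt1. Qed.
Let pq0 : 0 < p / Q. Proof. by rewrite divr_gt0. Qed.
Let beta0 : 0 < beta. Proof. by rewrite addr_gt0. Qed.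

Let betaE x : x `^ beta = x `^ (p / Q) * x `^ (1 - m^-1).
Proof. by rewrite powRD// -/beta (gt_eqF beta0). Qed.

Lemma level_iteration k h : 1 <= k -> 0 < h ->
  (h / 2) `^ (p - 1) * a (k + h) <= K * Nf * a k `^ beta.
Proof.
move=> k1 h0; apply: le_trans (a_decay k1 h0) _.
apply: (@le_trans _ _ (K * a k `^ (p / Q) * (Nf * a k `^ (1 - m^-1)))).
  apply: ler_wpM2l; first by rewrite mulr_ge0 ?powR_ge0.
  exact: F_le (le_trans ler01 k1).
by rewrite betaE le_eqVlt; apply/orP; left; apply/eqP; ring.
Qed.

Lemma level_eq0_le k : 0 <= k -> a k = 0 -> {ae mu, forall x, v x <= k}.
Proof.
move=> k0 ak0; exists (B k); split=> //; first by rewrite aE// ak0.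
by move=> x /= /negP; rewrite -ltNge.
Qed.

Definition level_sum (c : R) (J : nat) := \sum_(j < J.+1) (2 `^ c) ^+ j * a (2 ^+ j).

Lemma measurable_dyadic c J : measurable_fun setT (fun x => dyadic c J (v x)).
Proof.
rewrite /dyadic; apply: measurable_sum => j; apply: measurable_funM => //.
rewrite (_ : (fun x => _) = \1_(B (2 ^+ j)) :> (H -> R)); first exact: measurable_indic.
by apply/funext => x; rewrite indicE; congr (_%:R); congr nat_of_bool; apply/idP/idP => [?|/set_mem//]; exact: mem_set.
Qed.

Lemma integral_dyadic c J :
  (\int[mu]_x (dyadic c J (v x))%:E = (level_sum c J)%:E)%E.
Proof.
have dB j x : (2 ^+ j < v x)%R%:R = \1_(B (2 ^+ j)) x :> R.
  by rewrite indicE; congr (_%:R); congr nat_of_bool; apply/idP/idP => [?|/set_mem//]; exact: mem_set.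
have two j : 0 <= (2 : R) ^+ j by rewrite exprn_ge0.
have mi j : measurable_fun setT (EFin \o (fun x => (2 `^ c) ^+ j * \1_(B (2 ^+ j)) x)).
  by apply/measurable_EFinP; apply: measurable_funM => //; exact: measurable_indic.
have i1 j : (\int[mu]_x ((2 `^ c) ^+ j * \1_(B (2 ^+ j)) x)%:E = ((2 `^ c) ^+ j * a (2 ^+ j))%:E)%E.
  under eq_integral do rewrite EFinM.
  apply: etrans (integral_cst_indic mu (mB (2 ^+ j)) (exprn_ge0 j (powR_ge0 2 c))) _.
  by rewrite EFinM; congr (_ * _)%E; exact: aE.
elim: J => [|J IH].
  rewrite /level_sum big_ord1 -i1; apply: eq_integral => x _.
  by rewrite /dyadic big_ord1 dB.
rewrite /level_sum big_ord_recr -/(level_sum c J) EFinD -IH -[in RHS]i1.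
rewrite -ge0_integralD//.
- by apply: eq_integral => x _; rewrite dyadicS dB EFinD.
- by move=> x _; rewrite lee_fin dyadic_ge0.
- by apply/measurable_EFinP; exact: measurable_dyadic.
- exact: mi.
Qed.

Lemma sum_energy_dyadic c J :
  mu.-integrable setT (EFin \o (fun x => `|fO x| * dyadic c J (v x))) /\
  \sum_(j < J.+1) (2 `^ c) ^+ j * F (2 ^+ j) = \int[mu]_x (`|fO x| * dyadic c J (v x)).
Proof.
have dB j x : (2 ^+ j < v x)%R%:R = \1_(B (2 ^+ j)) x :> R.
  by rewrite indicE; congr (_%:R); congr nat_of_bool; apply/idP/idP => [?|/set_mem//]; exact: mem_set.
have iF j : mu.-integrable setT (EFin \o (fun x => `|fO x| * \1_(B (2 ^+ j)) x)).
  apply: (integrable_rle measurableT (g := fun x => `|fO x|)).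
  - by apply: measurable_funM; [exact: measurableT_comp|exact: measurable_indic].
  - move=> x _; rewrite normrM normr_id ler_piMr// indicE.
    by case: (_ \in _); rewrite ?normr1 ?normr0.
  - exact: integrable_norm fi.
have iG j : mu.-integrable setT (EFin \o (fun x => (2 `^ c) ^+ j * (`|fO x| * \1_(B (2 ^+ j)) x))).
  exact: integrable_rZ (iF j).
have G j : \int[mu]_x ((2 `^ c) ^+ j * (`|fO x| * \1_(B (2 ^+ j)) x)) = (2 `^ c) ^+ j * F (2 ^+ j).
  by rewrite RintegralZl.
elim: J => [|J [IH1 IH2]].
  have E x : `|fO x| * dyadic c 0 (v x) = (2 `^ c) ^+ 0 * (`|fO x| * \1_(B (2 ^+ 0)) x).
    by rewrite /dyadic big_ord1 dB mulrCA.
  split; first by apply: eq_integrable (iG 0%N) => // x _; rewrite /= E.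
  by rewrite big_ord1 -G; apply: eq_Rintegral => x _; rewrite E.
have E x : `|fO x| * dyadic c J.+1 (v x) =
    `|fO x| * dyadic c J (v x) + (2 `^ c) ^+ J.+1 * (`|fO x| * \1_(B (2 ^+ J.+1)) x).
  by rewrite dyadicS dB; ring.
split; first by apply: eq_integrable (integrable_rD measurableT IH1 (iG J.+1)) => // x _; rewrite /= E.
by rewrite big_ord_recr/= IH2 -G -RintegralD//; apply: eq_Rintegral => x _; rewrite E.
Qed.

Let Mf := Nf * (2 `^ (m / (m - 1))) `^ (1 - m^-1).

(** Hoelder is applied once to f against the whole dyadic sum, not level by level; [dyadic_powR]
    then turns the m'-th power of a sum of weights 2^(c j) into one of weights 2^(m' c j). *)
Lemma sum_energy_le c J : 1 <= c ->
  \sum_(j < J.+1) (2 `^ c) ^+ j * F (2 ^+ j) <=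
  Mf * level_sum (m / (m - 1) * c) J `^ (1 - m^-1).
Proof.
move=> c1; have [_ ->] := sum_energy_dyadic c J.
set q := m / (m - 1); set S := level_sum _ _.
have ES := integral_dyadic (q * c) J.
have md := measurable_dyadic c J.
have le1 : (\int[mu]_x (`|dyadic c J (v x)| `^ q)%:E <= (2 `^ q * S)%:E)%E.
  have md' : measurable_fun setT (fun x => (dyadic (q * c) J (v x))%:E).
    by apply/measurable_EFinP; exact: measurable_dyadic.
  have d0 x : setT x -> (0 <= (dyadic (q * c) J (v x))%:E)%E.
    by rewrite lee_fin dyadic_ge0.
  rewrite EFinM -ES -(ge0_integralZl mu measurableT md' d0) ?lee_fin ?powR_ge0//.
  apply: ge0_le_integral => //.
  - apply/measurable_EFinP/(@measurableT_comp _ _ _ _ _ _ (@powR R ^~ q)) => //.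
    exact: measurableT_comp.
  - by apply: measurable_funeM; apply/measurable_EFinP; exact: measurable_dyadic.
  - by move=> x _; rewrite lee_fin ger0_norm ?dyadic_ge0// dyadic_powR.
have [_ H] := real_hoelder m1 mf md fOm (le_lt_trans le1 (ltry _)).
apply: le_trans H _; rewrite /Mf -mulrA ler_wpM2l//.
have S0 : 0 <= S by apply: sumr_ge0 => j _; rewrite mulr_ge0// exprn_ge0// powR_ge0.
rewrite -powRM ?powR_ge0// ge0_ler_powR ?nnegrE ?(ltW im1) ?mulr_ge0 ?powR_ge0//.
  by apply: Rintegral_ge0 => x _; exact: powR_ge0.
by rewrite -lee_fin /Rintegral fineK// ge0_fin_numE ?(le_lt_trans le1 (ltry _))// integral_ge0// => x _; rewrite lee_fin powR_ge0.
Qed.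

Lemma level_sum_ge0 c J : 0 <= level_sum c J.
Proof. by apply: sumr_ge0 => j _; rewrite mulr_ge0// exprn_ge0// powR_ge0. Qed.

(** The relation between t and gam splits the weight 2^(t j) into 2^(gam j), which goes with the
    energy, 2^((p-1) j), which the decay estimate consumes, and (2^(t j))^(p/Q), which joins the
    power of a(2^j). *)
Lemma level_sum_step t gam J j : t * (1 - p / Q) = gam + (p - 1) -> (j <= J)%N ->
  (2 `^ t) ^+ j.+1 * a (2 ^+ j.+1) <=
  2 `^ t * 2 `^ (p - 1) * K * level_sum t J `^ (p / Q) * ((2 `^ gam) ^+ j * F (2 ^+ j)).
Proof.
move=> tE jJ.
have two : 0 < (2 : R) ^+ j by rewrite exprn_gt0.
have two1 : 1 <= (2 : R) ^+ j by rewrite exprn_ege1// ler1n.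
have := a_decay two1 two.
have -> : 2 ^+ j + 2 ^+ j = 2 ^+ j.+1 :> R by rewrite exprS; ring.
rewrite powRM ?invr_ge0 ?(ltW two)// powR_natE// powRV// => dec.
set X := (2 `^ t) ^+ j; set Z := (2 `^ (p - 1)) ^+ j; set W := (2 `^ gam) ^+ j.
have X0 : 0 < X by rewrite exprn_gt0// powR_gt0.
have Z0 : 0 < Z by rewrite exprn_gt0// powR_gt0.
have W0 : 0 < W by rewrite exprn_gt0// powR_gt0.
set c := 2 `^ (p - 1); have c0 : 0 < c by rewrite powR_gt0.
have XE : X = W * X `^ (p / Q) * Z.
  rewrite /X /W /Z powR_natE ?powR_ge0// -!exprMn; congr (_ ^+ _).
  rewrite -powRrM -!powRD ?pnatr_eq0 ?implybT//; congr (_ `^ _).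
  by move: tE; set r := p / Q; lra.
(* The product 2^(t j) a(2^j) is a single term of [level_sum t J], hence bounded by the whole
   sum. *)
have le1 : X `^ (p / Q) * a (2 ^+ j) `^ (p / Q) <= level_sum t J `^ (p / Q).
  rewrite -powRM ?(ltW X0)// ge0_ler_powR ?nnegrE ?(ltW pq0) ?mulr_ge0 ?(ltW X0) ?level_sum_ge0//.
  rewrite /level_sum (bigD1 (Ordinal (jJ : (j < J.+1)%N)))//= lerDl.
  by apply: sumr_ge0 => i _; rewrite mulr_ge0// exprn_ge0// powR_ge0.
have F0 : 0 <= F (2 ^+ j) by apply: Rintegral_ge0 => x _; rewrite mulr_ge0.
have le2 : Z * a (2 ^+ j.+1) <= c * (K * a (2 ^+ j) `^ (p / Q) * F (2 ^+ j)).
  by rewrite -ler_pdivrMl// mulrA [c^-1 * Z]mulrC.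
rewrite exprS -/X.
have -> : 2 `^ t * X * a (2 ^+ j.+1) = 2 `^ t * (W * X `^ (p / Q)) * (Z * a (2 ^+ j.+1)).
  by rewrite [in LHS]XE; ring.
apply: (@le_trans _ _ (2 `^ t * (W * X `^ (p / Q)) * (c * (K * a (2 ^+ j) `^ (p / Q) * F (2 ^+ j))))).
  by rewrite ler_wpM2l// mulr_ge0 ?powR_ge0// mulr_ge0 ?powR_ge0// ltW.
have -> : 2 `^ t * (W * X `^ (p / Q)) * (c * (K * a (2 ^+ j) `^ (p / Q) * F (2 ^+ j))) =
  (2 `^ t * c * K * (W * F (2 ^+ j))) * (X `^ (p / Q) * a (2 ^+ j) `^ (p / Q)) by ring.
have -> : 2 `^ t * c * K * level_sum t J `^ (p / Q) * (W * F (2 ^+ j)) =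
  (2 `^ t * c * K * (W * F (2 ^+ j))) * level_sum t J `^ (p / Q) by ring.
apply: ler_wpM2l => //; apply: mulr_ge0; last by apply: mulr_ge0 => //; exact: ltW.
by apply: mulr_ge0 => //; apply: mulr_ge0; exact: powR_ge0.
Qed.

(** The decay estimate starts at level 1 and gives the terms from level 2 on; the level 2^0 is
    simply bounded by the measure of Omega. *)
Lemma level_sum_le t gam J : t * (1 - p / Q) = gam + (p - 1) -> t = m / (m - 1) * gam ->
  1 <= gam -> level_sum t J <= fine (mu Omega) +
    2 `^ t * 2 `^ (p - 1) * K * Mf * level_sum t J `^ beta.
Proof.
move=> tE tg g1.
set C := 2 `^ t * 2 `^ (p - 1) * K; set S := level_sum t J.
have C0 : 0 <= C by apply: mulr_ge0 => //; apply: mulr_ge0; exact: powR_ge0.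
have F0 j : 0 <= F (2 ^+ j) by apply: Rintegral_ge0 => x _; rewrite mulr_ge0.
have sE : \sum_(j < J.+1) (2 `^ gam) ^+ j * F (2 ^+ j) <= Mf * S `^ (1 - m^-1).
  by have := sum_energy_le J g1; rewrite -tg.
apply: (@le_trans _ _ (fine (mu Omega) +
    \sum_(j < J) C * S `^ (p / Q) * ((2 `^ gam) ^+ j * F (2 ^+ j)))).
  rewrite {1}/S /level_sum big_ord_recl; apply: lerD.
    by rewrite expr0 mul1r expr0 level_measure_le.
  by apply: ler_sum => j _; apply: level_sum_step => //; exact: ltnW.
rewrite lerD2l -mulr_sumr.
apply: (@le_trans _ _ (C * S `^ (p / Q) * (Mf * S `^ (1 - m^-1)))).
  apply: ler_wpM2l; first by rewrite mulr_ge0 ?powR_ge0.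
  apply: le_trans sE.
  by rewrite big_ord_recr/= lerDl mulr_ge0// exprn_ge0// powR_ge0.
by rewrite betaE le_eqVlt; apply/orP; left; apply/eqP; ring.
Qed.

End solution.

Lemma approx_bounded : Q / p < m -> exists M : R, forall n v, (0 < n)%N ->
  approx_solution Omega p s alpha delta f n v -> {ae mu, forall x, v x <= M}.
Proof.
move=> Qpm.
have b1 : 1 < p / Q + (1 - m^-1).
  have : m^-1 < p / Q by rewrite -invf_div ltf_pV2 ?posrE// divr_gt0.
  by set x := p / Q; set y := m^-1; lra.
have [d d0 dP] := @stampacchia R (p - 1) (K * Nf) _ (fine (mu Omega))
  (eq_ind_r is_true p1 (subr_gt0 1 p)) (mulr_ge0 K0 Nf0) b1 (fine_ge0 (measure_ge0 mu Omega)).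
exists (1 + d) => n v n0 sol.
apply: (level_eq0_le sol); first by rewrite addr_ge0// ltW.
apply: dP.
- exact: (level_mono sol).
- by move=> k; exact: fine_ge0.
- exact: (level_measure_le sol).
- exact: (level_iteration n0 sol).
Qed.

(** The constant precedes n, v and J. For m < Q/p the exponent beta is below 1, so [absorb] applies
    to the finite sum. *)
Lemma approx_dyadic_bound t gam : m < Q / p -> t * (1 - p / Q) = gam + (p - 1) ->
  t = m / (m - 1) * gam -> 1 <= gam -> exists C : R, forall n v J, (0 < n)%N ->
  approx_solution Omega p s alpha delta f n v ->
  (\int[mu]_x (dyadic t J (v x))%:E <= C%:E)%E.
Proof.
move=> mQp tE tg g1.
have b0 : 0 <= p / Q + (1 - m^-1).
  by rewrite addr_ge0 ?divr_ge0 ?(ltW p0) ?(ltW Q0)// subr_ge0 invf_le1 ?ltW.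
have b1 : p / Q + (1 - m^-1) < 1.
  have : p / Q < m^-1 by rewrite -invf_div ltf_pV2 ?posrE ?divr_gt0.
  by set x := p / Q; set y := m^-1; lra.
set C0 := 2 `^ t * 2 `^ (p - 1) * K * (Nf * (2 `^ (m / (m - 1))) `^ (1 - m^-1)).
have C00 : 0 <= C0.
  apply: mulr_ge0; last by rewrite mulr_ge0 ?powR_ge0.
  by apply: mulr_ge0 => //; apply: mulr_ge0; exact: powR_ge0.
exists (2 * fine (mu Omega) + (2 * C0) `^ (1 - (p / Q + (1 - m^-1)))^-1) => n v J n0 sol.
rewrite (integral_dyadic sol) lee_fin; apply: absorb => //.
- by rewrite fine_ge0.
- exact: level_sum_ge0.
- exact: (level_sum_le n0 sol J tE tg g1).
Qed.

End regularity.

(** * Passage to the limit in the dyadic sums *)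

Section dyadic_limit.
Context {R : realType}.

Lemma dyadic_leS (c : R) (J n : nat) v : (J <= n)%N -> dyadic c J v <= dyadic c n v.
Proof.
elim: n => [|n IH]; first by rewrite leqn0 => /eqP ->.
rewrite leq_eqVlt => /predU1P[->//|/IH le1]; apply: le_trans le1 _.
by rewrite dyadicS lerDl mulr_ge0// exprn_ge0// powR_ge0.
Qed.

(** The inequality 2^j < v is strict, hence inherited by w n for large n: each indicator is lower
    semicontinuous. *)
Lemma dyadic_near (c : R) (J : nat) (w : nat -> R) (v : R) : w n @[n --> \oo] --> v ->
  \forall n \near \oo, dyadic c J v <= dyadic c J (w n).
Proof.
move=> wv.
have step j : \forall n \near \oo, (2 ^+ j < v)%R%:R <= (2 ^+ j < w n)%R%:R :> R.
  have [jv|jv] := ltP (2 ^+ j) v; last by apply: nearW => n; case: (_ < _).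
  have wj : \forall n \near \oo, 2 ^+ j < w n by exact: cvgr_gt wv _ jv.
  by near=> n; rewrite (_ : 2 ^+ j < w n)//; near: n.
elim: J => [|J IH].
  by have := step 0%N; apply: filterS => n; rewrite !dyadic0 expr0.
have := step J.+1; apply: filterS2 IH => n le1 le2.
by rewrite !dyadicS lerD// ler_wpM2l ?exprn_ge0 ?powR_ge0.
Unshelve. all: by end_near.
Qed.

(** The index n is both the rank of the approximation and the number of levels, so one sequence of
    functions suffices in Fatou's lemma. A J with v <= 2^J removes the truncation. *)
Lemma powR_le_dyadic_near (t v : R) (w : nat -> R) : 0 < t -> 0 <= v ->
  w n @[n --> \oo] --> v ->
  exists n0 : nat, forall n, (n0 <= n)%N -> v `^ t <= 1 + 2 `^ t * dyadic t n (w n).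
Proof.
move=> t0 v0 wv.
pose J := (Num.truncn v).+1.
have vJ : v <= 2 ^+ J.
  apply: (@le_trans _ _ J%:R); first by rewrite ltW// truncnS_gt.
  by rewrite -natrX ler_nat ltnW// ltn_expl.
have [n1 _ n1P] := dyadic_near t J wv.
exists (maxn n1 J) => n; rewrite geq_max => /andP[n1n Jn].
have := powR_le_dyadic J v0 t0; rewrite min_l// => le1; apply: le_trans le1 _.
rewrite lerD2l ler_wpM2l ?powR_ge0//; apply: le_trans (dyadic_leS t (w n) Jn).
exact: n1P.
Qed.

End dyadic_limit.

(** * Arithmetic of the exponents *)

Section exponents.
Context {R : realType}.
Variables (Q p m ds : R).
Hypotheses (p1 : 1 < p) (pQ : p < Q) (ds1 : 1 <= ds).
Let p0 : 0 < p. Proof. exact: lt_trans ltr01 p1. Qed.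
Let Q0 : 0 < Q. Proof. exact: lt_trans pQ. Qed.
Hypothesis mlow : Q * (ds + p - 1) / (Q * (p - 1) + ds * p) <= m.
Hypothesis mup : m < Q / p.

Let mlow' : Q * (ds + p - 1) <= m * (Q * (p - 1) + ds * p).
Proof.
have p10 : 0 < p - 1 by rewrite subr_gt0.
have ds0 : 0 < ds := lt_le_trans ltr01 ds1.
by rewrite -ler_pdivrMr// addr_gt0// mulr_gt0.
Qed.

Let mup' : m * p < Q. Proof. by rewrite -ltr_pdivlMr. Qed.

(** If m <= 1, the lower bound on m would force ds (Q - p) <= 0. *)
Lemma exponent_gt1 : 1 < m.
Proof.
rewrite ltNge; apply/negP => m1.
have p10 : 0 < p - 1 by rewrite subr_gt0.
have ds0 : 0 < ds := lt_le_trans ltr01 ds1.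
have D0 : 0 <= Q * (p - 1) + ds * p by rewrite addr_ge0// mulr_ge0// ltW.
have := le_trans mlow' (ler_wpM2r D0 m1); rewrite mul1r.
have : 0 < ds * (Q - p) by rewrite mulr_gt0// subr_gt0.
by lra.
Qed.

Let gamma := Q * (p - 1) * (m - 1) / (Q - m * p).
Let D0 : 0 < Q - m * p. Proof. by rewrite subr_gt0. Qed.

(** For ds = 1 the lower bound on m says exactly gamma >= 1; a larger ds only adds the nonnegative
    surplus (ds - 1) (Q - m p). *)
Lemma exponent_gamma_ge1 : 1 <= gamma.
Proof.
rewrite /gamma ler_pdivlMr// mul1r.
have : 0 <= (ds - 1) * (Q - m * p) by rewrite mulr_ge0 ?subr_ge0// ltW.
by have := mlow'; lra.
Qed.

Lemma exponent_t : m / (m - 1) * gamma * (1 - p / Q) = gamma + (p - 1).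
Proof.
have h1 : m - 1 != 0 by rewrite subr_eq0 gt_eqF// exponent_gt1.
by rewrite /gamma; field; rewrite h1 (gt_eqF Q0) (gt_eqF D0).
Qed.

End exponents.

Theorem theorem1p3 (R : realType) (N : nat) (Omega : set 'rV[R]_(N + N + 1))
    (s p alpha delta_star eps m : R)
    (delta f u : 'rV[R]_(N + N + 1) -> R)
    (u_ : nat -> 'rV[R]_(N + N + 1) -> R) :
  let mu := lebesgue_rV R (N + N + 1) in
  let Q := hdim R N in
  (1 <= N)%N ->
  bounded_smooth_domain Omega ->
  0 < s -> s < 1 -> 1 < p -> p < Q -> 0 < alpha ->
  {within closure Omega, continuous delta} ->
  (forall x, closure Omega x -> 0 < delta x) ->
  1 <= delta_star -> 0 < eps ->
  (forall x, Omega x -> (cc_dist_set x (boundary Omega) < eps%:E)%E ->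
    delta x <= delta_star) ->
  LpOn Omega m%:E f ->
  ~ {ae mu, forall x, Omega x -> f x = 0} ->
  {ae mu, forall x, Omega x -> 0 <= f x} ->
  (forall n, (0 < n)%N -> approx_solution Omega p s alpha delta f n (u_ n)) ->
  (forall n, (0 < n)%N -> {ae mu, forall x, u_ n x <= u_ n.+1 x}) ->
  {ae mu, forall x, u_ n x @[n --> \oo] --> u x} ->
  weak_solution Omega p s alpha delta f u ->
  (Q * (delta_star + p - 1) / (Q * (p - 1) + delta_star * p) <= m ->
   m < Q / p ->
   let gamma := Q * (p - 1) * (m - 1) / (Q - m * p) in
   let t := conj_exp m * gamma in
   LpOn Omega t%:E u) /\
  (Q / p < m -> LpOn Omega +oo%E u).

Proof.
move=> mu Q N0 [oO _ _ bO _] _ _ p1 pQ al0 _ de0 ds1 _ _ fm _ _ sol _ ucv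
  [[_ uLp] _ [u0 _] _ _].
have mO := open_measurable_rV oO.
have Ofin : (mu Omega < +oo)%E := bounded_finite_measure mO bO.
have dO x : Omega x -> 0 < delta x by move=> xO; apply: de0; exact: subset_closure.
have p10 : 0 < p - 1 by rewrite subr_gt0.
(* Measurability of u on Omega is read off from its membership in L^(p-1), part of being a weak
   solution. *)
have mu_ : measurable_fun setT (u \_ Omega) by have [] := (Lfun_powRP _ _ p10).1 uLp.
split=> [mlow mup|Qpm].
  pose gamma := Q * (p - 1) * (m - 1) / (Q - m * p).
  pose t := conj_exp m * gamma.
  rewrite -[is_true _]/(is_true (LpOn Omega t%:E u)).
  have m1 := exponent_gt1 p1 pQ ds1 mlow.
  have g1 : 1 <= gamma := exponent_gamma_ge1 p1 pQ ds1 mlow mup.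
  have tE : t * (1 - p / Q) = gamma + (p - 1) := exponent_t p1 pQ ds1 mlow mup.
  have t0 : 0 < t by rewrite mulr_gt0 ?(lt_le_trans ltr01 g1)// divr_gt0 ?subr_gt0// (lt_trans ltr01).
  have [C CP] := approx_dyadic_bound s N0 oO Ofin p1 pQ al0 m1 dO fm mup tE erefl g1.
  apply/(Lfun_powRP _ _ t0); split=> //.
  (* The indicator of Omega stands for the constant 1 of [powR_le_dyadic_near] and is integrable
     because Omega has finite measure; indices start at 1, where the approximations do. *)
  pose h n x := \1_Omega x + 2 `^ t * dyadic t n (u_ n.+1 x) : R.
  have md n : measurable_fun setT (fun x => dyadic t n (u_ n.+1 x)).
    exact: (measurable_dyadic (sol n.+1 _)).
  have mh n : measurable_fun setT (h n).
    apply: measurable_funD; first exact: measurable_indic.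
    exact: measurable_funM.
  have d0 n x : 0 <= 2 `^ t * dyadic t n (u_ n.+1 x) by rewrite mulr_ge0 ?powR_ge0 ?dyadic_ge0.
  have i0 x : 0 <= (\1_Omega x : R) by rewrite indicE.
  have hC n : (\int[mu]_x (h n x)%:E <= (fine (mu Omega) + 2 `^ t * C)%:E)%E.
    have -> : (\int[mu]_x (h n x)%:E = \int[mu]_x ((\1_Omega x)%:E + (2 `^ t * dyadic t n (u_ n.+1 x))%:E))%E.
      by apply: eq_integral => x _; rewrite EFinD.
    have mi : measurable_fun setT (fun x => (\1_Omega x : R)%:E).
      by apply/measurable_EFinP; exact: measurable_indic.
    have mdE : measurable_fun setT (fun x => (dyadic t n (u_ n.+1 x))%:E) by exact/measurable_EFinP.
    have mdE2 : measurable_fun setT (fun x => (2 `^ t * dyadic t n (u_ n.+1 x))%:E).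
      by apply/measurable_EFinP; exact: measurable_funM.
    have dE0 x : setT x -> (0 <= (dyadic t n (u_ n.+1 x))%:E)%E by rewrite lee_fin dyadic_ge0.
    have iE0 x : setT x -> (0 <= (\1_Omega x : R)%:E)%E by rewrite lee_fin.
    have dE1 x : setT x -> (0 <= (2 `^ t * dyadic t n (u_ n.+1 x))%:E)%E by rewrite lee_fin.
    rewrite (ge0_integralD mu measurableT iE0 mi dE1 mdE2) EFinD leeD//.
      by rewrite integral_indic// setIT fineK// ge0_fin_numE.
    under eq_integral do rewrite EFinM.
    rewrite (ge0_integralZl mu measurableT mdE dE0) ?lee_fin ?powR_ge0//.
    rewrite EFinM; apply: lee_wpmul2l; first by rewrite lee_fin powR_ge0.
    by apply: (CP n.+1 _ n _ (sol _ _)).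
  apply: (@le_lt_trans _ _ (fine (mu Omega) + 2 `^ t * C)%:E); last exact: ltry.
  apply: (fatou_le _ _ mh _ hC).
  - apply/(@measurableT_comp _ _ _ _ _ _ (@powR R ^~ t)) => //.
    exact: measurableT_comp.
  - by move=> x; exact: powR_ge0.
  - by move=> n x; rewrite addr_ge0.
  - apply: filterS2 u0 ucv => x ux0 ux; rewrite patchE.
    case: ifPn => xO; last first.
      exists 0%N => n _; rewrite normr0 powR0 ?gt_eqF// addr_ge0//.
    have ux' : u_ n.+1 x @[n --> \oo] --> u x by move: ux; rewrite -cvg_shiftS.
    have [n0 n0P] := powR_le_dyadic_near t0 ux0 ux'.
    exists n0 => n n0n; rewrite ger0_norm// /h indicE xO; exact: n0P.
(* Here m > Q/p > 1, since p < Q. *)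
have m1 : 1 < m by apply: lt_trans Qpm; rewrite ltr_pdivlMr ?mul1r// (lt_trans ltr01).
have [M MP] := approx_bounded s N0 oO Ofin p1 pQ al0 m1 dO fm Qpm.
apply/Lfun_inftyP; split=> //; exists `|M|.
have uM : {ae mu, forall x, forall n, u_ n.+1 x <= M}.
  by apply: ae_foralln => n; apply: MP (sol _ _).
apply: filterS3 uM u0 ucv => x uMx ux0 ux; rewrite patchE.
case: ifPn => _; last by rewrite normr0.
rewrite ger0_norm// (le_trans _ (ler_norm M))// -(cvg_lim _ ux)//.
apply: limr_le; first by apply/cvg_ex; exists (u x).
by exists 1%N => // n /= n1; rewrite -(prednK n1).
Qed.
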